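(* Let $X$ be a measure space and $\Gamma$ an $\mathrm{L}^1(X)$-normed module. Then the following assertions hold. (i) There is a measurable Banach bundle $E$ over $X$ such that $\Gamma^1(E)$ is isometrically isomorphic to $\Gamma$ (as a Banach module over $\mathrm{L}^\infty(X)$). (ii) If $\Gamma$ is separable, then there is a separable measurable Banach bundle $E$ over $X$ such that $\Gamma^1(E)$ is isometrically isomorphic to $\Gamma$ (as a Banach module over $\mathrm{L}^\infty(X)$). Moreover, this separable bundle $E$ is unique up to isometric isomorphy.
   Context: All vector spaces are over a fixed field $\mathbb{K}\in\{\mathbb{R},\mathbb{C}\}$. A measure space $X=(\Omega_X,\Sigma_X,\mu_X)$ is always $\sigma$-finite and complete. Banach module over $\mathrm{L}^\infty(X)$: a Banach space $\Gamma$ that is an $\mathrm{L}^\infty(X)$-module with $\|fs\|\le\|f\|\|s\|$, always assumed non-degenerate ($\Gamma=\overline{\mathrm{lin}}\{fs\}$, equivalently unitary). An $\mathrm{L}^1(X)$-normed module is a Banach module $\Gamma$ over $\mathrm{L}^\infty(X)$ together with a map $|\cdot|\colon\Gamma\to\mathrm{L}^\infty(X)'_+$ such that $\||s|\|=\|s\|$, $|fs|=|f|\cdot|s|$, $|s_1+s_2|\le|s_1|+|s_2|$ for all $s,s_1,s_2\in\Gamma$, $f\in\mathrm{L}^\infty(X)$, and such that $|s|$ lies in the canonical image of $\mathrm{L}^1(X)$ in $\mathrm{L}^\infty(X)'$ for every $s$ (so $|\cdot|$ is regarded as a map $\Gamma\to\mathrm{L}^1(X)_+$). Measurable Banach bundle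 over $X$: a triple $(E,p_E,\mathcal{M}_E)$ with $E$ a set, $p_E\colon E\to\Omega_X$ surjective, each fiber $E_x=p_E^{-1}(x)$ a Banach space, and $\mathcal{M}_E$ a linear subspace of the space $\mathcal{S}_E$ of all sections ($s\colon\Omega_X\to E$ with $p_E\circ s=\mathrm{id}$) such that (i) $fs\in\mathcal{M}_E$ for measurable $f\colon\Omega_X\to\mathbb{K}$ and $s\in\mathcal{M}_E$; (ii) $|s|\colon x\mapsto\|s(x)\|_{E_x}$ is measurable for $s\in\mathcal{M}_E$; (iii) if $(s_n)$ in $\mathcal{M}_E$ converges almost everywhere to $s\in\mathcal{S}_E$, then $s\in\mathcal{M}_E$. It is separable if there is a sequence $(s_n)$ in $\mathcal{M}_E$ with $\mathrm{lin}\{s_n(x):n\in\mathbb{N}\}$ dense in $E_x$ for almost every $x$. $\Gamma^1(E)$ is the space of $s\in\mathcal{M}_E$ with $|s|$ integrable, modulo sections vanishing almost everywhere, with norm $\int|s|\,d\mu_X$ and pointwise multiplication by $\mathrm{L}^\infty(X)$. A morphism of measurable Banach bundles $E\to F$ over $X$ is an equivalence class (agreement on $E_x$ for almost every $x$) of maps $\Phi\colon E\to F$ such that $\Phi\circ s$ coincides almost everywhere with an element of $\mathcal{M}_F$ for every $s\in\mathcal{M}_E$, $p_F\circ\Phi=p_E$ almost everywhere (on $E_x$ for almost every $x$), $\Phi|_{E_x}$ is a bounded linear map $E_x\to F_x$ for almost every $x$, and $\mathrm{ess\,sup}_x\|\Phi|_{E_x}\|<\infty$. It is isometric if $\Phi|_{E_x}$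 is isometric for almost every $x$. Isometric isomorphy of bundles means existence of an isometric morphism with an inverse morphism. *)

(* Defs.v *)
From HB Require Import structures.
From mathcomp Require Import all_boot all_order all_algebra.
From mathcomp Require Import generic_quotient ring_quotient complex.
From mathcomp Require Import all_classical all_reals all_analysis.
From mathcomp Require Import measurable_realfun ess_sup_inf.

Set Implicit Arguments.
Unset Strict Implicit.
Unset Printing Implicit Defensive.

Import Order.TTheory GRing.Theory Num.Theory.
Import numFieldNormedType.Exports.

Local Open Scope classical_set_scope.
Local Open Scope ring_scope.
Local Open Scope quotient_scope.

(* The scalar field K is either R or C = R[i]. *)
Inductive scalar_kind := RealScalars | ComplexScalars.

Definition scalar (R : realType) (k : scalar_kind) : numFieldType :=
  match k with
  | RealScalars => R : numFieldType
  | ComplexScalars => R[i] : numFieldType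
  end.

Section Scalars.
Context {R : realType} {k : scalar_kind}.
Local Notation K := (scalar R k).

Definition sre : K -> R :=
  match k return scalar R k -> R with
  | RealScalars => fun z => z
  | ComplexScalars => fun z : R[i] => complex.Re z
  end.

Definition sim : K -> R :=
  match k return scalar R k -> R with
  | RealScalars => fun=> 0
  | ComplexScalars => fun z : R[i] => complex.Im z
  end.

(* [mk_scalar a b] is a + i b; over the reals, b is meant to be 0. *)
Definition mk_scalar (a b : R) : K :=
  match k return scalar R k with
  | RealScalars => a
  | ComplexScalars => Complex a b
  end.

(* The library norms take their values in the nonnegative elements of K;
   [rnorm] is the same number, seen in R. *)
Definition rnorm {V : normedModType K} (v : V) : R := sre `|v|.

Definition snorm (z : K) : R := sre `|z|.

End Scalars.

Section ScalarsTheory.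
Context {R : realType}.
Implicit Type k : scalar_kind.

Lemma sreD k : {morph @sre R k : x y / x + y}.
Proof. by case: k => //= [[a b] [c e]]. Qed.

Lemma simD k : {morph @sim R k : x y / x + y}.
Proof. by case: k => [x y|[a b] [c e]] //=; rewrite addr0. Qed.

Lemma sreM k (x y : scalar R k) : sre (x * y) = sre x * sre y - sim x * sim y.
Proof. by case: k x y => [x y|[a b] [c e]] //=; rewrite mulr0 subr0. Qed.

Lemma simM k (x y : scalar R k) : sim (x * y) = sre x * sim y + sim x * sre y.
Proof. by case: k x y => [x y|[a b] [c e]] //=; rewrite mulr0 mul0r addr0. Qed.

Lemma sre0 k : sre (0 : scalar R k) = 0. Proof. by case: k. Qed.

Lemma sim0 k : sim (0 : scalar R k) = 0. Proof. by case: k. Qed.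

Lemma ler_sre k (x y : scalar R k) : x <= y -> sre x <= sre y.
Proof. by case: k x y => [//|[a b] [c e]]; rewrite lecE /= => /andP[]. Qed.

Lemma sim_ge0 k (x : scalar R k) : 0 <= x -> sim x = 0.
Proof. by case: k x => [//|[a b]]; rewrite lecE /= => /andP[/eqP ->]. Qed.

Lemma snormE k (z : scalar R k) : snorm z = Num.sqrt (sre z ^+ 2 + sim z ^+ 2).
Proof.
rewrite /snorm; case: k z => [z|[a b]] //=.
by rewrite expr0n addr0 sqrtr_sqr.
Qed.

Lemma rnorm_ge0 k (V : normedModType (scalar R k)) (v : V) : 0 <= rnorm v.
Proof. by rewrite -(sre0 k) ler_sre. Qed.

Lemma rnorm0 k (V : normedModType (scalar R k)) : rnorm (0 : V) = 0.
Proof. by rewrite /rnorm normr0 sre0. Qed.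

Lemma rnormD k (V : normedModType (scalar R k)) (u v : V) :
  rnorm (u + v) <= rnorm u + rnorm v.
Proof. by rewrite -sreD ler_sre// ler_normD. Qed.

Lemma rnormZ k (V : normedModType (scalar R k)) a (v : V) :
  rnorm (a *: v) = snorm a * rnorm v.
Proof. by rewrite /rnorm normrZ sreM (sim_ge0 (normr_ge0 a)) mul0r subr0. Qed.

Lemma snorm_ge0 k (z : scalar R k) : 0 <= snorm z.
Proof. by rewrite -(sre0 k) ler_sre. Qed.

Lemma snorm0 k : snorm (0 : scalar R k) = 0.
Proof. by rewrite /snorm normr0 sre0. Qed.

Lemma snormD k (u v : scalar R k) : snorm (u + v) <= snorm u + snorm v.
Proof. by rewrite -sreD ler_sre// ler_normD. Qed.

Lemma snormM k (a b : scalar R k) : snorm (a * b) = snorm a * snorm b.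
Proof. by rewrite /snorm normrM sreM (sim_ge0 (normr_ge0 a)) mul0r subr0. Qed.

Lemma snorm_norm k (a : scalar R k) : snorm `|a| = snorm a.
Proof. by rewrite /snorm normr_id. Qed.

End ScalarsTheory.

Definition lin {K : pzRingType} {V : lmodType K} (A : set V) : set V :=
  [set v | exists n (c : 'I_n -> K) (u : 'I_n -> V),
     (forall i, A (u i)) /\ v = \sum_(i < n) c i *: u i].

Section LmodQuotient.
Context {K : pzRingType} {V : lmodType K} (I : zmodClosed V).
Hypothesis IZ : GRing.scaler_closed I.

Definition lmod_quot of GRing.scaler_closed I : Type := Quotient.quot I.
Local Notation Q := (lmod_quot IZ).
HB.instance Definition _ := GRing.Zmodule.on Q.
HB.instance Definition _ := EqQuotient.on Q.

Definition quot_scale (a : K) (x : Q) : Q := \pi_Q (a *: repr x).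

Lemma quot_scale_pi a (v : V) :
  quot_scale a (\pi_Q v) = \pi_Q (a *: v).
Proof.
apply/eqP; rewrite -Quotient.idealrBE -scalerBr IZ//.
by rewrite Quotient.idealrBE reprK.
Qed.

Lemma lmod_quotP (u v : V) : \pi_Q u = \pi_Q v <-> u - v \in I.
Proof. by rewrite [u - v \in I]Quotient.idealrBE; split=> [->|/eqP]. Qed.

Let piP (x : Q) : exists u : V, x = \pi_Q u.
Proof. by exists (repr x); rewrite reprK. Qed.

Let piD (u v : V) : \pi_Q (u + v) = \pi_Q u + \pi_Q v.
Proof. exact: (@pi_addr _ _ _ _ _ (Quotient.quot I)). Qed.

Let scaleA a b x : quot_scale a (quot_scale b x) = quot_scale (a * b) x.
Proof. by have [u ->] := piP x; rewrite !quot_scale_pi scalerA. Qed.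

Let scale1 : left_id 1 quot_scale.
Proof. by move=> x; have [u ->] := piP x; rewrite quot_scale_pi scale1r. Qed.

Let scaleDr : right_distributive quot_scale +%R.
Proof.
move=> a x y; have [u ->] := piP x; have [v ->] := piP y.
by rewrite -piD !quot_scale_pi scalerDr piD.
Qed.

Let scaleDl x : {morph quot_scale^~ x : a b / a + b}.
Proof.
by move=> a b; have [u ->] := piP x; rewrite !quot_scale_pi scalerDl piD.
Qed.

HB.instance Definition _ := GRing.Zmodule_isLmodule.Build K Q
  scaleA scale1 scaleDr scaleDl.

End LmodQuotient.

Section MeasureSpace.
Context {R : realType} (k : scalar_kind) {d : measure_display}
  {T : measurableType d} (mu : {measure set T -> \bar R}).
Local Notation K := (scalar R k).

Definition scalar_measurable (f : T -> K) : Prop :=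
  measurable_fun setT (sre \o f) /\ measurable_fun setT (sim \o f).

Definition ess_bounded (f : T -> K) : Prop :=
  exists M : R, \forall x \ae mu, snorm (f x) <= M.

Definition Linf_pred : {pred T -> K^o} :=
  fun f => `[< scalar_measurable f /\ ess_bounded f >].

Lemma scalar_measurable_cst c : scalar_measurable (cst c).
Proof.
split; first exact: (measurable_cst (sre c)).
exact: (measurable_cst (sim c)).
Qed.

Lemma scalar_measurableD f g : scalar_measurable f -> scalar_measurable g ->
  scalar_measurable (fun x => f x + g x).
Proof.
move=> [rf if_] [rg ig]; split.
  rewrite [X in measurable_fun _ X](_ : _ = (sre \o f) \+ (sre \o g)).
    exact: measurable_funD.
  by apply/funext => x /=; rewrite sreD.
rewrite [X in measurable_fun _ X](_ : _ = (sim \o f) \+ (sim \o g)).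
  exact: measurable_funD.
by apply/funext => x /=; rewrite simD.
Qed.

Lemma scalar_measurableM f g : scalar_measurable f -> scalar_measurable g ->
  scalar_measurable (fun x => f x * g x).
Proof.
move=> [rf if_] [rg ig]; split.
  rewrite [X in measurable_fun _ X](_ : _ =
      ((sre \o f) \* (sre \o g)) \- ((sim \o f) \* (sim \o g))).
    by apply: measurable_funB; exact: measurable_funM.
  by apply/funext => x /=; rewrite sreM.
rewrite [X in measurable_fun _ X](_ : _ =
    ((sre \o f) \* (sim \o g)) \+ ((sim \o f) \* (sre \o g))).
  by apply: measurable_funD; exact: measurable_funM.
by apply/funext => x /=; rewrite simM.
Qed.

Lemma measurable_snorm f : scalar_measurable f ->
  measurable_fun setT (fun x => snorm (f x)).
Proof.
move=> [rf if_].
rewrite [X in measurable_fun _ X](_ : _ =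
  Num.sqrt \o (((sre \o f) \* (sre \o f)) \+ ((sim \o f) \* (sim \o f)))).
  apply: measurableT_comp; last by apply: measurable_funD; exact: measurable_funM.
  by apply: continuous_measurable_fun; exact: sqrt_continuous.
by apply/funext => x /=; rewrite snormE !expr2.
Qed.

Lemma scalar_measurable_norm f : scalar_measurable f ->
  scalar_measurable (fun x => `|f x|).
Proof.
move=> mf; split; first exact: measurable_snorm.
rewrite [X in measurable_fun _ X](_ : _ = cst 0); first exact: measurable_cst.
by apply/funext => x /=; rewrite sim_ge0.
Qed.

Lemma ess_boundedD f g : ess_bounded f -> ess_bounded g ->
  ess_bounded (fun x => f x + g x).
Proof.
move=> [M fM] [N gN]; exists (M + N); apply: filterS2 fM gN => x fx gx.
by rewrite (le_trans (snormD _ _))// lerD.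
Qed.

Lemma ess_boundedM f g : ess_bounded f -> ess_bounded g ->
  ess_bounded (fun x => f x * g x).
Proof.
move=> [M fM] [N gN]; exists (M * N); apply: filterS2 fM gN => x fx gx.
by rewrite snormM ler_pM// snorm_ge0.
Qed.

Lemma Linf_submod_closed : submod_closed Linf_pred.
Proof.
split.
  apply/asboolP; split; first exact: (scalar_measurable_cst 0).
  by exists 0; apply/nearW => x; rewrite snorm0.
move=> a f g /asboolP[mf bf] /asboolP[mg bg]; apply/asboolP; split.
  apply: (@scalar_measurableD (fun x => a * f x)) => //.
  exact: (scalar_measurableM (scalar_measurable_cst a) mf).
apply: (@ess_boundedD (fun x => a * f x)) => //.
apply: (@ess_boundedM (cst a)) => //.
by exists (snorm a); apply/nearW.
Qed.

HB.instance Definition _ :=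
  GRing.isSubmodClosed.Build K (T -> K^o) Linf_pred Linf_submod_closed.

Record Linf_fun := LinfFun {
  Linf_val :> T -> K^o;
  Linf_valP : Linf_val \in Linf_pred
}.

HB.instance Definition _ := [isSub for Linf_val].
HB.instance Definition _ := [Choice of Linf_fun by <:].
HB.instance Definition _ := [SubChoice_isSubLmodule of Linf_fun by <:].

Definition Linf_null : {pred Linf_fun} :=
  fun f => `[< \forall x \ae mu, f x = 0 >].

Lemma Linf_null_zmod_closed : zmod_closed Linf_null.
Proof.
split; first by apply/asboolP/nearW => x.
move=> f g /asboolP f0 /asboolP g0; apply/asboolP.
by apply: filterS2 f0 g0 => x fx gx; rewrite -[LHS]/(f x - g x) fx gx subrr.
Qed.

HB.instance Definition _ :=
  GRing.isZmodClosed.Build Linf_fun Linf_null Linf_null_zmod_closed.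

Lemma Linf_null_scaler_closed : GRing.scaler_closed Linf_null.
Proof.
move=> a f /asboolP f0; apply/asboolP.
by apply: filterS f0 => x fx; rewrite -[LHS]/(a * f x) fx mulr0.
Qed.

Definition Linfty : Type := lmod_quot Linf_null_scaler_closed.
HB.instance Definition _ := GRing.Lmodule.on Linfty.
HB.instance Definition _ := EqQuotient.on Linfty.

Lemma Linfty_piP (f g : Linf_fun) :
  \pi_Linfty f = \pi_Linfty g <-> \forall x \ae mu, f x = g x.
Proof.
split=> [/(lmod_quotP Linf_null_scaler_closed)/asboolP|] fg; last first.
  apply/(lmod_quotP Linf_null_scaler_closed)/asboolP; apply: filterS fg => x fg.
  by rewrite -[LHS]/(f x - g x) fg subrr.
have {}fg : \forall x \ae mu, f x - g x = 0 := fg.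
by apply: filterS fg => x /subr0_eq.
Qed.

Lemma Linfty_repr (f : Linf_fun) : \forall x \ae mu, repr (\pi_Linfty f) x = f x.
Proof. by apply/Linfty_piP; rewrite reprK. Qed.

Definition Linf_mul (f g : Linf_fun) : Linf_fun.
Proof.
exists (fun x => f x * g x); apply/asboolP.
have /asboolP[mf bf] := Linf_valP f; have /asboolP[mg bg] := Linf_valP g.
by split; [exact: scalar_measurableM|exact: ess_boundedM].
Defined.

Definition Linf_abs (f : Linf_fun) : Linf_fun.
Proof.
exists (fun x => `|f x|); apply/asboolP.
have /asboolP[mf [M fM]] := Linf_valP f.
split; first exact: scalar_measurable_norm.
by exists M; apply: filterS fM => x; rewrite snorm_norm.
Defined.

Definition Linfty_mul (F G : Linfty) : Linfty :=
  \pi_Linfty (Linf_mul (repr F) (repr G)).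

Definition Linfty_abs (F : Linfty) : Linfty := \pi_Linfty (Linf_abs (repr F)).

Lemma Linfty_mulE f g :
  Linfty_mul (\pi_Linfty f) (\pi_Linfty g) = \pi_Linfty (Linf_mul f g).
Proof.
apply/Linfty_piP; apply: filterS2 (Linfty_repr f) (Linfty_repr g) => x fx gx.
by rewrite /= fx gx.
Qed.

Lemma Linfty_absE f : Linfty_abs (\pi_Linfty f) = \pi_Linfty (Linf_abs f).
Proof.
by apply/Linfty_piP; apply: filterS (Linfty_repr f) => x fx; rewrite /= fx.
Qed.

Definition Linfty_norm (F : Linfty) : R :=
  fine (Lnorm mu +oo%E (fun x => (snorm (repr F x))%:E)).

(* In K, [0 <= z] means that z is real and nonnegative. *)
Definition Linfty_ge0 (F : Linfty) : Prop := \forall x \ae mu, 0 <= repr F x.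

Record Linfty_dual := LinftyDual {
  dual_val :> {scalar Linfty};
  dual_bounded : exists C : R, forall F, snorm (dual_val F) <= C * Linfty_norm F
}.

Definition dual_norm (phi : Linfty_dual) : R :=
  sup [set snorm (phi F) | F in [set F | Linfty_norm F <= 1]].

Definition dual_ge0 (phi : Linfty_dual) : Prop :=
  forall F, Linfty_ge0 F -> 0 <= phi F.

Record Linfty_module := LinftyModule {
  mod_carrier :> completeNormedModType K;
  mod_act : Linfty -> mod_carrier -> mod_carrier;
  mod_act_linearl : forall s, linear (mod_act^~ s);
  mod_act_linearr : forall F, linear (mod_act F);
  mod_actM : forall F G s, mod_act (Linfty_mul F G) s = mod_act F (mod_act G s);
  mod_act_norm : forall F s, rnorm (mod_act F s) <= Linfty_norm F * rnorm s;
  mod_nondegenerate :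
    closure (lin [set mod_act F s | F in [set: Linfty] & s in [set: mod_carrier]])
      = [set: mod_carrier]
}.

Definition scalar_integrable (h : T -> K) : Prop :=
  mu.-integrable setT (EFin \o (sre \o h)) /\
  mu.-integrable setT (EFin \o (sim \o h)).

Definition scalar_integral (h : T -> K) : K :=
  mk_scalar (\int[mu]_x sre (h x)) (\int[mu]_x sim (h x)).

(* [phi] is in the canonical image of L^1 in the dual of L^oo. *)
Definition in_L1 (phi : Linfty_dual) : Prop :=
  exists2 h : T -> K, scalar_integrable h &
    forall F, phi F = scalar_integral (fun x => repr F x * h x).

(* [F . phi] is the functional [G |-> phi (F G)], and [phi <= psi] means that
   [psi - phi] is positive. *)
Record L1_normed_module := L1NormedModule {
  l1_module :> Linfty_module;
  l1_abs : l1_module -> Linfty_dual;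
  l1_abs_ge0 : forall s, dual_ge0 (l1_abs s);
  l1_abs_norm : forall s, dual_norm (l1_abs s) = rnorm s;
  l1_abs_act : forall F s G,
    l1_abs (mod_act F s) G = l1_abs s (Linfty_mul (Linfty_abs F) G);
  l1_abs_triangle : forall s t G, Linfty_ge0 G ->
    l1_abs (s + t) G <= l1_abs s G + l1_abs t G;
  l1_abs_in_L1 : forall s, in_L1 (l1_abs s)
}.

Section Sections.
Variable E : T -> completeNormedModType K.

Definition section : Type := forall x, E x.
HB.instance Definition _ := Choice.copy section (forall x, E x).

Implicit Types s t u : section.

Definition section_zero : section := fun x => 0.
Definition section_add s t : section := fun x => s x + t x.
Definition section_opp s : section := fun x => - s x.
Definition section_scale (a : K) s : section := fun x => a *: s x.

Let addA : associative section_add.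
Proof. by move=> s t u; apply: functional_extensionality_dep => x; exact: addrA. Qed.
Let addC : commutative section_add.
Proof. by move=> s t; apply: functional_extensionality_dep => x; exact: addrC. Qed.
Let add0 : left_id section_zero section_add.
Proof. by move=> s; apply: functional_extensionality_dep => x; exact: add0r. Qed.
Let addN : left_inverse section_zero section_opp section_add.
Proof. by move=> s; apply: functional_extensionality_dep => x; exact: addNr. Qed.
HB.instance Definition _ := GRing.isZmodule.Build section addA addC add0 addN.

Let scaleA a b s :
  section_scale a (section_scale b s) = section_scale (a * b) s.
Proof. by apply: functional_extensionality_dep => x; exact: scalerA. Qed.
Let scale1 : left_id 1 section_scale.
Proof. by move=> s; apply: functional_extensionality_dep => x; exact: scale1r. Qed.
Let scaleDr : right_distributive section_scale +%R.
Proof. by move=> a s t; apply: functional_extensionality_dep => x; exact: scalerDr. Qed.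
Let scaleDl s : {morph section_scale^~ s : a b / a + b}.
Proof. by move=> a b; apply: functional_extensionality_dep => x; exact: scalerDl. Qed.
HB.instance Definition _ := GRing.Zmodule_isLmodule.Build K section
  scaleA scale1 scaleDr scaleDl.

Definition section_mul (f : T -> K) s : section := fun x => f x *: s x.

Definition section_norm s : T -> R := fun x => rnorm (s x).

End Sections.

(* The total space is [{x : T & fiber x}] with projection [projT1]. *)
Record measurable_banach_bundle := MeasurableBanachBundle {
  fiber : T -> completeNormedModType K;
  msec : set (section fiber);
  msec0 : msec 0;
  msecD : forall s t, msec s -> msec t -> msec (s + t);
  msecZ : forall (a : K) s, msec s -> msec (a *: s);
  msecM : forall (f : T -> K) s,
    scalar_measurable f -> msec s -> msec (section_mul f s);
  msec_norm : forall s, msec s -> measurable_fun setT (section_norm s);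
  msec_lim : forall (s_ : nat -> section fiber) (s : section fiber),
    (forall n, msec (s_ n)) ->
    (\forall x \ae mu, (fun n => s_ n x) @ \oo --> s x) -> msec s
}.

Definition separable_bundle (E : measurable_banach_bundle) : Prop :=
  exists2 s_ : nat -> section (fiber E), forall n, msec (s_ n) &
    \forall x \ae mu, closure (lin (range (fun n => s_ n x))) = [set: fiber E x].

Section Gamma1.
Variable E : measurable_banach_bundle.

Definition section_integrable (s : section (fiber E)) : Prop :=
  mu.-integrable setT (EFin \o section_norm s).

Definition G1_pred : {pred section (fiber E)} :=
  fun s => `[< msec s /\ section_integrable s >].

Lemma section_integrable0 : section_integrable 0.
Proof.
apply: (eq_integrable _ (cst 0%E)) => //; last exact: integrable0.
by move=> x _ /=; rewrite /section_norm rnorm0.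
Qed.

Lemma section_integrableD s t : msec s -> msec t ->
  section_integrable s -> section_integrable t -> section_integrable (s + t).
Proof.
move=> ms mt is_ it; apply: le_integrable (integrableD _ is_ it) => //.
  by apply/measurable_EFinP; exact/msec_norm/msecD.
move=> x _ /=; rewrite lee_fin !ger0_norm ?addr_ge0 ?rnorm_ge0//.
exact: rnormD.
Qed.

Lemma section_integrableM (f : T -> K) s : scalar_measurable f -> ess_bounded f ->
  msec s -> section_integrable s -> section_integrable (section_mul f s).
Proof.
move=> mf [M fM] ms is_.
have iMs : mu.-integrable setT (fun x => (M%:E * (section_norm s x)%:E)%E).
  exact: integrableZl.
have mfs : measurable_fun setT (EFin \o section_norm (section_mul f s)).
  by apply/measurable_EFinP/msec_norm; exact: msecM.
apply/integrableP; split => //.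
have /integrableP[_] := iMs; apply: le_lt_trans.
apply: ae_ge0_le_integral => //.
- exact: measurableT_comp.
- apply: measurableT_comp => //; exact: measurable_int iMs.
apply: filterS fM => x fx _ /=.
rewrite /section_norm /section_mul rnormZ lee_fin.
rewrite !ger0_norm ?mulr_ge0 ?snorm_ge0 ?rnorm_ge0//; last first.
  exact: le_trans (snorm_ge0 _) fx.
by apply: ler_wpM2r => //; exact: rnorm_ge0.
Qed.

Lemma G1_submod_closed : submod_closed G1_pred.
Proof.
split; first by apply/asboolP; split; [exact: msec0|exact: section_integrable0].
move=> a s t /asboolP[ms is_] /asboolP[mt it]; apply/asboolP.
have mas : msec (a *: s) by exact: msecZ.
split; first exact: msecD.
apply: section_integrableD => //.
apply: (@section_integrableM (cst a)) => //; first exact: scalar_measurable_cst.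
by exists (snorm a); exact/nearW.
Qed.

HB.instance Definition _ :=
  GRing.isSubmodClosed.Build K (section (fiber E)) G1_pred G1_submod_closed.

Record G1_section := G1Section {
  G1_val :> section (fiber E);
  G1_valP : G1_val \in G1_pred
}.

HB.instance Definition _ := [isSub for G1_val].
HB.instance Definition _ := [Choice of G1_section by <:].
HB.instance Definition _ := [SubChoice_isSubLmodule of G1_section by <:].

Definition G1_null : {pred G1_section} :=
  fun s => `[< \forall x \ae mu, G1_val s x = 0 >].

Lemma G1_null_zmod_closed : zmod_closed G1_null.
Proof.
split; first by apply/asboolP/nearW => x.
move=> s t /asboolP s0 /asboolP t0; apply/asboolP.
by apply: filterS2 s0 t0 => x sx tx; rewrite -[LHS]/(G1_val s x - G1_val t x) sx tx subrr.
Qed.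

HB.instance Definition _ :=
  GRing.isZmodClosed.Build G1_section G1_null G1_null_zmod_closed.

Lemma G1_null_scaler_closed : GRing.scaler_closed G1_null.
Proof.
move=> a s /asboolP s0; apply/asboolP.
by apply: filterS s0 => x sx; rewrite -[LHS]/(a *: G1_val s x) sx scaler0.
Qed.

Definition Gamma1 : Type := lmod_quot G1_null_scaler_closed.
HB.instance Definition _ := GRing.Lmodule.on Gamma1.
HB.instance Definition _ := EqQuotient.on Gamma1.

Lemma Gamma1_piP (s t : G1_section) :
  \pi_Gamma1 s = \pi_Gamma1 t <-> \forall x \ae mu, G1_val s x = G1_val t x.
Proof.
split=> [/(lmod_quotP G1_null_scaler_closed)/asboolP|] st; last first.
  apply/(lmod_quotP G1_null_scaler_closed)/asboolP; apply: filterS st => x st.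
  by rewrite -[LHS]/(G1_val s x - G1_val t x) st subrr.
have {}st : \forall x \ae mu, G1_val s x - G1_val t x = 0 := st.
by apply: filterS st => x /subr0_eq.
Qed.

Lemma Gamma1_repr (s : G1_section) :
  \forall x \ae mu, G1_val (repr (\pi_Gamma1 s)) x = G1_val s x.
Proof. by apply/Gamma1_piP; rewrite reprK. Qed.

Definition Gamma1_norm (s : Gamma1) : R := \int[mu]_x section_norm (repr s) x.

Definition G1_mul (f : Linf_fun) (s : G1_section) : G1_section.
Proof.
exists (section_mul f s); apply/asboolP.
have /asboolP[mf bf] := Linf_valP f; have /asboolP[ms is_] := G1_valP s.
by split; [exact: msecM|exact: section_integrableM].
Defined.

Definition Gamma1_act (F : Linfty) (s : Gamma1) : Gamma1 :=
  \pi_Gamma1 (G1_mul (repr F) (repr s)).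

Lemma Gamma1_actE f s :
  Gamma1_act (\pi_Linfty f) (\pi_Gamma1 s) = \pi_Gamma1 (G1_mul f s).
Proof.
apply/Gamma1_piP; apply: filterS2 (Linfty_repr f) (Gamma1_repr s) => x fx sx.
by rewrite /= /section_mul fx sx.
Qed.

End Gamma1.

Definition Gamma1_isometric_to (E : measurable_banach_bundle) (G : Linfty_module)
  : Prop :=
  exists U : {linear Gamma1 E -> G},
    [/\ bijective U,
        forall F s, U (Gamma1_act F s) = mod_act F (U s) &
        forall s, rnorm (U s) = Gamma1_norm s].

Definition separable_space (V : topologicalType) : Prop :=
  exists2 D : set V, countable D & dense D.

Section Morphisms.
Implicit Types E F : measurable_banach_bundle.

Definition total E : Type := {x : T & fiber E x}.

Definition total_norm E (e : total E) : R := rnorm (projT2 e).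

Definition fiber_norm E F (Phi : total E -> total F) (x : T) : \bar R :=
  ereal_sup [set (total_norm (Phi (existT _ x v)))%:E
            | v in [set v : fiber E x | rnorm v <= 1]].

Definition fiber_linear E F (Phi : total E -> total F) (x : T) : Prop :=
  exists phi : {linear fiber E x -> fiber F x},
    forall v, Phi (existT _ x v) = existT _ x (phi v).

(* A representative of a morphism; morphisms themselves are the classes of
   these maps for [morphism_eq]. *)
Record bundle_morphism E F (Phi : total E -> total F) : Prop := {
  morphism_msec : forall s : section (fiber E), msec s ->
    exists2 t : section (fiber F), msec t &
      \forall x \ae mu, Phi (existT _ x (s x)) = existT _ x (t x);
  morphism_proj : \forall x \ae mu, forall v : fiber E x,
    projT1 (Phi (existT _ x v)) = x;
  morphism_linear : \forall x \ae mu,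
    fiber_linear Phi x /\ (fiber_norm Phi x < +oo)%E;
  morphism_bounded : (ess_sup mu (fiber_norm Phi) < +oo)%E
}.

Definition morphism_eq E F (Phi Psi : total E -> total F) : Prop :=
  \forall x \ae mu, forall v : fiber E x,
    Phi (existT _ x v) = Psi (existT _ x v).

Definition morphism_isometric E F (Phi : total E -> total F) : Prop :=
  \forall x \ae mu, forall v : fiber E x,
    total_norm (Phi (existT _ x v)) = rnorm v.

Definition isometrically_isomorphic E F : Prop :=
  exists (Phi : total E -> total F) (Psi : total F -> total E),
    [/\ bundle_morphism Phi /\ morphism_isometric Phi,
        bundle_morphism Psi,
        morphism_eq (Psi \o Phi) id &
        morphism_eq (Phi \o Psi) id].

End Morphisms.

End MeasureSpace.

(* Main.v *)
From HB Require Import structures.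
From mathcomp Require Import all_boot all_order all_algebra.
From mathcomp Require Import generic_quotient complex.
From mathcomp Require Import all_classical all_reals all_analysis.
From mathcomp Require Import measurable_realfun ess_sup_inf.
From mathcomp Require Import ring lra.
Require Import Defs.

Set Implicit Arguments.
Unset Strict Implicit.
Unset Printing Implicit Defensive.

Import Order.TTheory GRing.Theory Num.Theory.
Import numFieldNormedType.Exports.

Local Open Scope classical_set_scope.
Local Open Scope ring_scope.
Local Open Scope quotient_scope.

(** An element s of an L^1-normed module has a pointwise norm |s|, a class of
    integrable functions. The relations that would make |.| a seminorm at a
    point x hold for almost every x, but with an exceptional set that depends
    on the elements, and uncountably many exceptional sets cannot be discarded
    together. The remedy is a lower density: a [density_field] attaches to
    every point x a filter of measurable sets such that, for each measurable
    A, the set A belongs to the filter at x for almost every x in A and almost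
    no x outside A. The limit superior of |s| along the filter at x is, where
    it is finite, a true seminorm at every single x, because the inequalities
    it needs only have to hold off a null set, and sets of full measure belong
    to every filter; and it equals |s|(x) for almost every x ([germ_norm_ae]).
    So the germs of elements along the filters are the values of sections.

    Density fields exist ([density_field_exists]) by the classical argument of
    von Neumann and Maharam. Zorn's lemma is applied to lower densities
    defined on sub-sigma-algebras. One set can be added to a sub-sigma-algebra
    ([dens_extend]). A chain either has a sigma-algebra as its union, or has a
    cofinal sequence; a sequence of lower densities extends to the generated
    sigma-algebra by a zero-one law of Levy type ([dens_limit]), whose maximal
    inequality only needs a Hahn decomposition on each sub-sigma-algebra
    ([sub_hahn]).

    The fibre at x consists of the elements whose pointwise norm is bounded on
    a member of the filter, modulo those of seminorm 0. It is already complete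
    ([germ_norm_complete]): the terms of a series of germs with summable norms
    may be multiplied by indicators of members of the filter, which does not
    change the germs and makes the series converge in the module. For the
    separable case only those germs are kept which are limits of germs from
    the span of a fixed dense set S; as the germ of a given element survives
    at almost every point ([dom_ae]), one construction serves for S the whole
    module and for S a dense sequence.

    The measurable sections are the products of a scalar measurable function
    and the section of germs of an element. Dominated convergence and the
    completeness of the module show that they are closed under limits almost
    everywhere ([hat_limit], [hat_surj]), and that the integrable ones are
    exactly the sections of germs, which is the isometry with the module
    ([bundle_of_isometric]).

    For uniqueness, a sequence in the module is chosen whose sections generate
    both bundles. Countably many null sets suffice to make all rational
    combinations of the two sequences of values have equal norms, so that at
    almost every x the correspondence of values closes up to the graph of a
    linear isometry ([corr_total], [corr_inj]). These isometries carry the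
    section of any element in one bundle to its section in the other, since
    the distances to the rational combinations agree ([represents_corr]). *)

(** * Exhaustion, and Hahn decomposition on a sub-sigma-algebra *)

Lemma natSinv_small {R : realType} (e : R) : 0 < e -> exists n : nat, n.+1%:R^-1 < e.
Proof.
by move=> e0; have /filter_ex[n] := near_infty_natSinv_lt (PosNum e0); exists n.
Qed.

Section Exhaustion.
Context {R : realType} {d : measure_display} {T : measurableType d}
  (mu : {finite_measure set T -> \bar R}).

(** Exhaustion: a sequence of members whose measures approach the supremum has
    a union of maximal measure, and nothing of positive measure can be added
    to a union of maximal measure. *)
Lemma essential_union (C : set (set T)) : C `<=` measurable -> C set0 ->
  (forall F : (set T)^nat, (forall n, C (F n)) -> C (\bigcup_n F n)) ->
  exists2 H, C H & forall D, C D -> mu (D `\` H) = 0%E.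
Proof.
move=> CM C0 CU.
pose S := [set mu A | A in C].
have Sfin : ereal_sup S \is a fin_num.
  rewrite fin_numElt (lt_le_trans (ltNyr 0)) /=; last first.
    by apply: ereal_sup_ubound; exists set0; rewrite ?measure0.
  apply: (@le_lt_trans _ _ (mu setT)); last by rewrite ltey_eq fin_num_measure.
  apply: ge_ereal_sup => _ [A CA <-].
  by apply: le_measure; rewrite ?inE//; exact: CM.
have /choice[F FP] : forall n : nat, exists A,
    C A /\ (ereal_sup S - (n.+1%:R^-1)%:E < mu A)%E.
  move=> n; have n0 : 0 < n.+1%:R^-1 :> R by rewrite invr_gt0.
  by have [_ [A CA <-] lA] := ub_ereal_sup_adherent n0 Sfin; exists A.
have CF n : C (F n) by case: (FP n).
set H := \bigcup_n F n.
have CH : C H by exact: CU.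
exists H => //.
have mH : measurable H by apply: CM; exact: CU.
have leH : (ereal_sup S <= mu H)%E.
  apply/lee_addgt0Pr => e e0.
  have [n ne] : exists n : nat, n.+1%:R^-1 < e.
    exact: natSinv_small.
  rewrite -leeBlDr//; apply: (@le_trans _ _ (ereal_sup S - (n.+1%:R^-1)%:E)%E).
    by rewrite leeB// lee_fin ltW.
  apply: (le_trans (ltW (FP n).2)).
  by apply: le_measure; rewrite ?inE//; [exact: CM|move=> x ?; exists n].
move=> D CD; have mD := CM _ CD.
have CDH : C (H `|` D).
  by rewrite -bigcup2E; apply: CU => -[|[|n]] //=; exact: CH.
have : (mu (H `|` D) <= mu H)%E.
  by apply: (le_trans _ leH); apply: ereal_sup_ubound; exists (H `|` D).
rewrite [X in mu X](_ : _ = (D `\` H) `|` H); last first.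
  by apply/seteqP; split=> x; rewrite /setU /setD /=; have := pselect (H x); tauto.
rewrite measureU//; [|exact: measurableD|by rewrite setDE -setIA setICl setI0].
rewrite -leeBrDr ?fin_num_measure// subee ?fin_num_measure//.
by rewrite measure_le0 => /eqP.
Qed.

(** A Hahn decomposition, within the sub-sigma-algebra [S], of the charge e
    mu(A) - mu(A and B). On [P] the conditional density of [B] given [S] is at
    most [e], and off [P] it is at least [e]; this replaces conditional
    expectations in the zero-one law below. *)
Lemma sub_hahn (S : set (set T)) (B : set T) (e : R) :
  sigma_algebra setT S -> S `<=` measurable -> measurable B -> 0 < e ->
  exists2 P, S P &
    (forall A, S A -> A `<=` P -> (mu (A `&` B) <= e%:E * mu A)%E) /\
    (forall A, S A -> A `&` P = set0 -> (e%:E * mu A <= mu (A `&` B))%E).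
Proof.
move=> sS SM mB e0.
(* The Hahn decomposition theorem is applied to the type whose measurable sets
   are the members of S. *)
pose T' := g_sigma_algebraType S.
have mE (A : set T') : measurable A = S A.
  exact: (congr1 (@^~ A) (sigma_algebra_id sS)).
have muB : (mu B < +oo)%E by rewrite ltey_eq fin_num_measure.
pose nuB : {finite_measure set T -> \bar R} := mfrestr mB muB.
pose nuT : {charge set T -> \bar R} :=
  cadd (cscale e (charge_of_finite_measure mu)) (copp (charge_of_finite_measure nuB)).
have nuE A : nuT A = (e%:E * mu A - mu (A `&` B))%E by [].
pose nu' : set T' -> \bar R := nuT.
have nu'0 : nu' set0 = 0%E by exact: charge0.
have nu'fin (A : set T') : measurable A -> nu' A \is a fin_num.
  by rewrite mE => /SM mA; exact: fin_num_measure.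
have nu'sig : semi_sigma_additive nu'.
  move=> F mF tF mUF; apply: (@charge_semi_sigma_additive _ _ _ nuT) => //.
    by move=> n; apply: SM; rewrite -mE.
  by apply: SM; rewrite -mE.
pose C := isCharge.Build _ T' R nu' nu'0 nu'fin nu'sig.
pose nu : {charge set T' -> \bar R} := HB.pack nu' C.
have [P [N [[mP P0] [mN N0] PNT PN0]]] := Hahn_decomposition nu.
exists P; first by rewrite -mE.
have mule A : S A -> (0 <= nuT A)%E = (mu (A `&` B) <= e%:E * mu A)%E.
  move=> /SM mA; rewrite nuE sube_ge0// fin_num_measure//; exact: measurableI.
have mulE A : S A -> (nuT A <= 0)%E = (e%:E * mu A <= mu (A `&` B))%E.
  move=> /SM mA; rewrite nuE sube_le0// fin_num_measure//; exact: measurableI.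
split=> A SA AP.
  by rewrite -mule//; apply: P0 => //; rewrite ?mE// inE mE.
rewrite -mulE//; apply: N0 => //; rewrite ?inE ?mE// => x Ax.
have : (P `|` N) x by rewrite PNT.
by case=> // Px; have : (A `&` P) x by []; rewrite AP.
Qed.

End Exhaustion.

(** * Lower densities, and their extension by one set *)

Section SigmaAlgebra.
Variables (T : Type) (S : set (set T)) (sS : sigma_algebra setT S).

Lemma sigmaC A : S A -> S (~` A).
Proof. by move=> SA; rewrite -setTD; case: sS => _ + _; apply. Qed.

Lemma sigma0 : S set0. Proof. by case: sS. Qed.

Lemma sigmaT : S setT. Proof. by rewrite -setC0; exact/sigmaC/sigma0. Qed.

Lemma sigma_bigcup F : (forall n : nat, S (F n)) -> S (\bigcup_n F n).
Proof. by case: sS => _ _; apply. Qed.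

Lemma sigmaU A B : S A -> S B -> S (A `|` B).
Proof.
by move=> SA SB; rewrite -bigcup2E; apply: sigma_bigcup => -[|[|n]] //=; exact: sigma0.
Qed.

Lemma sigmaI A B : S A -> S B -> S (A `&` B).
Proof.
by move=> SA SB; rewrite -[_ `&` _]setCK setCI; apply/sigmaC/sigmaU; exact: sigmaC.
Qed.

Lemma sigmaD A B : S A -> S B -> S (A `\` B).
Proof. by move=> SA SB; rewrite setDE; apply: sigmaI => //; exact: sigmaC. Qed.

End SigmaAlgebra.

Section LowerDensity.
Context {R : realType} {d : measure_display} {T : measurableType d}
  (mu : {finite_measure set T -> \bar R}).

(** The set attached by a lower density to [A] is the set of points [x] with
    [dens_at x A]. The dual presentation by the filters [dens_at x] is the one
    used here, because limits superior are taken along these filters.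
    [dens_atS] makes the filters insensitive to null sets. *)
Record lower_density := LowerDensity {
  dens_dom : set (set T);
  dens_at : T -> set (set T);
  dens_sigma : sigma_algebra setT dens_dom;
  dens_measurable : dens_dom `<=` measurable;
  dens_at_dom : forall x, dens_at x `<=` dens_dom;
  dens_atT : forall x, dens_at x setT;
  dens_atI : forall x A B, dens_at x A -> dens_at x B -> dens_at x (A `&` B);
  dens_atS : forall x A B, dens_at x A -> dens_dom B -> mu (A `\` B) = 0%E ->
    dens_at x B;
  dens_ae : forall A, dens_dom A -> \forall x \ae mu, dens_at x A <-> A x }.

Definition dens_le (D D' : lower_density) :=
  (dens_dom D `<=` dens_dom D') /\
  (forall x A, dens_dom D A -> dens_at D x A <-> dens_at D' x A).

Lemma dens_le_refl D : dens_le D D. Proof. by split. Qed.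

Lemma dens_le_trans D1 D2 D3 : dens_le D1 D2 -> dens_le D2 D3 -> dens_le D1 D3.
Proof.
move=> [s12 a12] [s23 a23]; split; first exact: subset_trans s23.
by move=> x A DA; rewrite a12// a23//; exact: s12.
Qed.

Lemma measure0_sub (A B : set T) : measurable A -> measurable B -> A `<=` B ->
  mu B = 0%E -> mu A = 0%E.
Proof. exact: subset_measure0. Qed.

Lemma measure0_U (A B : set T) : measurable A -> measurable B ->
  mu A = 0%E -> mu B = 0%E -> mu (A `|` B) = 0%E.
Proof.
move=> mA mB A0 B0; apply/negligibleP; first exact: measurableU.
by apply: negligibleU; exact/negligibleP.
Qed.

Lemma ae_null (A : set T) : measurable A -> mu A = 0%E -> \forall x \ae mu, ~ A x.
Proof. by move=> mA A0; exists A; split => // x /= /contrapT. Qed.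

Section OneStep.
Variables (D : lower_density) (A : set T) (mA : measurable A).
Let S := dens_dom D.
Let sS := dens_sigma D.
Let SM := @dens_measurable D.

(** The largest member of the sub-sigma-algebra that meets [B] in a null set:
    the complement of the measurable envelope of [B]. *)
Definition null_hull (B : set T) : set T :=
  xget set0 [set H | (S H /\ mu (H `&` B) = 0%E) /\
    forall E, S E -> mu (E `&` B) = 0%E -> mu (E `\` H) = 0%E].

Lemma null_hullP B : measurable B ->
  [/\ S (null_hull B), mu (null_hull B `&` B) = 0%E &
      forall E, S E -> mu (E `&` B) = 0%E -> mu (E `\` null_hull B) = 0%E].
Proof.
move=> mB.
suff [H HP] : exists H, (S H /\ mu (H `&` B) = 0%E) /\
    forall E, S E -> mu (E `&` B) = 0%E -> mu (E `\` H) = 0%E.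
  by rewrite /null_hull; case: xgetP => [_ -> [[]]|/(_ H)].
have [| | |H [SH H0] Hmax] := @essential_union _ _ _ mu [set H | S H /\ mu (H `&` B)
    = 0%E].
- by move=> H [/SM].
- by split; [exact: sigma0|rewrite set0I measure0].
- move=> F FP; split; first by apply: (sigma_bigcup sS) => n; case: (FP n).
  rewrite setI_bigcupl; apply/negligibleP.
    by apply: bigcupT_measurable => n; apply: measurableI => //; apply: SM; case: (FP n).
  apply: negligible_bigcup => n; have [/SM ? ?] := FP n.
  by apply/negligibleP => //; exact: measurableI.
by exists H; split => // E SE E0; apply: Hmax.
Qed.

(** The filter at [x] is enlarged by the one of [A], ~` A that contains [x],
    except on a null set of points. By [trace_set_cut] this creates no new
    membership among the old sets. *)
Let trace_set x : set T := if `[< A x /\ dens_at D x (~` null_hull A) >] then A else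
  if `[< ~ A x /\ dens_at D x (~` null_hull (~` A)) >] then ~` A else setT.

Let trM x : measurable (trace_set x).
Proof. by rewrite /trace_set; case: ifPn => // _; case: ifPn => // _; exact:
    measurableC. Qed.

(** The part of [E] outside [F] meets [B] in a null set, hence lies in the
    hull of [B] up to a null set, and the complement of the hull belongs to
    the filter. *)
Let hull_cut x B : measurable B -> dens_at D x (~` null_hull B) ->
  forall E F, dens_at D x E -> S F -> mu ((E `&` B) `\` F) = 0%E -> dens_at D x F.
Proof.
move=> mB xB E F xE SF EF0; have [SH H0 Hmax] := null_hullP mB.
have SE := dens_at_dom xE.
apply: (dens_atS (dens_atI xE xB)) => //.
rewrite setDE setIAC -!setDE; apply: Hmax; first exact: (sigmaD sS).
by rewrite setDE setIAC -setDE.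
Qed.

Let trace_set_cut x E F : dens_at D x E -> S F -> mu ((E `&` trace_set x) `\` F) = 0%E ->
  dens_at D x F.
Proof.
rewrite /trace_set; case: ifPn => [/asboolP[_ xA]|_]; first exact: hull_cut.
case: ifPn => [/asboolP[_ xA]|_]; first by apply: hull_cut => //; exact: measurableC.
by move=> xE SF; rewrite setIT; exact: dens_atS.
Qed.

(** The sets that agree with a member of the old sigma-algebra on [A] and with
    another one on the complement form the sigma-algebra generated by [A] and
    the old one. *)
Let glue (BC : set T * set T) := (BC.1 `&` A) `|` (BC.2 `&` ~` A).

Let dom' : set (set T) := [set E | exists B C, [/\ S B, S C & E = glue (B, C)]].

Let domS : S `<=` dom'.
Proof.
move=> E SE; exists E, E; split => //.
by apply/seteqP; split=> x; rewrite /glue/=; have := pselect (A x); tauto.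
Qed.

Let at' x : set (set T) := [set E | dom' E /\
  exists2 B, dens_at D x B & mu ((B `&` trace_set x) `\` E) = 0%E].

Let domM' : dom' `<=` measurable.
Proof.
move=> _ [B [C [/SM mB /SM mC ->]]]; apply: measurableU; apply: measurableI => //.
exact: measurableC.
Qed.

(** The step of the Zorn argument that adds one set. Adding the trace set to
    the filter at each point keeps the old memberships; on [A] a glued set is
    measured by its first component and on the complement by its second one. *)
Lemma dens_extend : exists2 D', dens_le D D' & dens_dom D' A.
Proof.
have s' : sigma_algebra setT dom'.
  split; first exact/domS/(sigma0 sS).
    move=> _ [B [C [SB SC ->]]]; exists (~` B), (~` C); split; try exact: (sigmaC sS).
    by apply/seteqP; split=> x; rewrite /glue/=; have := pselect (A x); tauto.
  move=> F /choice[B /choice[C BC]].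
  exists (\bigcup_n B n), (\bigcup_n C n); split.
  - by apply: (sigma_bigcup sS) => n; case: (BC n).
  - by apply: (sigma_bigcup sS) => n; case: (BC n).
  - apply/seteqP; split=> [x [n _]|x [[[n _ Bx] Ax]|[[n _ Bx] Ax]]].
    + by case: (BC n) => _ _ -> [] [h Ax]; [left|right]; split => //; exists n.
    + by exists n => //; case: (BC n) => _ _ ->; left.
    + by exists n => //; case: (BC n) => _ _ ->; right.
have atT x : at' x setT.
  split; first exact/domS/(sigmaT sS).
  by exists setT; [exact: dens_atT|rewrite setDT measure0].
have atI x E F : at' x E -> at' x F -> at' x (E `&` F).
  move=> [dE [B xB BE]] [dF [C xC CF]]; split; first exact: (sigmaI s').
  exists (B `&` C); first exact: dens_atI.
  have [mB mC] := (SM (dens_at_dom xB), SM (dens_at_dom xC)).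
  have [mE mF] := (domM' dE, domM' dF).
  apply: (measure0_sub _ _ _ (measure0_U _ _ BE CF)).
  - by apply: measurableD; do ?apply: measurableI.
  - by apply: measurableU; apply: measurableD => //; apply: measurableI.
  - by move=> y [[[By Cy] ty]] /not_andP[nE|nF]; [left|right].
  - by apply: measurableD => //; apply: measurableI.
  - by apply: measurableD => //; apply: measurableI.
have atS x E F : at' x E -> dom' F -> mu (E `\` F) = 0%E -> at' x F.
  move=> [dE [B xB BE]] dF EF; split => //; exists B => //.
  have mB := SM (dens_at_dom xB).
  have [mE mF] := (domM' dE, domM' dF).
  apply: (measure0_sub _ _ _ (measure0_U _ _ BE EF)).
  - by apply: measurableD => //; apply: measurableI.
  - by apply: measurableU; apply: measurableD => //; apply: measurableI.
  - by move=> y [[By ty] nF]; have [Ey|nE] := pselect (E y); [right|left].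
  - by apply: measurableD => //; apply: measurableI.
  - exact: measurableD.
have at_ae E : dom' E -> \forall x \ae mu, at' x E <-> E x.
  move=> dE; have [B [C [SB SC EE]]] := dE.
  have mAC := measurableC mA.
  have [SH H0 _] := null_hullP mA; have [SK K0 _] := null_hullP mAC.
  have nH : \forall x \ae mu, ~ (null_hull A `&` A) x.
    by apply: ae_null => //; apply: measurableI => //; exact: SM.
  have nK : \forall x \ae mu, ~ (null_hull (~` A) `&` ~` A) x.
    by apply: ae_null => //; apply: measurableI => //; exact: SM.
  have aeH := dens_ae (sigmaC sS SH); have aeK := dens_ae (sigmaC sS SK).
  apply: filterS2 (filterI (filterI nH nK) (filterI aeH aeK))
    (filterI (dens_ae SB) (dens_ae SC)) => x [[nHx nKx] [xH xK]] [xB xC].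
  have [Ax|nAx] := pselect (A x).
    have trx : trace_set x = A.
      by rewrite /trace_set asboolT//; split => //; apply/xH => Hx; apply: nHx.
    split=> [[_ [F xF]]|Ex].
      rewrite trx => F0; rewrite EE; left; split => //; apply/xB.
      apply: (trace_set_cut xF) => //; rewrite trx -F0; congr (mu _).
      by rewrite EE /glue; apply/seteqP; split=> y /=; tauto.
    have Bx : B x by move: Ex; rewrite EE /glue /=; tauto.
    split => //; exists B; first exact/xB.
    rewrite trx EE (_ : _ `\` _ = set0) ?measure0//.
    by rewrite /glue; apply/seteqP; split=> y //=; tauto.
  have trx : trace_set x = ~` A.
    rewrite /trace_set asboolF; last by case.
    by rewrite asboolT//; split => //; apply/xK => Hx; apply: nKx.
  split=> [[_ [F xF]]|Ex].
    rewrite trx => F0; rewrite EE; right; split => //; apply/xC.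
    apply: (trace_set_cut xF) => //; rewrite trx -F0; congr (mu _).
    by rewrite EE /glue; apply/seteqP; split=> y /=; tauto.
  have Cx : C x by move: Ex; rewrite EE /glue /=; tauto.
  split => //; exists C; first exact/xC.
  rewrite trx EE (_ : _ `\` _ = set0) ?measure0//.
  by rewrite /glue; apply/seteqP; split=> y //=; tauto.
exists (@LowerDensity dom' at' s' domM' (fun x E => @proj1 _ _) atT atI atS at_ae).
  split => // x E SE; split=> [xE|[_ [B xB]]]; last exact: trace_set_cut.
  split; first exact: domS.
  by exists E => //; rewrite (_ : _ `\` _ = set0) ?measure0//; apply/seteqP; split=>
      y //= -[[]].
exists setT, set0; split; [exact: sigmaT|exact: sigma0|].
by rewrite /glue/= set0I setU0 setTI.
Qed.

End OneStep.
End LowerDensity.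

(** * Limits of increasing sequences of lower densities *)

Section Limit.
Context {R : realType} {d : measure_display} {T : measurableType d}
  (mu : {finite_measure set T -> \bar R}).
Variables (D : nat -> lower_density mu) (leD : forall n, dens_le (D n) (D n.+1)).
Let S n := dens_dom (D n).
Let sS n : sigma_algebra setT (S n) := dens_sigma (D n).
Let SM n : S n `<=` measurable := @dens_measurable _ _ _ _ (D n).

Let leD_ n m : (n <= m)%N -> dens_le (D n) (D m).
Proof.
move=> /subnKC <-; elim: (m - n)%N => [|j IH]; first by rewrite addn0; exact:
    dens_le_refl.
by rewrite addnS; apply: dens_le_trans IH _; exact: leD.
Qed.

Let U : set (set T) := \bigcup_n S n.
Let S' : set (set T) := <<s U>>.

Let sS' : sigma_algebra setT S'. Proof. exact: smallest_sigma_algebra. Qed.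

Let S'M : S' `<=` measurable.
Proof.
apply: smallest_sub; first exact: sigma_algebra_measurable.
by move=> A [n _ /SM].
Qed.

Let SS' n : S n `<=` S'.
Proof. by move=> A SA; apply: sub_sigma_algebra; exists n. Qed.

(** Members of the generated sigma-algebra are approximated in measure by
    members of the union of the sequence, since the approximable sets form a
    sigma-algebra. *)
Let approx (A : set T) := measurable A /\ forall e, 0 < e ->
  exists n B, S n B /\ (mu ((A `\` B) `|` (B `\` A)) < e%:E)%E.

Let approxU A B : approx A -> approx B -> approx (A `|` B).
Proof.
move=> [mA aA] [mB aB]; split; first exact: measurableU.
move=> e e0; have e20 : 0 < e / 2 by rewrite divr_gt0.
have [n [A' [SA' Ae]]] := aA _ e20; have [m [B' [SB' Be]]] := aB _ e20.
exists (maxn n m), (A' `|` B'); split.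
  apply: (sigmaU (sS _)).
    by case: (leD_ (leq_maxl n m)) => + _; apply.
  by case: (leD_ (leq_maxr n m)) => + _; apply.
have [mA' mB'] := (SM SA', SM SB').
rewrite [in ltRHS](splitr e) EFinD; apply: le_lt_trans (lteD Ae Be).
apply: le_trans (measureU2 _ _ _); last 2 first.
- by apply: measurableU; exact: measurableD.
- by apply: measurableU; exact: measurableD.
apply: le_measure; rewrite ?inE//.
- by apply: measurableU; apply: measurableD => //; exact: measurableU.
- by apply: measurableU; apply: measurableU; exact: measurableD.
- by move=> x; rewrite /setU /setD /=; tauto.
Qed.

Let approx_sigma : sigma_algebra setT approx.
Proof.
have a0 : approx set0.
  split => // e e0; exists 0%N, set0; split; first exact: (sigma0 (sS _)).
  by rewrite setDv setU0 measure0 lte_fin.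
split => //.
- move=> A [mA aA]; split; first exact: measurableD.
  move=> e e0; have [n [B [SB Be]]] := aA e e0.
  exists n, (~` B); split; first exact: (sigmaC (sS _)).
  apply: le_lt_trans Be; rewrite le_eqVlt; apply/orP; left; apply/eqP; congr (mu _).
  by apply/seteqP; split => x; rewrite /setU /setD /setC /=; have := pselect (B x);
    have := pselect (A x); tauto.
- move=> F aF; have mF n : measurable (F n) by case: (aF n).
  split; first exact: bigcupT_measurable.
  pose G n := \big[setU/set0]_(i < n) F i.
  have aG n : approx (G n).
    rewrite /G; elim: n => [|n IH]; first by rewrite big_ord0.
    by rewrite big_ord_recr; exact: approxU.
  have mG n : measurable (G n) by case: (aG n).
  move=> e e0; have e20 : 0 < e / 2 by rewrite divr_gt0.
  have mUF : measurable (\bigcup_n F n) by exact: bigcupT_measurable.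
  have cvG : mu (\bigcup_n F n `\` G n) @[n --> \oo] --> 0%E.
    have <- : mu (\bigcap_n (\bigcup_n F n `\` G n)) = 0%E.
      rewrite (_ : \bigcap_n _ = set0) ?measure0//; apply/seteqP; split => // x /= xG.
      have [[i _ Fi] _] := xG 0%N Logic.I.
      by have [_] := xG i.+1 Logic.I; apply; rewrite /G -bigcup_mkord; exists i => /=.
    apply: nonincreasing_cvg_mu => //.
    - by rewrite ltey_eq fin_num_measure//; exact: measurableD.
    - by move=> n; exact: measurableD.
    - by apply: bigcapT_measurable => n; exact: measurableD.
    - move=> n m nm; apply/subsetPset; apply: setDS.
      exact: subset_bigsetU.
  have [n nG] : exists n, (mu (\bigcup_n F n `\` G n) < (e / 2)%:E)%E.
    have : \forall n \near \oo, (mu (\bigcup_n F n `\` G n) < (e / 2)%:E)%E.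
      apply: (cvG [set y | (y < (e / 2)%:E)%E]); apply: open_nbhs_nbhs.
      by split; [exact: open_ereal_lt_ereal|rewrite /= lte_fin].
    by move=> /filter_ex[n]; exists n.
  have [m [B [SB Be]]] := (aG n).2 _ e20.
  exists m, B; split => //; have mB := SM SB.
  rewrite [in ltRHS](splitr e) EFinD; apply: le_lt_trans (lteD nG Be).
  apply: le_trans (measureU2 _ _ _); last 2 first.
  - exact: measurableD.
  - by apply: measurableU; exact: measurableD.
  apply: le_measure; rewrite ?inE//.
  - by apply: measurableU; exact: measurableD.
  - apply: measurableU; first exact: measurableD.
    by apply: measurableU; exact: measurableD.
  - have GF : G n `<=` \bigcup_n F n by rewrite /G; exact: bigsetU_bigcup.
    move=> x; have := GF x; rewrite /setU /setD /=.
    by have := pselect (G n x); tauto.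
Qed.

Let S'approx : S' `<=` approx.
Proof.
apply: smallest_sub; first exact: approx_sigma.
move=> A [n _ SA]; split; first exact: SM SA.
by move=> e e0; exists n, A; split => //; rewrite setDv setU0 measure0 lte_fin.
Qed.

(** [P] is good for [A] when the conditional density of the complement of [A]
    given the [n]-th sigma-algebra is at most [e] on [P]. *)
Let good n (e : R) (A P : set T) := forall E, S n E -> E `<=` P ->
  (mu (E `\` A) <= e%:E * mu E)%E.

Let bigsetU_dom n (F : nat -> set T) m : (forall i, (i < m)%N -> S n (F i)) ->
  S n (\big[setU/set0]_(i < m) F i).
Proof.
elim: m => [|m IH] SF; first by rewrite big_ord0; exact: (sigma0 (sS _)).
rewrite big_ord_recr/=; apply: (sigmaU (sS _)); last exact: SF.
by apply: IH => i im; apply: SF; rewrite ltnS ltnW.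
Qed.

(** The maximal inequality of [good_ae] leaves this bound for every error [r]
    of the approximation. *)
Lemma measure_le_small (B : set T) (e : R) : measurable B -> 0 < e ->
  (forall r, 0 < r -> (e%:E * mu B <= (e * r + r)%:E)%E) -> mu B = 0%E.
Proof.
move=> mB e0 H; have e10 : 0 < e + 1 by rewrite addr_gt0.
have : (e%:E * mu B <= 0)%E.
  apply/lee_addgt0Pr => r r0; rewrite add0e.
  apply: (le_trans (H (r / (e + 1)) _)); first by rewrite divr_gt0.
  by rewrite lee_fin -{2}[r / _]mul1r -mulrDl mulrC divfK// gt_eqF.
by rewrite pmule_rle0 ?lte_fin// measure_le0 => /eqP.
Qed.

(** The zero-one law. If [B] approximates [A] up to [r], then the points of
    [B] that some later good set misses form a disjoint union of sets on each
    of which the complement of [A] has density at least [e]. The measure of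
    that union is therefore at most r / e, and [r] is arbitrary. *)
Let good_ae A e : S' A -> 0 < e -> \forall x \ae mu, A x -> exists n, forall m,
  (n <= m)%N -> exists2 P, dens_at (D m) x P & good m e A P.
Proof.
move=> SA e0; have mA := S'M SA.
have /choice[P PP] : forall m, exists P, S m P /\ good m e A P /\
    forall E, S m E -> E `&` P = set0 -> (e%:E * mu E <= mu (E `\` A))%E.
  move=> m; have [P SP [P1 P2]] := sub_hahn mu (sS m) (@SM m) (measurableC mA) e0.
  by exists P.
have SP m : S m (P m) by case: (PP m).
have mP m : measurable (P m) by exact: SM (SP m).
pose L := A `&` \bigcap_n \bigcup_(m in [set m | (n <= m)%N]) ~` P m.
have mL : measurable L.
  apply: measurableI => //; apply: bigcapT_measurable => n.
  by apply: bigcup_measurable => m _; exact: measurableC.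
have L0 : mu L = 0%E.
  apply: (measure_le_small mL e0) => r r0.
  have [n [B [SB Br]]] := (S'approx SA).2 _ r0.
  have mB := SM SB.
  pose F j := B `\` P (n + j)%N.
  have SnB j : S (n + j)%N B by case: (leD_ (leq_addr j n)) => + _; apply.
  have SF j : S (n + j)%N (F j) by apply: (sigmaD (sS _)).
  have mF j : measurable (F j) by exact: SM (SF j).
  (* The first time a good set misses the point makes the union disjoint, and
     the pieces still belong to the sigma-algebras of the sequence. *)
  pose V := seqDU F.
  have SV j : S (n + j)%N (V j).
    apply: (sigmaD (sS _)); first exact: SF.
    apply: bigsetU_dom => i ij.
    have nij : (n + i <= n + j)%N by rewrite leq_add2l ltnW.
    by case: (leD_ nij) => + _; apply; exact: SF.
  have mV j : measurable (V j) by exact: SM (SV j).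
  pose W := \bigcup_j F j.
  have WV : W = \bigcup_j V j by rewrite /W seqDU_bigcup_eq.
  have mW : measurable W by exact: bigcupT_measurable.
  have tV : trivIset setT V by exact: trivIset_seqDU.
  have eW : (e%:E * mu W <= mu (W `\` A))%E.
    have -> : W `\` A = \bigcup_j (V j `\` A) by rewrite WV setDE setI_bigcupl.
    rewrite WV !measure_bigcup//; last 2 first.
    - by move=> j _; exact: measurableD.
    - by apply: trivIset_setIr.
    rewrite -nneseriesZl//.
    apply: lee_nneseries => // j _.
    - by rewrite mule_ge0// lee_fin ltW.
    - apply: (PP (n + j)%N).2.2 => //; apply/seteqP; split => // x [Vx Px].
      by have [_] := subset_seqDU Vx.
  have Wr : (mu (W `\` A) <= r%:E)%E.
    apply: le_trans (ltW Br); apply: le_measure; rewrite ?inE//.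
    - exact: measurableD.
    - by apply: measurableU; exact: measurableD.
    - by move=> x [[j _ [Bx _]] nA]; right.
  have LW : (mu L <= r%:E + mu W)%E.
    apply: (@le_trans _ _ (mu ((A `\` B) `|` W))%E).
      apply: le_measure; rewrite ?inE//.
        by apply: measurableU => //; exact: measurableD.
      move=> x [Ax Lx]; have [Bx|] := pselect (B x); last by left.
      have [m /= nm Pm] := Lx n Logic.I; right; exists (m - n)%N => //.
      by rewrite /F subnKC.
    apply: le_trans (measureU2 _ _ _) _ => //; first exact: measurableD.
    rewrite leeD2r//; apply: le_trans (ltW Br); apply: le_measure; rewrite ?inE//.
    - exact: measurableD.
    - by apply: measurableU; exact: measurableD.
  apply: (@le_trans _ _ (e%:E * (r%:E + mu W))%E).
    by rewrite lee_pmul2l ?lte_fin.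
  rewrite ge0_muleDr//; last by rewrite lee_fin ltW.
  rewrite EFinD EFinM. by apply: leeD => //; exact: le_trans eW Wr.
apply: filterS2 (ae_null mL L0) (ae_foralln (fun m => dens_ae (SP m))) => x nL xP Ax.
have [n nx] : exists n, forall m, (n <= m)%N -> P m x.
  apply: contrapT => H; apply: nL; split => // n _; apply: contrapT => H1.
  apply: H; exists n => m nm; apply: contrapT => Pm; apply: H1; by exists m.
by exists n => m nm; exists (P m); [exact/xP/nx|have [_ []] := PP m].
Qed.

(** Accuracies e1 and e2 for two sets give the accuracy e1 + e2 for their
    intersection; asking for every accuracy is what makes this a filter. *)
Let lim_at x : set (set T) := [set A | S' A /\ forall e, 0 < e -> exists n, forall m,
  (n <= m)%N -> exists2 P, dens_at (D m) x P & good m e A P].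

(** For a member [A] of a sigma-algebra of the sequence, a set that is good
    for [A] with accuracy less than 1 is contained in [A] up to a null set. *)
Let atE x n A : S n A -> dens_at (D n) x A <-> lim_at x A.
Proof.
move=> SA; split=> [xA|[_ /(_ (1 / 2))[//|m nP]]].
  split; first exact: SS' SA.
  move=> e e0; exists n => m nm; exists A.
    by have [_ xnm] := leD_ nm; exact/xnm.
  by move=> E _ EA; rewrite (_ : _ `\` _ = set0) ?measure0 ?mule_ge0// ?lee_fin
      ?ltW//; rewrite ?setD_eq0.
have [P xP gP] := nP _ (leq_maxl m n).
have [Snm xnm] := leD_ (leq_maxr m n).
apply/xnm => //; apply: (dens_atS xP); first exact: Snm.
have SP := dens_at_dom xP; have SPA : S (maxn m n) (P `\` A).
  by apply: (sigmaD (sS _)) => //; exact: Snm.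
have := gP _ SPA (@subDsetl _ _ _); rewrite setDE setDE -setIA setIid -setDE.
have mPA : measurable (P `\` A) by exact: SM SPA.
rewrite -(fineK (fin_num_measure mu _ mPA)) -EFinM lee_fin => H.
apply/eqP; rewrite eqe eq_le fine_ge0// andbT.
by lra.
Qed.

(** Half of the almost everywhere equivalence is the zero-one law for [A]; the
    other half is the zero-one law for the complement, as the empty set
    belongs to the filters of almost no points. *)
Lemma dens_limit : exists D', forall n, dens_le (D n) D'.
Proof.
have atT x : lim_at x setT by apply/(@atE x 0%N); [exact: sigmaT|exact: dens_atT].
have atI x A B : lim_at x A -> lim_at x B -> lim_at x (A `&` B).
  move=> [SA xA] [SB xB]; split; first exact: (sigmaI sS').
  move=> e e0; have e20 : 0 < e / 2 by rewrite divr_gt0.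
  have [n nA] := xA _ e20; have [m mB] := xB _ e20.
  exists (maxn n m) => j; rewrite geq_max => /andP[/nA[P xP gP] /mB[Q xQ gQ]].
  exists (P `&` Q); first exact: dens_atI.
  move=> E SE; rewrite subsetI => -[EP EQ]; have mE := SM SE.
  have [mA mB'] := (S'M SA, S'M SB).
  rewrite setDIr (splitr e) EFinD ge0_muleDl ?lee_fin ?(ltW e20)//.
  apply: le_trans (measureU2 _ _ _) _; [exact: measurableD..|].
  by apply: leeD; [exact: gP|exact: gQ].
have atS x A B : lim_at x A -> S' B -> mu (A `\` B) = 0%E -> lim_at x B.
  move=> [SA xA] SB AB; split => // e e0; have [n nA] := xA _ e0.
  exists n => m /nA[P xP gP]; exists P => // E SE EP.
  have [mA mB] := (S'M SA, S'M SB); have mE := SM SE.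
  apply: le_trans (gP _ SE EP).
  apply: (@le_trans _ _ (mu ((E `\` A) `|` (A `\` B)))%E).
    apply: le_measure; rewrite ?inE//; first exact: measurableD.
      by apply: measurableU; exact: measurableD.
    by move=> y; rewrite /setU /setD/=; have := pselect (A y); tauto.
  apply: le_trans (measureU2 _ _ _) _; [exact: measurableD..|].
  by rewrite [X in (_ + X <= _)%E]AB adde0.
have at_ae A : S' A -> \forall x \ae mu, lim_at x A <-> A x.
  have H B : S' B -> \forall x \ae mu, B x -> lim_at x B.
    move=> SB.
    have : \forall x \ae mu, forall j, B x -> exists n, forall m, (n <= m)%N ->
        exists2 P, dens_at (D m) x P & good m j.+1%:R^-1 B P.
      by apply: ae_foralln => j; apply: good_ae => //; rewrite invr_gt0.
    apply: filterS => x xB Bx; split => // e e0.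
    have [j je] : exists n : nat, n.+1%:R^-1 < e.
      exact: natSinv_small.
    have [n nP] := xB j Bx; exists n => m /nP[P xP gP]; exists P => // E SE EP.
    by apply: le_trans (gP _ SE EP) _; rewrite lee_wpmul2r// lee_fin ltW.
  move=> SA; have SCA := sigmaC sS' SA.
  have S00 : S 0%N set0 by exact: (sigma0 (sS _)).
  apply: filterS3 (H _ SA) (H _ SCA) (dens_ae S00) => x xA xCA x0.
  split => // atA; apply: contrapT => nA.
  have := atI x _ _ atA (xCA nA); rewrite setICr.
  by move/(atE x S00)/x0.
exists (@LowerDensity _ _ _ mu S' lim_at sS' S'M (fun x E => @proj1 _ _) atT atI atS
    at_ae) => n.
by split; [exact: SS'|move=> x A SA; exact: atE].
Qed.

End Limit.

(** * Existence of density fields *)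

Section Existence.
Context {R : realType} {d : measure_display} {T : measurableType d}.

Section Finite.
Variable mu : {finite_measure set T -> \bar R}.

(** The starting point for Zorn's lemma. The empty set has to belong to the
    filters when the whole space is null. *)
Let trivial_density : lower_density mu.
Proof.
pose S := [set set0; setT] : set (set T).
have sS : sigma_algebra setT S.
  split; first by left.
    by move=> A [->|->]; [right; rewrite setD0|left; rewrite setDv].
  move=> F SF; have [[n Fn]|H] := pselect (exists n, F n = setT).
    by right; apply/seteqP; split => // x _; exists n => //; rewrite Fn.
  left; apply/seteqP; split => // x [n _]; case: (SF n) => [->//|Fn].
  by case: H; exists n.
pose F (x : T) : set (set T) := [set A | S A /\ (A = setT \/ mu setT = 0%E)].
apply: (@LowerDensity _ _ _ mu S F sS).
- by move=> A [->|->].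
- by move=> x A [].
- by move=> x; split; [right|left].
- move=> x A B [SA AT] [SB BT]; split; first exact: (sigmaI sS).
  by case: AT BT => [->|?] [->|?]; [left; rewrite setTI|right..].
- move=> x A B [SA AT] SB AB; split => //; case: AT => [AT|]; last by right.
  by case: SB AB => [->|->]; [rewrite AT setD0; right|left].
- move=> A SA; have [T0|T0] := pselect (mu setT = 0%E); first exact: measure0_ae.
  apply: aeW => x; split=> [[_ [->//|//]]|Ax]; split => //; left.
  by case: SA Ax => ->.
Qed.

(** A chain in which every sequence is bounded has a sigma-algebra as its
    union. Otherwise some sequence is unbounded in the chain, hence cofinal,
    and running maxima turn it into an increasing one. *)
Let chain_bound (C : set (lower_density mu)) :
  (forall D1 D2, C D1 -> C D2 -> dens_le D1 D2 \/ dens_le D2 D1) ->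
  exists D, forall D', C D' -> dens_le D' D.
Proof.
move=> totC.
have [C0|/set0P[D0 CD0]] := eqVneq C set0.
  by exists trivial_density => D; rewrite C0.
have [[e [Ce nub]]|bnd] := pselect (exists e : nat -> lower_density mu, (forall n, C
    (e n)) /\
    forall D, C D -> ~ forall n, dens_le (e n) D).
  pose fix m n := if n is n'.+1 then
    if `[< dens_le (m n') (e n) >] then e n else m n' else e 0%N.
  have Cm n : C (m n) by elim: n => [|n IH] //=; case: ifPn.
  have lem n : dens_le (m n) (m n.+1).
    by move=> /=; case: ifPn => [/asboolP//|_]; exact: dens_le_refl.
  have em n : dens_le (e n) (m n).
    case: n => [|n]; first exact: dens_le_refl.
    move=> /=; case: ifPn => [_|/asboolPn H]; first exact: dens_le_refl.
    by case: (totC _ _ (Cm n) (Ce n.+1)) => // /H.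
  have [D' mD'] := dens_limit lem; exists D' => D CD.
  have [n nD] : exists n, ~ dens_le (e n) D.
    by apply: contrapT => H; apply: (nub D CD) => n; apply: contrapT => nD; apply: H;
        exists n.
  apply: dens_le_trans (mD' n); apply: dens_le_trans (em n).
  by case: (totC _ _ (Ce n) CD).
have {}bnd (e : nat -> lower_density mu) : (forall n, C (e n)) ->
    exists2 D, C D & forall n, dens_le (e n) D.
  move=> Ce; apply: contrapT => H; apply: bnd; exists e; split => // D CD eD.
  by apply: H; exists D.
have ub2 D1 D2 : C D1 -> C D2 -> exists D, [/\ C D, dens_le D1 D & dens_le D2 D].
  move=> C1 C2; case: (totC _ _ C1 C2) => H; [exists D2|exists D1];
    by split => //; exact: dens_le_refl.
pose S : set (set T) := \bigcup_(D in C) dens_dom D.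
pose F x : set (set T) := [set A | exists2 D, C D & dens_at D x A].
have FE D x A : C D -> dens_dom D A -> F x A <-> dens_at D x A.
  move=> CD DA; split=> [[D1 CD1 xA]|]; last by exists D.
  have [D2 [CD2 [l1 a1] [l a]]] := ub2 _ _ CD1 CD.
  by apply/a => //; apply/a1 => //; exact: dens_at_dom xA.
have sS : sigma_algebra setT S.
  split; first by exists D0 => //; exact: (sigma0 (dens_sigma D0)).
    by move=> A [D CD DA]; exists D => //; rewrite setTD; exact: (sigmaC (dens_sigma D)).
  move=> A SA; have /choice[e eP] : forall n, exists D, C D /\ dens_dom D (A n).
    by move=> n; case: (SA n) => D CD DA; exists D.
  have [D CD eD] := bnd e (fun n => (eP n).1).
  exists D => //; apply: (sigma_bigcup (dens_sigma D)) => n.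
  by case: (eD n) => + _; apply; case: (eP n).
have SM : S `<=` @measurable d T by move=> A [D _ /dens_measurable].
have FS x : F x `<=` S by move=> A [D CD /dens_at_dom DA]; exists D.
have FT x : F x setT by exists D0 => //; exact: dens_atT.
have FI x A B : F x A -> F x B -> F x (A `&` B).
  move=> [D1 CD1 A1] [D2 CD2 B2]; have [D [CD [l1 a1] [l2 a2]]] := ub2 _ _ CD1 CD2.
  exists D => //; by apply: dens_atI; [apply/a1|apply/a2] => //;
    [exact: dens_at_dom A1|exact: dens_at_dom B2].
have Fsup x A B : F x A -> S B -> mu (A `\` B) = 0%E -> F x B.
  move=> [D1 CD1 A1] [D2 CD2 B2]; have [D [CD [l1 a1] [l2 a2]]] := ub2 _ _ CD1 CD2.
  move=> AB; exists D => //; apply: (dens_atS _ _ AB); last exact: l2.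
  by apply/a1 => //; exact: dens_at_dom A1.
have Fae A : S A -> \forall x \ae mu, F x A <-> A x.
  by move=> [D CD DA]; apply: filterS (dens_ae DA) => x <-; exact: FE.
exists (LowerDensity sS SM FS FT FI Fsup Fae).
move=> D CD; split=> [A DA|x A DA /=]; first by exists D.
by have := FE D x A CD DA; tauto.
Qed.

Lemma lower_density_full : exists D : lower_density mu, dens_dom D = @measurable d T.
Proof.
have [| | |D maxD] := @ZL_preorder _ trivial_density (fun D D' => `[< @dens_le _ _ _
    mu D D' >]).
- by move=> D; apply/asboolP; exact: dens_le_refl.
- by move=> D1 D2 D3 /asboolP h /asboolP h'; apply/asboolP; exact: dens_le_trans h h'.
- move=> C totC'; suff [D DP] : exists D, forall D', C D' -> dens_le D' D.
    by exists D => D' /DP ?; exact/asboolP.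
  apply: chain_bound => D1 D2 C1 C2.
  by case: (totC' _ _ C1 C2) => /asboolP ?; [left|right].
exists D; apply/seteqP; split; first exact: dens_measurable.
move=> A mA; have [D' DD' D'A] := dens_extend D mA.
by have /asboolP[+ _] := maxD D' (introT (asboolP _) DD'); apply.
Qed.
End Finite.

(** The version for sigma-finite measures. By [df_finite] each filter contains
    a set of finite measure, on which bounded elements are integrable. *)
Record density_field (mu : {measure set T -> \bar R}) := DensityField {
  df_at :> T -> set (set T);
  df_measurable : forall x, df_at x `<=` measurable;
  df_I : forall x A B, df_at x A -> df_at x B -> df_at x (A `&` B);
  df_S : forall x A B, df_at x A -> measurable B -> mu (A `\` B) = 0%E -> df_at x B;
  df_ae : forall A, measurable A -> \forall x \ae mu, df_at x A <-> A x;
  df_finite : forall x, exists2 A, df_at x A & (mu A < +oo)%E }.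

(** The lower densities of the restrictions to countably many sets of finite
    measure are glued, each point using the density of one piece that contains
    it. *)
Lemma density_field_exists (mu : {measure set T -> \bar R}) :
  sigma_finite setT mu -> inhabited (density_field mu).
Proof.
move=> [F TF /all_and2[mF Foo]].
pose nu n : {finite_measure set T -> \bar R} := mfrestr (mF n) (Foo n).
have nuE n A : nu n A = mu (A `&` F n) by [].
pose D n := sval (cid (lower_density_full (nu n))).
have domD n : dens_dom (D n) = @measurable d T := svalP (cid (lower_density_full (nu n))).
have /choice[idx idxP] : forall x, exists n, F n x.
  by move=> x; have : setT x by []; rewrite TF => -[n _]; exists n.
split; apply: (@DensityField mu (fun x => dens_at (D (idx x)) x)).
- by move=> x A /dens_at_dom; rewrite domD.
- by move=> x A B; exact: dens_atI.
- move=> x A B xA mB AB; apply: (dens_atS xA); first by rewrite domD.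
  have mA : measurable A by move/dens_at_dom: xA; rewrite domD.
  rewrite nuE; apply: (@subset_measure0 _ _ _ mu _ (A `\` B)) => //.
    by apply: measurableI => //; exact: measurableD.
  exact: measurableD.
- move=> A mA.
  have H n : \forall x \ae mu, F n x -> dens_at (D n) x A <-> A x.
    have := @dens_ae _ _ _ _ (D n) A; rewrite domD => /(_ mA) [N [mN N0 NP]].
    exists (N `&` F n); split => //; first exact: measurableI.
    move=> x /= /not_implyP[Fx nx]; split => //; exact: NP.
  by apply: filterS (ae_foralln H) => x /(_ (idx x)); apply.
- move=> x; exists (F (idx x)) => //; apply: (dens_atS (dens_atT _ x)).
    by rewrite domD.
  by rewrite nuE setTD setICl measure0.
Qed.

End Existence.

(** * Real and complex scalars *)

Section ScalarEmbedding.
Context {R : realType} {k : scalar_kind}.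
Local Notation K := (scalar R k).

(** Norms take their values in this copy of the real numbers inside the
    scalars. *)
Definition rtos (r : R) : K := mk_scalar r 0.

Lemma sre_rtos r : sre (rtos r) = r. Proof. by rewrite /rtos; case: k. Qed.

Lemma sim_rtos r : sim (rtos r) = 0. Proof. by rewrite /rtos; case: k. Qed.

Lemma scalar_eqP (z w : K) : sre z = sre w -> sim z = sim w -> z = w.
Proof. by move: z w; case: k => //= -[a b] [a' b'] /= -> ->. Qed.

Lemma rtosD : {morph rtos : a b / a + b}.
Proof.
by move=> a b; apply: scalar_eqP; rewrite ?sreD ?simD ?sre_rtos ?sim_rtos ?addr0.
Qed.

Lemma rtosM : {morph rtos : a b / a * b}.
Proof.
move=> a b; apply: scalar_eqP; rewrite ?sreM ?simM ?sre_rtos ?sim_rtos.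
  by rewrite mulr0 subr0.
by rewrite mulr0 mul0r addr0.
Qed.

Lemma rtos0 : rtos 0 = 0.
Proof. by apply: scalar_eqP; rewrite ?sre_rtos ?sim_rtos ?sre0 ?sim0. Qed.

Lemma rtos1 : rtos 1 = 1. Proof. by rewrite /rtos; case: k. Qed.

Lemma ler_rtos : {mono rtos : a b / a <= b}.
Proof. by move=> a b; rewrite /rtos; case: k => //=; rewrite lecE /= eqxx. Qed.

Lemma ltr_rtos : {mono rtos : a b / a < b}.
Proof. exact: leW_mono ler_rtos. Qed.

Lemma scalar_ge0E (z : K) : 0 <= z -> z = rtos (sre z).
Proof. by move=> z0; apply: scalar_eqP; rewrite ?sre_rtos ?sim_rtos ?(sim_ge0 z0). Qed.

Lemma sre_gt0 (z : K) : 0 < z -> 0 < sre z.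
Proof. by move=> z0; rewrite -ltr_rtos -scalar_ge0E ?ltW// rtos0. Qed.

Lemma snorm_rtos r : snorm (rtos r) = `|r|.
Proof. by rewrite snormE sre_rtos sim_rtos expr0n addr0 sqrtr_sqr. Qed.

Lemma snorm1 : snorm (1 : K) = 1.
Proof. by rewrite -rtos1 snorm_rtos normr1. Qed.

Lemma sre_le_snorm (z : K) : `|sre z| <= snorm z.
Proof.
rewrite snormE -sqrtr_sqr ler_wsqrtr// lerDl; exact: sqr_ge0.
Qed.

Lemma sim_le_snorm (z : K) : `|sim z| <= snorm z.
Proof.
rewrite snormE -sqrtr_sqr ler_wsqrtr// lerDr; exact: sqr_ge0.
Qed.

Lemma snorm_le_sum (z : K) : snorm z <= `|sre z| + `|sim z|.
Proof.
rewrite snormE -[leRHS]ger0_norm ?addr_ge0// -sqrtr_sqr ler_wsqrtr// sqrrD.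
by rewrite !real_normK ?num_real// lerD2r lerDl mulrn_wge0// mulr_ge0.
Qed.

Lemma snorm0_eq0 (z : K) : snorm z = 0 -> z = 0.
Proof.
move=> z0; apply: scalar_eqP; rewrite ?sre0 ?sim0; apply/eqP;
  rewrite -normr_le0 -z0; [exact: sre_le_snorm|exact: sim_le_snorm].
Qed.

Lemma snormV (z : K) : snorm z^-1 = (snorm z)^-1.
Proof.
have [->|z0] := eqVneq z 0; first by rewrite invr0 snorm0 invr0.
have sz0 : snorm z != 0 by apply: contra_neq z0; exact: snorm0_eq0.
by apply: (mulfI sz0); rewrite -snormM !divff// snorm1.
Qed.

Section Norm.
Context {V : normedModType K}.
Implicit Types u v : V.

Lemma normr_rtos v : `|v| = rtos (rnorm v).
Proof. exact: scalar_ge0E. Qed.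

Lemma rnorm0_eq0 v : rnorm v = 0 -> v = 0.
Proof. by move=> v0; apply/eqP; rewrite -normr_eq0 normr_rtos v0 rtos0. Qed.

Lemma rnormN v : rnorm (- v) = rnorm v. Proof. by rewrite /rnorm normrN. Qed.

Lemma rdistC u v : rnorm (u - v) = rnorm (v - u). Proof. by rewrite /rnorm distrC. Qed.

Lemma rdist_tri w u v : rnorm (u - v) <= rnorm (u - w) + rnorm (w - v).
Proof. by rewrite -[u - v](subrKA w); exact: rnormD. Qed.

Lemma rdist_norm u v : `|rnorm u - rnorm v| <= rnorm (u - v).
Proof.
rewrite ler_norml; apply/andP; split; last first.
  by rewrite lerBlDr -{1}[u](subrK v); exact: rnormD.
by rewrite lerNl opprB lerBlDr rdistC -{1}[v](subrK u); exact: rnormD.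
Qed.

Lemma cvg_rnormP (u : nat -> V) (l : V) :
  u @ \oo --> l <-> (fun n => rnorm (u n - l)) @ \oo --> (0 : R).
Proof.
split=> [/cvgrPdist_lt H|/cvgrPdist_lt H].
  apply/cvgrPdist_lt => e e0; have e0' : 0 < rtos e by rewrite -rtos0 ltr_rtos.
  near=> n; rewrite sub0r normrN ger0_norm ?rnorm_ge0// rdistC.
  by rewrite -ltr_rtos -normr_rtos; near: n; exact: H.
apply/cvgrPdist_lt => e e0; have := H _ (sre_gt0 e0).
apply: filterS => n; rewrite sub0r normrN ger0_norm ?rnorm_ge0// rdistC => H1.
by rewrite normr_rtos (scalar_ge0E (ltW e0)) ltr_rtos.
Unshelve. all: by end_near. Qed.

Lemma nbhs_rnormP (v : V) (A : set V) :
  nbhs v A <-> exists2 e : R, 0 < e & forall u, rnorm (v - u) < e -> A u.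
Proof.
split=> [/nbhs_normP[e /= e0 eA]|[e e0 eA]].
  exists (sre e); first exact: sre_gt0.
  move=> u ue; apply: eA; rewrite /ball_ /= normr_rtos.
  by rewrite (scalar_ge0E (ltW e0)) ltr_rtos.
apply/nbhs_normP; exists (rtos e) => /=; first by rewrite -rtos0 ltr_rtos.
by move=> u; rewrite /ball_ /= normr_rtos ltr_rtos; exact: eA.
Qed.

Lemma closure_rnormP (A : set V) (v : V) :
  closure A v <-> forall e : R, 0 < e -> exists2 u, A u & rnorm (v - u) < e.
Proof.
split=> [cA e e0|H B /nbhs_rnormP[e e0 eB]].
  have /cA[u [Au ue]] : nbhs v [set u | rnorm (v - u) < e] by apply/nbhs_rnormP; exists e.
  by exists u.
by have [u Au ue] := H _ e0; exists u; split => //; exact: eB.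
Qed.

End Norm.

Lemma rcauchy_cvg (V : completeNormedModType K) (u : nat -> V) :
  (forall e : R, 0 < e -> exists N, forall n m, (N <= n)%N -> (N <= m)%N ->
     rnorm (u n - u m) < e) -> exists l : V, u @ \oo --> l.
Proof.
move=> H; have : cauchy (u @ \oo).
  apply: cauchy_exP => e e0; have [N NP] := H _ (sre_gt0 e0).
  exists (u N); exists N => // n /= Nn.
  rewrite -ball_normE /ball_ /= normr_rtos (scalar_ge0E (ltW e0)) ltr_rtos.
  exact: NP.
by move/cauchy_cvgP => uc; exists (lim (u @ \oo)).
Qed.

End ScalarEmbedding.

(** * Banach spaces from complete seminorms *)

Section BanachSeminorm.
Context {R : realType} {k : scalar_kind}.
Local Notation K := (scalar R k).

(** A seminorm on a subspace whose quotient by the kernel is a Banach space.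
    For completeness it is enough to have limits of sequences with increments
    at most 2^(-n), as every Cauchy sequence has such a subsequence. *)
Record banach_seminorm (V : lmodType K) := BanachSeminorm {
  bs_dom : {pred V};
  bs_fun :> V -> R;
  bs_closed : submod_closed bs_dom;
  bs_ge0 : forall v, 0 <= bs_fun v;
  bs_triangle : {in bs_dom &, forall u v, bs_fun (u + v) <= bs_fun u + bs_fun v};
  bs_scale : forall a, {in bs_dom, forall v, bs_fun (a *: v) = snorm a * bs_fun v};
  bs_complete : forall v : nat -> V, (forall n, v n \in bs_dom) ->
    (forall n, bs_fun (v n.+1 - v n) <= 2 ^- n) ->
    exists2 w, w \in bs_dom & forall e, 0 < e ->
      exists N, forall n, (N <= n)%N -> bs_fun (w - v n) < e
}.

Context {V : lmodType K} (p : banach_seminorm V).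

HB.instance Definition _ :=
  GRing.isSubmodClosed.Build K V (bs_dom p) (bs_closed p).

Record bs_sub := BsSub { bs_val :> V; bs_valP : bs_val \in bs_dom p }.

HB.instance Definition _ := [isSub for bs_val].
HB.instance Definition _ := [Choice of bs_sub by <:].
HB.instance Definition _ := [SubChoice_isSubLmodule of bs_sub by <:].

Definition bs_null : {pred bs_sub} := fun v => p (bs_val v) == 0.

Let p0 : p 0 = 0.
Proof.
rewrite -(scale0r (0 : V)) bs_scale ?snorm0 ?mul0r//.
by case: (bs_closed p).
Qed.

Let pN (v : V) : v \in bs_dom p -> p (- v) = p v.
Proof.
move=> vp; rewrite -scaleN1r bs_scale//.
by rewrite /snorm normrN1 -rtos1 sre_rtos mul1r.
Qed.

Lemma bs_null_zmod_closed : zmod_closed bs_null.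
Proof.
split; first by rewrite unfold_in; apply/eqP; exact: p0.
move=> u v; rewrite !unfold_in /= => /eqP u0 /eqP v0.
rewrite eq_le bs_ge0 andbT; apply: le_trans (bs_triangle _ _) _.
- exact: bs_valP.
- by rewrite rpredN bs_valP.
- by rewrite pN ?bs_valP// u0 v0 addr0.
Qed.

HB.instance Definition _ := GRing.isZmodClosed.Build bs_sub bs_null bs_null_zmod_closed.

Lemma bs_null_scaler_closed : GRing.scaler_closed bs_null.
Proof.
move=> a u; rewrite !unfold_in /= => /eqP u0.
by rewrite bs_scale ?bs_valP// u0 mulr0.
Qed.

Definition bs_quot : Type := lmod_quot bs_null_scaler_closed.
HB.instance Definition _ := GRing.Lmodule.on bs_quot.
HB.instance Definition _ := EqQuotient.on bs_quot.

Let piP (x : bs_quot) : exists u : bs_sub, x = \pi_bs_quot u.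
Proof. by exists (repr x); rewrite reprK. Qed.

(** The junk value 0 outside the domain lets every element of [V] define a
    section, also at the points where it has no germ. *)
Definition bs_class (v : V) : bs_quot :=
  if insub v is Some u then \pi_bs_quot u else 0.

Lemma bs_classE (u : bs_sub) : bs_class (bs_val u) = \pi_bs_quot u.
Proof. by rewrite /bs_class valK. Qed.

Let classW (v : V) (vp : v \in bs_dom p) : bs_class v = \pi_bs_quot (BsSub vp).
Proof. exact: (bs_classE (BsSub vp)). Qed.

Let piD (u v : bs_sub) : \pi_bs_quot (u + v) = \pi_bs_quot u + \pi_bs_quot v.
Proof. exact: (@pi_addr _ _ _ _ _ (Quotient.quot bs_null)). Qed.

Let piZ a (u : bs_sub) : \pi_bs_quot (a *: u) = a *: \pi_bs_quot u.
Proof. exact/esym/(quot_scale_pi bs_null_scaler_closed). Qed.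

Lemma bs_classP (x : bs_quot) : exists2 v, v \in bs_dom p & x = bs_class v.
Proof.
have [u ->] := piP x; exists (bs_val u); first exact: bs_valP.
by rewrite bs_classE.
Qed.

Lemma bs_classD (u v : V) : u \in bs_dom p -> v \in bs_dom p ->
  bs_class (u + v) = bs_class u + bs_class v.
Proof. by move=> up vp; rewrite (classW up) (classW vp) -piD -bs_classE. Qed.

Lemma bs_classZ a (u : V) : u \in bs_dom p -> bs_class (a *: u) = a *: bs_class u.
Proof. by move=> up; rewrite (classW up) -piZ -bs_classE. Qed.

Lemma bs_classB (u v : V) : u \in bs_dom p -> v \in bs_dom p ->
  bs_class (u - v) = bs_class u - bs_class v.
Proof. by move=> up vp; rewrite -scaleN1r bs_classD ?rpredZ// bs_classZ// scaleN1r. Qed.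

Let bs_normR (x : bs_quot) : R := p (bs_val (repr x)).

Let bs_normE (v : V) : v \in bs_dom p -> bs_normR (bs_class v) = p v.
Proof.
move=> vp; rewrite /bs_normR (classW vp).
set u := BsSub vp; set w := repr _.
have /(lmod_quotP bs_null_scaler_closed) : \pi_bs_quot w = \pi_bs_quot u by rewrite reprK.
rewrite unfold_in /= => /eqP wu.
have le (a b : bs_sub) : p (bs_val a - bs_val b) = 0 -> p (bs_val a) <= p (bs_val b).
  move=> ab; rewrite -[bs_val a](subrK (bs_val b)).
  apply: le_trans (bs_triangle _ _) _; rewrite ?bs_valP ?rpredB ?bs_valP//.
  by rewrite ab add0r.
rewrite -[p v]/(p (bs_val u)); apply/eqP; rewrite eq_le !le//.
by rewrite -opprB pN// rpredB ?bs_valP.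
Qed.

Definition bs_norm (x : bs_quot) : K := rtos (bs_normR x).

Let norm_triangle x y : bs_norm (x + y) <= bs_norm x + bs_norm y.
Proof.
have [u up ->] := bs_classP x; have [v vp ->] := bs_classP y.
rewrite /bs_norm -rtosD ler_rtos -bs_classD// !bs_normE ?rpredD//.
exact: bs_triangle.
Qed.

Let normZ a x : bs_norm (a *: x) = `|a| * bs_norm x.
Proof.
have [u up ->] := bs_classP x.
rewrite /bs_norm -bs_classZ// !bs_normE ?rpredZ// bs_scale// rtosM; congr (_ * _).
by rewrite /snorm -scalar_ge0E.
Qed.

Let norm0_eq0 x : bs_norm x = 0 -> x = 0.
Proof.
have [u up ->] := bs_classP x.
rewrite /bs_norm bs_normE// => /(congr1 sre); rewrite sre_rtos sre0 => u0.
rewrite (classW up) -[RHS](@pi_zeror _ _ _ _ _ (Quotient.quot bs_null)).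
apply/(lmod_quotP bs_null_scaler_closed).
by rewrite subr0 unfold_in /= u0.
Qed.

HB.instance Definition _ := Lmodule_isNormed.Build K bs_quot
  norm_triangle normZ norm0_eq0.

Lemma rnorm_bs_class (v : V) : v \in bs_dom p -> rnorm (bs_class v) = p v.
Proof.
move=> vp; rewrite /rnorm -[`|_|]/(bs_norm _) /bs_norm sre_rtos; exact: bs_normE.
Qed.

(** A Cauchy filter contains small balls; their centres form a sequence with
    geometrically small increments, whose limit is the limit of the filter. *)
Let quot_complete (F : set_system bs_quot) : ProperFilter F -> cauchy F -> cvg F.
Proof.
move=> PF /cauchyP cF.
have r0 n : 0 < 2 ^- n.+1 :> R by rewrite invr_gt0 exprn_gt0.
have /choice[x xP] : forall n, exists x : bs_quot,
    F [set y | rnorm (x - y) < 2 ^- n.+1].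
  move=> n; have rn0 : 0 < rtos (2 ^- n.+1) :> K by rewrite -rtos0 ltr_rtos.
  have [x xF] := cF _ rn0; exists x; apply: filterS xF => y.
  by rewrite -ball_normE /ball_ /= normr_rtos ltr_rtos.
have xx n : rnorm (x n.+1 - x n) <= 2 ^- n.
  have [y [ny ny1]] := filter_ex (filterI (xP n) (xP n.+1)).
  have tri := rdist_tri y (x n.+1) (x n).
  have le12 : 2 ^- n.+2 <= 2 ^- n.+1 :> R.
    by rewrite lef_pV2 ?posrE ?exprn_gt0// ler_eXn2l// ltr1n.
  have E : 2 ^- n = 2 ^- n.+1 + 2 ^- n.+1 :> R.
    by rewrite exprS; field.
  move: ny ny1; rewrite /= [rnorm (x n - y)]rdistC => ny ny1; lra.
have /choice[v vP] : forall n, exists v, v \in bs_dom p /\ x n = bs_class v.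
  by move=> n; have [v vp ->] := bs_classP (x n); exists v.
have vp n : v n \in bs_dom p by case: (vP n).
have [|w wp wP] := @bs_complete _ p v vp.
  move=> n; rewrite -rnorm_bs_class ?rpredB// bs_classB//.
  by have := xx n; rewrite !(vP _).2.
apply/cvg_ex; exists (bs_class w); apply/cvgrPdist_lt => e e0.
have e20 : 0 < sre e / 2 by rewrite divr_gt0// sre_gt0.
have [N NP] := wP _ e20.
have [M ME] : exists n : nat, 2 ^- n.+1 < sre e / 2.
  have [n nP] : exists n : nat, n.+1%:R^-1 < sre e / 2.
    exact: natSinv_small.
  exists n; apply: le_lt_trans nP; rewrite lef_pV2 ?posrE ?exprn_gt0//.
  by rewrite -natrX ler_nat ltnW// ltn_expl.
pose n := maxn N M.
have nE : 2 ^- n.+1 < sre e / 2.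
  apply: le_lt_trans ME; rewrite lef_pV2 ?posrE ?exprn_gt0//.
  by rewrite ler_eXn2l ?ltr1n// ltnS leq_maxr.
apply: filterS (xP n) => y yn.
rewrite normr_rtos (scalar_ge0E (ltW e0)) ltr_rtos.
apply: le_lt_trans (rdist_tri (x n) _ _) _.
rewrite [ltRHS](splitr (sre e)); apply: ltrD; last exact: lt_trans yn nE.
by rewrite (vP n).2 -bs_classB// rnorm_bs_class ?rpredB//; apply: NP; exact: leq_maxl.
Qed.

HB.instance Definition _ := Uniform_isComplete.Build bs_quot quot_complete.

Definition bs_space : completeNormedModType K := bs_quot.

End BanachSeminorm.

(** * Integrals of real functions *)

Section RealIntegrals.
Context {R : realType} {d : measure_display} {T : measurableType d}
  (mu : {measure set T -> \bar R}).
Implicit Types f g : T -> R.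
Local Notation Int f := (mu.-integrable setT (EFin \o f)).

Lemma ae_forall_count (I : countType) (P : I -> T -> Prop) :
  (forall i, \forall x \ae mu, P i x) -> \forall x \ae mu, forall i, P i x.
Proof.
move=> H; have : \forall x \ae mu, forall n : nat,
    (if @unpickle I n is Some i then P i x else True).
  by apply: ae_foralln => n; case: unpickle => [i|]; [exact: H|exact: aeW].
by apply: filterS => x xP i; have := xP (pickle i); rewrite pickleK.
Qed.

Lemma Int_measurable f : Int f -> measurable_fun setT f.
Proof. by move=> /measurable_int /measurable_EFinP. Qed.

Lemma Int_le f g : measurable_fun setT g -> Int f ->
  (\forall x \ae mu, `|g x| <= f x) -> Int g.
Proof.
move=> mg If gf; apply/integrableP; split; first exact/measurable_EFinP.
have /integrableP[mf] := If; apply: le_lt_trans.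
apply: ae_ge0_le_integral => //.
- by do 2 apply: measurableT_comp => //.
- by do 2 apply: measurableT_comp => //; exact: Int_measurable.
apply: filterS gf => x gfx _ /=; rewrite lee_fin.
exact: le_trans gfx (ler_norm _).
Qed.

Lemma IntD f g : Int f -> Int g -> Int (fun x => f x + g x).
Proof. by move=> If Ig; exact: (integrableD measurableT If Ig). Qed.

Lemma IntB f g : Int f -> Int g -> Int (fun x => f x - g x).
Proof. by move=> If Ig; exact: (integrableB measurableT If Ig). Qed.

Lemma IntZ (a : R) f : Int f -> Int (fun x => a * f x).
Proof. by move=> If; apply: (integrableZl measurableT a If). Qed.

Lemma rint_ae_ge0 f : Int f -> (\forall x \ae mu, 0 <= f x) -> 0 <= \int[mu]_x f x.
Proof.
move=> If f0; have mf := Int_measurable If.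
rewrite /Rintegral (ae_eq_integral (fun x => `|f x|%:E)) //.
- by apply: fine_ge0; apply: integral_ge0.
- exact/measurable_EFinP.
- by apply/measurable_EFinP; exact: measurableT_comp.
- by apply: filterS f0 => x fx _ /=; rewrite ger0_norm.
Qed.

Lemma rint_ae_le f g : Int f -> Int g -> (\forall x \ae mu, f x <= g x) ->
  \int[mu]_x f x <= \int[mu]_x g x.
Proof.
move=> If Ig fg; rewrite -subr_ge0 -RintegralB//.
by apply: rint_ae_ge0; [exact: IntB|apply: filterS fg => x; rewrite subr_ge0].
Qed.

Lemma rint_ae_eq f g : Int f -> measurable_fun setT g -> (\forall x \ae mu, f x = g x) ->
  \int[mu]_x f x = \int[mu]_x g x.
Proof.
move=> If mg fg; rewrite /Rintegral; congr fine; apply: ae_eq_integral => //.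
- exact/measurable_EFinP/Int_measurable.
- exact/measurable_EFinP.
- by apply: filterS fg => x + _ /= => ->.
Qed.

Lemma rint_eq0_ae f : Int f -> (\forall x \ae mu, 0 <= f x) -> \int[mu]_x f x <= 0 ->
  \forall x \ae mu, f x = 0.
Proof.
move=> If f0 i0; have mf := Int_measurable If.
have Iaf : Int (fun x => `|f x|).
  by apply: (Int_le _ If); [exact: measurableT_comp|apply: filterS f0 => x fx;
      rewrite normr_id ger0_norm].
have : (\int[mu]_x `|(EFin \o f) x|)%E = 0%E.
  rewrite -[LHS]fineK ?integrable_fin_num//.
  apply/eqP; rewrite eqe eq_le fine_ge0 ?integral_ge0// andbT.
  apply: le_trans i0; rewrite -/(Rintegral mu setT (fun x => `|f x|)).
  by apply: rint_ae_le => //; apply: filterS f0 => x fx; rewrite ger0_norm.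
move/(ae_eq_integral_abs mu measurableT).
move=> H; have /H : measurable_fun setT (EFin \o f) by exact/measurable_EFinP.
by apply: filterS => x /(_ Logic.I) [].
Qed.

Lemma measurable_indicR (A : set T) : measurable A ->
  measurable_fun setT (\1_A : T -> R).
Proof. exact: measurable_indic. Qed.

Lemma indic_ge0 (A : set T) x : 0 <= \1_A x :> R. Proof. by rewrite indicE. Qed.

Lemma indic_le1 (A : set T) x : \1_A x <= 1 :> R.
Proof. by rewrite indicE; case: (_ \in _). Qed.

Lemma Int_indic (A : set T) f : measurable A -> Int f -> Int (fun x => \1_A x * f x).
Proof.
move=> mA If; have mf := Int_measurable If.
have Iaf : Int (fun x => `|f x|) by exact: (integrable_abse If).
apply: (Int_le _ Iaf).
  by apply: measurable_funM => //; exact: measurable_indicR.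
apply: aeW => x; rewrite normrM ger0_norm ?indic_ge0//.
by rewrite ler_piMl// indic_le1.
Qed.

(** Integrate over the set where the inequality fails. *)
Lemma ae_le_of_set_integrals f g : Int f -> Int g ->
  (forall A, measurable A -> \int[mu]_x (\1_A x * f x) <= \int[mu]_x (\1_A x * g x)) ->
  \forall x \ae mu, f x <= g x.
Proof.
move=> If Ig H; have [mf mg] := (Int_measurable If, Int_measurable Ig).
pose A := [set x | g x < f x].
have mA : measurable A by rewrite -[A]setTI; exact: measurable_fun_ltr.
pose h x := \1_A x * f x - \1_A x * g x.
have Ih : Int h by apply: IntB; exact: Int_indic.
have h0 : \forall x \ae mu, h x = 0.
  apply: rint_eq0_ae => //.
    apply: aeW => x; rewrite /h -mulrBr indicE.
    by have [/set_mem/ltW|] := boolP (x \in A); rewrite ?mul0r// mul1r subr_ge0.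
  by rewrite /h RintegralB//; [rewrite subr_le0; exact: H|exact: Int_indic..].
apply: filterS h0 => x; rewrite /h -mulrBr indicE leNgt => h0; apply/negP => fg.
by move: h0; rewrite mem_set// mul1r => /subr0_eq E; move: fg; rewrite E ltxx.
Qed.

Lemma ae_eq_of_set_integrals f g : Int f -> Int g ->
  (forall A, measurable A -> \int[mu]_x (\1_A x * f x) = \int[mu]_x (\1_A x * g x)) ->
  \forall x \ae mu, f x = g x.
Proof.
move=> If Ig H; apply: filterS2 (ae_le_of_set_integrals If Ig _)
  (ae_le_of_set_integrals Ig If _) => [x||].
- by move=> fg gf; apply/eqP; rewrite eq_le fg gf.
- by move=> A mA; rewrite H.
- by move=> A mA; rewrite H.
Qed.

(** The form in which convergence in L^1 is used to obtain inequalities almost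
    everywhere, without passing to subsequences. *)
Lemma ae_le0_of_small f : measurable_fun setT f ->
  (forall e, 0 < e -> exists g, [/\ Int g, \int[mu]_x g x <= e,
     (\forall x \ae mu, 0 <= g x) & \forall x \ae mu, f x <= g x]) ->
  \forall x \ae mu, f x <= 0.
Proof.
move=> mf H; pose h x := Num.max (f x) 0.
have mh : measurable_fun setT h by exact: measurable_maxr.
have h0 x : 0 <= h x by rewrite /h le_max lexx orbT.
have Hh e : 0 < e -> Int h /\ \int[mu]_x h x <= e.
  move=> /H[g [Ig ge g0 fg]].
  have hg : \forall x \ae mu, h x <= g x.
    by apply: filterS2 fg g0 => x fg g0; rewrite /h ge_max fg g0.
  have Ih : Int h.
    by apply: (Int_le mh Ig); apply: filterS hg => x; rewrite ger0_norm.
  by split => //; apply: le_trans ge; exact: rint_ae_le.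
have [Ih _] := Hh 1 ltr01.
have : \forall x \ae mu, h x = 0.
  apply: rint_eq0_ae => //; first exact: aeW.
  by apply/ler_addgt0Pr => e e0; rewrite add0r; case: (Hh e e0).
by apply: filterS => x hx; rewrite -hx /h le_max lexx.
Qed.

Lemma dominated_small (g_ : nat -> T -> R) w :
  (forall n, measurable_fun setT (g_ n)) -> Int w ->
  (\forall x \ae mu, forall n, 0 <= g_ n x <= w x) ->
  (\forall x \ae mu, (fun n => g_ n x) @ \oo --> (0 : R)) ->
  forall e, 0 < e -> exists N, forall n, (N <= n)%N -> \int[mu]_x g_ n x < e.
Proof.
move=> mg Iw gw g0 e e0.
have [|| | |_ _ H] := @dominated_convergence _ _ _ mu setT measurableT
  (fun n => EFin \o g_ n) (cst 0%E) (EFin \o w) _ _ _ Iw.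
- by move=> n; apply/measurable_EFinP.
- exact: measurable_cst.
- by apply: filterS g0 => x gx _; apply/fine_cvgP; split => //; exact: nearW.
- by apply: filterS gw => x + n _ => /(_ n) /andP[g0' gw']; rewrite /= lee_fin ger0_norm.
move: H; rewrite integral0 => /fine_cvgP[_ /cvgrPdist_lt/(_ _ e0)] [N _ NP].
exists N => n Nn; have := NP n Nn; rewrite /= sub0r normrN.
by apply: le_lt_trans; exact: ler_norm.
Qed.

Lemma measurable_inv_pos (f : T -> R) : measurable_fun setT f -> (forall x, 0 < f x) ->
  measurable_fun setT (fun x => (f x)^-1).
Proof.
move=> mf f0.
have -> : (fun x => (f x)^-1) = (fun x => f x `^ (-1)).
  by apply/funext => x; rewrite powR_inv1// ltW.
exact: measurableT_comp (measurable_powR _) mf.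
Qed.

Hypothesis cmu : measure_is_complete mu.

Lemma measurable_ae_eq f g : measurable_fun setT f ->
  (\forall x \ae mu, f x = g x) -> measurable_fun setT g.
Proof.
move=> mf fg; apply/measurable_EFinP.
apply: (@ae_measurable_fun _ _ _ mu cmu _ (EFin \o f)); last exact/measurable_EFinP.
by apply: filterS fg => x + _ /= => ->.
Qed.

Lemma measurable_ae_cvg (f_ : nat -> T -> R) f :
  (forall n, measurable_fun setT (f_ n)) ->
  (\forall x \ae mu, (fun n => f_ n x) @ \oo --> f x) -> measurable_fun setT f.
Proof.
move=> mf [N [mN N0 NP]].
apply: (@measurable_ae_eq (fun x => \1_(~` N) x * f x)).
  apply: (@measurable_fun_cvg _ _ _ _ (fun n x => \1_(~` N) x * f_ n x)).
    by move=> n; apply: measurable_funM => //; apply: measurable_indicR; exact: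
        measurableC.
  move=> x _; rewrite indicE; have [|/negP xN] := boolP (x \in ~` N).
    move=> /set_mem xN; rewrite mul1r.
    under eq_fun do rewrite mul1r.
    by apply: contrapT => H; apply: xN; apply: NP.
  under eq_fun do rewrite mul0r.
  by rewrite mul0r; exact: cvg_cst.
exists N; split => // x /= H; apply: contrapT => xN; apply: H.
by rewrite indicE mem_set// mul1r.
Qed.

End RealIntegrals.

(** * Elements of L^oo and their representatives *)

Section ScalarFunctions.
Context {R : realType} {k : scalar_kind} {d : measure_display}
  {T : measurableType d} (mu : {measure set T -> \bar R}).
Local Notation K := (scalar R k).
Local Notation Int f := (mu.-integrable setT (EFin \o f)).
Local Notation Li := (Linfty k mu).
Local Notation smeas := (@scalar_measurable R k d T).

Lemma sre_integral (h : T -> K) : sre (scalar_integral mu h) = \int[mu]_x sre (h x).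
Proof. by rewrite /scalar_integral; move: h; case: k. Qed.

Lemma sim_integral (h : T -> K) : sim (scalar_integral mu h) = \int[mu]_x sim (h x).
Proof.
rewrite /scalar_integral; move: h; case: k => //= h.
by rewrite /Rintegral integral0.
Qed.

Lemma scalar_measurable_rtos (f : T -> R) : measurable_fun setT f ->
  smeas (fun x => rtos (f x) : K).
Proof.
move=> mf; split.
  by rewrite (_ : _ \o _ = f) //; apply/funext => x /=; rewrite sre_rtos.
rewrite (_ : _ \o _ = cst 0); first exact: measurable_cst.
by apply/funext => x /=; rewrite sim_rtos.
Qed.

Definition Linf_function (f : T -> K) : Prop := smeas f /\ ess_bounded mu f.

(** Total on functions, with value 0 outside L^oo, so that elements of L^oo
    can be written by formulas. *)
Definition to_Linfty (f : T -> K) : Li :=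
  if insub (f : T -> K^o) is Some g then \pi_(Linfty k mu) g else 0.

Lemma to_LinftyE f : Linf_function f -> \forall x \ae mu, repr (to_Linfty f) x = f x.
Proof.
move=> bf; have fP : (f : T -> K^o) \in Linf_pred mu by exact/asboolP.
by rewrite /to_Linfty insubT; exact: Linfty_repr.
Qed.

Lemma repr_Linf_function (F : Li) : Linf_function (repr F).
Proof. exact/asboolP/(Linf_valP (repr F)). Qed.

Lemma Linfty_eqP (F G : Li) : (\forall x \ae mu, repr F x = repr G x) -> F = G.
Proof. by move=> H; rewrite -[F]reprK -[G]reprK; exact/Linfty_piP. Qed.

Lemma repr_mul (F G : Li) :
  \forall x \ae mu, repr (Linfty_mul F G) x = repr F x * repr G x.
Proof. exact: Linfty_repr. Qed.

Lemma repr_abs (F : Li) : \forall x \ae mu, repr (Linfty_abs F) x = `|repr F x|.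
Proof. exact: Linfty_repr. Qed.

Lemma repr_lin a (F G : Li) :
  \forall x \ae mu, repr (a *: F + G) x = a * repr F x + repr G x.
Proof.
have -> : a *: F + G = \pi_(Linfty k mu) (a *: repr F + repr G).
  rewrite -{1}[G]reprK; apply/esym.
  exact: (@pi_addr _ _ _ _ _ (Quotient.quot (@Linf_null _ _ _ _ mu))).
exact: Linfty_repr.
Qed.

Lemma Linf_function_indic (A : set T) : measurable A -> Linf_function (fun x => rtos
    (\1_A x) : K).
Proof.
move=> mA; split; first by apply: scalar_measurable_rtos; exact: measurable_indicR.
by exists 1; apply: aeW => x; rewrite snorm_rtos ger0_norm ?indic_ge0 ?indic_le1.
Qed.

Lemma Linf_function_cst (c : K) : Linf_function (cst c).
Proof. by split; [exact: scalar_measurable_cst|exists (snorm c); exact: aeW]. Qed.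

Lemma Linf_functionB f g : Linf_function f -> Linf_function g -> Linf_function (fun x
    => f x - g x).
Proof.
move=> [mf bf] [mg bg].
have [mN bN] : Linf_function (fun x => -1 * g x).
  have [mc bc] := Linf_function_cst (-1).
  by split; [exact: (scalar_measurableM mc)|exact: (ess_boundedM bc)].
have E : (fun x => f x - g x) = (fun x => f x + -1 * g x).
  by apply/funext => x; rewrite mulN1r.
by rewrite E; split; [exact: scalar_measurableD|exact: ess_boundedD].
Qed.

Lemma Linfty_norm_le (F : Li) (M : R) : 0 <= M ->
  (\forall x \ae mu, snorm (repr F x) <= M) -> Linfty_norm F <= M.
Proof.
move=> M0 FM; rewrite /Linfty_norm unlock /=.
case: ifPn => // mu0; rewrite -lee_fin.
set g := (fun _ => _ : \bar R).
have gM : (ess_sup mu (abse \o g) <= M%:E)%E.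
  apply/ess_supP; apply: filterS FM => x Fx.
  by rewrite /g /= lee_fin ger0_norm ?snorm_ge0.
have g0 : (0 <= ess_sup mu (abse \o g))%E.
  by apply: ess_sup_gee => //; apply: aeW => x; exact: abse_ge0.
by rewrite fineK// fin_numElt (lt_le_trans (ltNyr 0) g0) (le_lt_trans gM (ltry M)).
Qed.

Lemma le_Linfty_norm (F : Li) : \forall x \ae mu, snorm (repr F x) <= Linfty_norm F.
Proof.
pose g x := (snorm (repr F x))%:E.
have : Linfty_norm F = fine (if (0 < mu setT)%E then ess_sup mu (abse \o g) else 0%E).
  by rewrite /Linfty_norm unlock.
case: ifPn => [mu0|]; last first.
  rewrite -leNgt measure_le0 => /eqP mu0 _; exact: measure0_ae.
move: (Linfty_norm F) => N EN.
have [_ [M FM]] := repr_Linf_function F.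
have gM : (ess_sup mu (abse \o g) <= M%:E)%E.
  apply/ess_supP; apply: filterS FM => x Fx.
  by rewrite /g /= lee_fin ger0_norm ?snorm_ge0.
have g0 : (0 <= ess_sup mu (abse \o g))%E.
  by apply: ess_sup_gee => //; apply: aeW => x; exact: abse_ge0.
have gfin : ess_sup mu (abse \o g) \is a fin_num.
  by rewrite fin_numElt (lt_le_trans (ltNyr 0) g0) (le_lt_trans gM (ltry M)).
apply: filterS (ess_sup_ge mu (abse \o g)) => x; rewrite -{1}(fineK gfin) -EN /g /=
    lee_fin.
by rewrite ger0_norm ?snorm_ge0.
Qed.

Lemma sre_real_mul (z w : K) : sim w = 0 -> sre (z * w) = sre z * sre w.
Proof. by rewrite sreM => ->; rewrite mulr0 subr0. Qed.

End ScalarFunctions.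

(** * The pointwise norm of an L^1-normed module *)

Section Densities.
Context {R : realType} {k : scalar_kind} {d : measure_display}
  {T : measurableType d} (mu : {measure set T -> \bar R}).
Local Notation K := (scalar R k).
Local Notation Int f := (mu.-integrable setT (EFin \o f)).
Local Notation Li := (Linfty k mu).
Variable Gam : L1_normed_module k mu.
Implicit Types (s t : Gam) (F G : Li).

(** A representative of the density of the functional |s|; it is real and
    nonnegative only almost everywhere. *)
Definition density_rep s : T -> K := s2val (cid2 (l1_abs_in_L1 s)).

Let repI s : scalar_integrable mu (density_rep s) := s2valP (cid2 (l1_abs_in_L1 s)).

Let repE s F : l1_abs s F = scalar_integral mu (fun x => repr F x * density_rep s x) :=
  s2valP' (cid2 (l1_abs_in_L1 s)) F.

Let rep_sm s : scalar_measurable (density_rep s).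
Proof. by case: (repI s) => /Int_measurable ? /Int_measurable ?; split. Qed.

Definition Linfty_indic (A : set T) : Li := to_Linfty mu (fun x => rtos (\1_A x)).

Lemma Linfty_indicE A : measurable A -> \forall x \ae mu, repr (Linfty_indic A) x =
    rtos (\1_A x).
Proof. by move=> mA; apply: to_LinftyE; exact: Linf_function_indic. Qed.

Lemma Linfty_indic_ge0 A : measurable A -> Linfty_ge0 (Linfty_indic A).
Proof.
move=> mA; apply: filterS (Linfty_indicE mA) => x ->; rewrite -rtos0 ler_rtos; exact:
    indic_ge0.
Qed.

Let mprod s F : scalar_measurable (fun x => repr F x * density_rep s x).
Proof. by apply: scalar_measurableM; [case: (repr_Linf_function F)|exact: rep_sm]. Qed.

Let sre_ind s A : measurable A ->
  sre (l1_abs s (Linfty_indic A)) = \int[mu]_x (\1_A x * sre (density_rep s x)).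
Proof.
move=> mA; rewrite repE sre_integral; apply/esym/rint_ae_eq.
- by apply: Int_indic => //; case: (repI s).
- by case: (mprod s (Linfty_indic A)).
- by apply: filterS (Linfty_indicE mA) => x ->; rewrite sreM sre_rtos sim_rtos mul0r
    subr0.
Qed.

Let sim_ind s A : measurable A ->
  sim (l1_abs s (Linfty_indic A)) = \int[mu]_x (\1_A x * sim (density_rep s x)).
Proof.
move=> mA; rewrite repE sim_integral; apply/esym/rint_ae_eq.
- by apply: Int_indic => //; case: (repI s).
- by case: (mprod s (Linfty_indic A)).
- by apply: filterS (Linfty_indicE mA) => x ->; rewrite simM sre_rtos sim_rtos mul0r
    addr0.
Qed.

Lemma rint0 : \int[mu]_(x in setT) (0 : R) = 0.
Proof. by rewrite /Rintegral integral0. Qed.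

Let Int0 : Int (cst 0 : T -> R). Proof. exact: integrable0. Qed.

(** Test the positivity of the functional on indicators. *)
Let rep_ge0 s : \forall x \ae mu, 0 <= sre (density_rep s x).
Proof.
have [Ir _] := repI s.
apply: (ae_le_of_set_integrals (f := cst 0)) => // A mA.
under eq_Rintegral do rewrite mulr0.
rewrite rint0 -sre_ind// -(sre0 k); apply: ler_sre; apply: l1_abs_ge0; exact:
    Linfty_indic_ge0.
Qed.

Let rep_real s : \forall x \ae mu, sim (density_rep s x) = 0.
Proof.
have [_ Ii] := repI s.
apply: (ae_eq_of_set_integrals (g := cst 0)) => // A mA.
under [RHS]eq_Rintegral do rewrite mulr0.
rewrite rint0 -sim_ind//; apply: sim_ge0; apply: l1_abs_ge0; exact: Linfty_indic_ge0.
Qed.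

(** The representative of |s| used throughout. Taking the positive part makes
    it nonnegative at every point. *)
Definition pnorm s : T -> R := fun x => Num.max (sre (density_rep s x)) 0.

Lemma pnorm_ge0 s x : 0 <= pnorm s x.
Proof. by rewrite /pnorm le_max lexx orbT. Qed.

Let pnormE s : \forall x \ae mu, sre (density_rep s x) = pnorm s x.
Proof. by apply: filterS (rep_ge0 s) => x sx; rewrite /pnorm max_l. Qed.

Lemma pnorm_measurable s : measurable_fun setT (pnorm s).
Proof. by apply: measurable_maxr => //; case: (rep_sm s). Qed.

Lemma pnorm_Int s : Int (pnorm s).
Proof.
have [Ir _] := repI s; apply: (Int_le (pnorm_measurable s) Ir).
by apply: filterS (pnormE s) => x sx; rewrite /= sx ger0_norm ?pnorm_ge0.
Qed.

Lemma Int_bounded_pnorm s (f : T -> R) (M : R) : measurable_fun setT f ->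
  (\forall x \ae mu, `|f x| <= M) -> Int (fun x => f x * pnorm s x).
Proof.
move=> mf fM; apply: (Int_le _ (IntZ M (pnorm_Int s))).
  by apply: measurable_funM => //; exact: pnorm_measurable.
apply: filterS fM => x fx; rewrite normrM [`|pnorm _ _|]ger0_norm ?pnorm_ge0//.
by rewrite ler_wpM2r// pnorm_ge0.
Qed.

Lemma Linf_function_Int s (f : T -> K) : Linf_function mu f ->
  Int (fun x => sre (f x) * pnorm s x) /\ Int (fun x => snorm (f x) * pnorm s x).
Proof.
move=> [mf [M fM]]; split; apply: (@Int_bounded_pnorm _ _ M).
- by case: mf.
- by apply: filterS fM => x; apply: le_trans; exact: sre_le_snorm.
- exact: measurable_snorm.
- by apply: filterS fM => x; rewrite ger0_norm ?snorm_ge0.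
Qed.

Lemma abs_sre s F : sre (l1_abs s F) = \int[mu]_x (sre (repr F x) * pnorm s x).
Proof.
rewrite repE sre_integral; apply/esym/rint_ae_eq.
- exact: (Linf_function_Int s (repr_Linf_function F)).1.
- by case: (mprod s F).
- by apply: filterS2 (pnormE s) (rep_real s) => x sx ix; rewrite sre_real_mul// sx.
Qed.

Lemma abs_ind s A : measurable A ->
  sre (l1_abs s (Linfty_indic A)) = \int[mu]_x (\1_A x * pnorm s x).
Proof.
move=> mA; rewrite abs_sre; apply/esym/rint_ae_eq.
- exact/Int_indic/pnorm_Int.
- exact/Int_measurable/(Linf_function_Int s (repr_Linf_function _)).1.
- by apply: filterS (Linfty_indicE mA) => x ->; rewrite sre_rtos.
Qed.

Lemma pnormD s t : \forall x \ae mu, pnorm (s + t) x <= pnorm s x + pnorm t x.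
Proof.
apply: ae_le_of_set_integrals; first exact: pnorm_Int.
  by apply: IntD; exact: pnorm_Int.
move=> A mA; under [leRHS]eq_Rintegral do rewrite mulrDr.
rewrite RintegralD//; try exact/Int_indic/pnorm_Int.
by rewrite -!abs_ind// -sreD; apply: ler_sre; apply: l1_abs_triangle; exact:
    Linfty_indic_ge0.
Qed.

(** Both functionals have the same values on indicators, by the compatibility
    of |.| with the action. *)
Lemma pnorm_act F s : \forall x \ae mu, pnorm (mod_act F s) x = snorm (repr F x) *
    pnorm s x.
Proof.
have [_ IF] := Linf_function_Int s (repr_Linf_function F).
apply: ae_eq_of_set_integrals => //; first exact: pnorm_Int.
move=> A mA; rewrite -abs_ind// l1_abs_act abs_sre; apply/esym/rint_ae_eq.
- exact: Int_indic.
- exact/Int_measurable/(Linf_function_Int s (repr_Linf_function _)).1.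
- apply: filterS3 (repr_mul (Linfty_abs F) (Linfty_indic A)) (repr_abs F)
    (Linfty_indicE mA) => x -> -> ->.
  by rewrite sreM sre_rtos sim_rtos mulr0 subr0 mulrA [_ * \1_A x]mulrC.
Qed.

Definition Linfty_one : Li := to_Linfty mu (cst 1).

Lemma Linfty_oneE : \forall x \ae mu, repr Linfty_one x = 1.
Proof. exact/to_LinftyE/Linf_function_cst. Qed.

(** The dual norm of a positive functional is its value at 1. For the upper
    bound, a value phi(F) is rotated to its modulus by a scalar of modulus 1,
    after which only real parts matter. *)
Lemma rint_pnorm s : \int[mu]_x pnorm s x = rnorm s.
Proof.
rewrite -l1_abs_norm /dual_norm.
set S := (X in sup X).
have I0 : 0 <= \int[mu]_x pnorm s x.
  by apply: Rintegral_ge0 => x _; exact: pnorm_ge0.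
have ubS : ubound S (\int[mu]_x pnorm s x).
  move=> _ [F /= F1 <-]; set z := l1_abs s F.
  have [->|z0] := eqVneq z 0; first by rewrite snorm0.
  pose c := rtos (snorm z) / z : K.
  have c1 : snorm c = 1.
    rewrite /c snormM snorm_rtos snormV ger0_norm ?snorm_ge0// divff//.
    by apply: contra_neq z0; exact: snorm0_eq0.
  have -> : snorm z = sre (l1_abs s (c *: F)).
    by rewrite scalarZ -/z /c divfK// sre_rtos.
  rewrite abs_sre; apply: rint_ae_le.
  - exact: (Linf_function_Int s (repr_Linf_function _)).1.
  - exact: pnorm_Int.
  - have := repr_lin c F 0; rewrite addr0.
    have r0 : \forall x \ae mu, repr (0 : Li) x = 0.
      have -> : (0 : Li) = \pi_(Linfty k mu) 0.
        by rewrite -[LHS](@pi_zeror _ _ _ _ _ (Quotient.quot (@Linf_null _ _ _ _ mu))).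
      exact: Linfty_repr.
    move=> cF; apply: filterS3 cF r0 (le_Linfty_norm F) => x -> -> Fx.
    rewrite addr0 -[leRHS]mul1r ler_wpM2r ?pnorm_ge0//.
    apply: (le_trans (ler_norm _)); apply: (le_trans (sre_le_snorm _)).
    by rewrite snormM c1 mul1r (le_trans Fx).
have [F1 S1] : Linfty_norm Linfty_one <= 1 /\ S (snorm (l1_abs s Linfty_one)).
  have F1 : Linfty_norm Linfty_one <= 1.
    by apply: Linfty_norm_le => //; apply: filterS Linfty_oneE => x ->; rewrite snorm1.
  by split => //; exists Linfty_one.
apply/eqP; rewrite eq_le; apply/andP; split; last by apply: ge_sup => //; exists
    (snorm (l1_abs s Linfty_one)).
have supS : has_sup S by split; [exists (snorm (l1_abs s Linfty_one))|exists
    (\int[mu]_x pnorm s x)].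
apply: le_trans (ub_le_sup supS.2 S1).
apply: le_trans (le_trans (ler_norm _) (sre_le_snorm _)).
rewrite abs_sre; apply: rint_ae_le; first exact: pnorm_Int.
  exact: (Linf_function_Int s (repr_Linf_function _)).1.
by apply: filterS Linfty_oneE => x ->; rewrite -rtos1 sre_rtos mul1r.
Qed.

Lemma Linfty_mul1 F : Linfty_mul Linfty_one F = F.
Proof.
by apply: Linfty_eqP; apply: filterS2 (repr_mul Linfty_one F) Linfty_oneE => x -> ->;
    rewrite mul1r.
Qed.

Lemma actDr F s t : mod_act F (s + t) = mod_act F s + mod_act F t.
Proof. by have := mod_act_linearr F 1 s t; rewrite !scale1r. Qed.

Lemma act0r F : mod_act F (0 : Gam) = 0.
Proof. by apply: (addrI (mod_act F 0)); rewrite -actDr !addr0. Qed.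

Lemma actZr F a s : mod_act F (a *: s) = a *: mod_act F s.
Proof. by have := mod_act_linearr F a s 0; rewrite act0r !addr0. Qed.

Lemma actNr F s : mod_act F (- s) = - mod_act F s.
Proof. by rewrite -scaleN1r actZr scaleN1r. Qed.

(** Non-degeneracy makes the module unitary: 1 acts trivially on the elements
    F s, hence on their closed span. *)
Lemma act1 s : mod_act Linfty_one s = s.
Proof.
have n1 : Linfty_norm Linfty_one <= 1.
  by apply: Linfty_norm_le => //; apply: filterS Linfty_oneE => x ->; rewrite snorm1.
apply/eqP; rewrite -subr_eq0; apply/eqP/rnorm0_eq0/eqP.
rewrite eq_le rnorm_ge0 andbT; apply/ler_addgt0Pr => e e0; rewrite add0r.
have e20 : 0 < e / 2 by rewrite divr_gt0.
have : closure (lin [set mod_act F s | F in [set: Li] & s in [set: Gam]]) s.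
  by rewrite mod_nondegenerate.
move=> /closure_rnormP/(_ _ e20)[u [n [c [v [vP uE]]]] su].
have u1 : mod_act Linfty_one u = u.
  rewrite uE (big_morph (mod_act Linfty_one) (actDr Linfty_one) (act0r Linfty_one)).
  apply: eq_bigr => i _; rewrite actZr; congr (_ *: _).
  by case: (vP i) => F _ [w _ <-]; rewrite -mod_actM Linfty_mul1.
have -> : mod_act Linfty_one s - s = mod_act Linfty_one (s - u) - (s - u).
  by rewrite actDr actNr u1 opprB addrA subrK.
rewrite (splitr e); apply: le_trans (rnormD _ _) _; apply: lerD; last by rewrite
    rnormN ltW.
apply: (le_trans (mod_act_norm _ _)).
by apply: le_trans (ltW su); rewrite ler_piMl// rnorm_ge0.
Qed.

Lemma act_lin a F G s : mod_act (a *: F + G) s = a *: mod_act F s + mod_act G s.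
Proof. exact: mod_act_linearl. Qed.

Lemma act_sub F c s :
  mod_act F s - c *: s = mod_act (to_Linfty mu (fun x => repr F x - c)) s.
Proof.
rewrite -{2}[s]act1 addrC -scaleNr -act_lin; congr (mod_act _ s).
have bF : Linf_function mu (fun x => repr F x - c) by exact: (Linf_functionB
    (repr_Linf_function F) (Linf_function_cst mu c)).
apply: Linfty_eqP; apply: filterS3 (repr_lin (- c) Linfty_one F) Linfty_oneE
    (to_LinftyE bF) => x -> -> ->.
by rewrite mulr1 addrC.
Qed.

Lemma pnorm_act_sub F c s : \forall x \ae mu,
  pnorm (mod_act F s - c *: s) x = snorm (repr F x - c) * pnorm s x.
Proof.
have bF : Linf_function mu (fun x => repr F x - c) by exact: (Linf_functionB
    (repr_Linf_function F) (Linf_function_cst mu c)).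
rewrite act_sub; pose G := to_Linfty mu (fun x => repr F x - c).
by apply: filterS2 (pnorm_act G s) (to_LinftyE bF) => x -> ->.
Qed.

Lemma pnormZ a s : \forall x \ae mu, pnorm (a *: s) x = snorm a * pnorm s x.
Proof.
have E : a *: s = mod_act (to_Linfty mu (cst a)) s.
  apply/esym/eqP; rewrite -subr_eq0 act_sub; apply/eqP.
  apply: rnorm0_eq0; rewrite -rint_pnorm -[RHS]rint0; apply: rint_ae_eq => //.
    exact: pnorm_Int.
  have ba := Linf_function_cst mu a.
  have b0 : Linf_function mu (fun x => repr (to_Linfty mu (cst a)) x - a).
    exact: (Linf_functionB (repr_Linf_function _) ba).
  pose G := to_Linfty mu (fun x => repr (to_Linfty mu (cst a)) x - a).
  apply: filterS3 (pnorm_act G s) (to_LinftyE b0) (to_LinftyE ba) => x -> -> ->.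
  by rewrite subrr snorm0 mul0r.
rewrite E; pose G := to_Linfty mu (cst a).
by apply: filterS2 (pnorm_act G s) (to_LinftyE (Linf_function_cst mu a)) => x -> ->.
Qed.

Lemma pnorm0 : \forall x \ae mu, pnorm 0 x = 0.
Proof.
rewrite -(scale0r (0 : Gam)); apply: filterS (pnormZ 0 0) => x ->.
by rewrite snorm0 mul0r.
Qed.

Lemma pnorm_eq0 s : (\forall x \ae mu, pnorm s x = 0) -> s = 0.
Proof.
move=> s0; apply: rnorm0_eq0; rewrite -rint_pnorm -[RHS]rint0.
by apply: rint_ae_eq => //; exact: pnorm_Int.
Qed.

End Densities.

(** * The seminorm of germs at a point *)

Section Lin.
Context {K : pzRingType} {V : lmodType K} (A : set V).

Lemma lin0 : lin A 0.
Proof. by exists 0%N, (fun=> 0), (fun=> 0); split; [case|rewrite big_ord0]. Qed.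

Lemma lin_linear a (u v : V) : lin A u -> lin A v -> lin A (a *: u + v).
Proof.
move=> [n [c [x [Ax ->]]]] [m [c' [x' [Ax' ->]]]].
exists (n + m)%N, (fun i => match fintype.split i with inl j => a * c j | inr j => c'
    j end),
  (fun i => match fintype.split i with inl j => x j | inr j => x' j end); split.
  by move=> i; case: (fintype.split i).
rewrite big_split_ord /= scaler_sumr; congr (_ + _); apply: eq_bigr => i _.
  by case: split_ordP => j; [move/lshift_inj => <-; rewrite scalerA|move/eqP; rewrite
      eq_lrshift].
by case: split_ordP => j; [move/eqP; rewrite eq_rlshift|move/rshift_inj => <-].
Qed.

Lemma lin_mem u : A u -> lin A u.
Proof. by move=> Au; exists 1%N, (fun=> 1), (fun=> u); split => //; rewrite big_ord1
    scale1r. Qed.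

End Lin.

Lemma pow2_small {R : realType} (c e : R) : 0 <= c -> 0 < e ->
  exists N, forall n, (N <= n)%N -> c * 2 ^- n < e.
Proof.
move=> c0 e0; have e1 : 0 < e / (c + 1) by rewrite divr_gt0// ltr_wpDl.
have [N NP] : exists n : nat, n.+1%:R^-1 < e / (c + 1).
  exact: natSinv_small.
exists N.+1 => n Nn; have cp : 0 < c + 1 by rewrite ltr_wpDl.
have : 2 ^- n < e / (c + 1).
  apply: le_lt_trans NP; rewrite lef_pV2 ?posrE ?exprn_gt0//.
  by rewrite -natrX ler_nat (leq_trans Nn)// ltnW// ltn_expl.
have p0 : 0 < 2 ^- n :> R by rewrite invr_gt0 exprn_gt0.
rewrite ltr_pdivlMr// => H; apply: le_lt_trans H.
by rewrite mulrC ler_wpM2l ?ltW// ltrDl.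
Qed.

Section PointSeminorm.
Context {R : realType} {k : scalar_kind} {d : measure_display}
  {T : measurableType d} (mu : {measure set T -> \bar R}).
Local Notation K := (scalar R k).
Local Notation Int f := (mu.-integrable setT (EFin \o f)).
Local Notation Li := (Linfty k mu).
Variables (Gam : L1_normed_module k mu) (df : density_field mu) (S : set Gam).
Variable x : T.
Implicit Types (s t u v : Gam) (F G : Li).

(** The filters are closed upwards up to null sets, for null sets that need
    not be given as measurable. *)
Lemma df_sub A B : df x A -> measurable B -> (\forall y \ae mu, A y -> B y) -> df x B.
Proof.
move=> xA mB AB; apply: (df_S xA) => //; apply: measure_negligible.
  by apply: measurableD => //; exact: df_measurable xA.
by apply: negligibleS AB => y [Ay nB] /= /(_ Ay).
Qed.

Lemma df_setT : df x setT.
Proof. by have [A xA _] := df_finite df x; apply: (df_sub xA) => //; exact: aeW. Qed.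

(** [r] is an upper bound for the limit superior of the pointwise norm of [s]
    along the filter at [x]. *)
Definition germ_ub s (r : R) := 0 <= r /\ df x [set y | pnorm s y <= r].
Definition germ_bounded s := exists r, germ_ub s r.

(** The limit superior of the pointwise norm of [s] along the filter at [x].
    It is meaningful on [germ_bounded] elements; elsewhere the infimum is 0. *)
Definition germ_norm s : R := inf [set r | germ_ub s r].

Lemma measurable_pnorm_le s r : measurable [set y | pnorm s y <= r].
Proof. by rewrite -[X in measurable X]setTI; apply: measurable_fun_ler => //; exact:
    pnorm_measurable. Qed.

Lemma germ_ubI A s r : df x A -> 0 <= r -> (\forall y \ae mu, A y -> pnorm s y <= r)
    -> germ_ub s r.
Proof. by move=> xA r0 H; split => //; apply: (df_sub xA) => //; exact:
    measurable_pnorm_le. Qed.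

Lemma germ_ubW s r r' : germ_ub s r -> r <= r' -> germ_ub s r'.
Proof.
move=> [r0 xs] rr'; apply: (germ_ubI xs); first exact: le_trans rr'.
by apply: aeW => y /= /le_trans; apply.
Qed.

Lemma germ_ubD s t r r' : germ_ub s r -> germ_ub t r' -> germ_ub (s + t) (r + r').
Proof.
move=> [r0 xs] [r'0 xt]; apply: (germ_ubI (df_I xs xt)); first exact: addr_ge0.
apply: filterS (pnormD s t) => y H [/= sy ty]; apply: le_trans H _; exact: lerD.
Qed.

Lemma germ_ubZ a s r : germ_ub s r -> germ_ub (a *: s) (snorm a * r).
Proof.
move=> [r0 xs]; apply: (germ_ubI xs); first by rewrite mulr_ge0// snorm_ge0.
by apply: filterS (pnormZ a s) => y -> /= H; rewrite ler_wpM2l// snorm_ge0.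
Qed.

Lemma germ_ub0 : germ_ub 0 0.
Proof. by apply: (germ_ubI df_setT) => //; apply: filterS (pnorm0 Gam) => y ->. Qed.

Lemma germ_norm_le s r : germ_ub s r -> germ_norm s <= r.
Proof. by move=> H; apply: ge_inf => //; exists 0 => ? []. Qed.

Lemma germ_norm_ge0 s : 0 <= germ_norm s.
Proof.
have [[r H]|H] := pselect (germ_bounded s); first by apply: lb_le_inf; [exists
    r|move=> ? []].
rewrite /germ_norm (_ : [set r | germ_ub s r] = set0) ?inf0//; apply/seteqP; split =>
    // r Hr.
by case: H; exists r.
Qed.

Lemma germ_norm_lt s r : germ_bounded s -> germ_norm s < r -> germ_ub s r.
Proof.
move=> [r' H] sr; have [|r'' H'' /ltW] := inf_lt _ sr; last exact: germ_ubW.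
by exists r'.
Qed.

Lemma germ_boundedD s t : germ_bounded s -> germ_bounded t -> germ_bounded (s + t).
Proof. by move=> [r ?] [r' ?]; exists (r + r'); exact: germ_ubD. Qed.

Lemma germ_boundedZ a s : germ_bounded s -> germ_bounded (a *: s).
Proof. by move=> [r ?]; exists (snorm a * r); exact: germ_ubZ. Qed.

Lemma germ_bounded0 : germ_bounded 0. Proof. by exists 0; exact: germ_ub0. Qed.

Lemma germ_boundedN s : germ_bounded s -> germ_bounded (- s).
Proof. by move=> fs; rewrite -scaleN1r; exact: germ_boundedZ. Qed.

Lemma germ_boundedB s t : germ_bounded s -> germ_bounded t -> germ_bounded (s - t).
Proof. by move=> fs ft; apply: germ_boundedD => //; exact: germ_boundedN. Qed.

Lemma germ_normD s t : germ_bounded s -> germ_bounded t -> germ_norm (s + t) <=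
    germ_norm s + germ_norm t.
Proof.
move=> fs ft; apply/ler_addgt0Pr => e e0; have e20 : 0 < e / 2 by rewrite divr_gt0.
rewrite (splitr e) addrACA; apply: germ_norm_le; apply: germ_ubD; apply: germ_norm_lt
    => //;
  by rewrite ltrDl.
Qed.

Let germ_normZ_le a s : germ_bounded s -> germ_norm (a *: s) <= snorm a * germ_norm s.
Proof.
move=> fs; apply/ler_addgt0Pr => e e0.
have e1 : 0 < e / (snorm a + 1) by rewrite divr_gt0// ltr_wpDl// snorm_ge0.
have H : germ_ub s (germ_norm s + e / (snorm a + 1)) by apply: germ_norm_lt => //;
    rewrite ltrDl.
apply: le_trans (germ_norm_le (germ_ubZ a H)) _; rewrite mulrDr lerD2l mulrCA.
apply: ler_piMr; first exact: ltW.
by rewrite ler_pdivrMr ?ltr_wpDl ?snorm_ge0// mul1r lerDl.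
Qed.

Lemma germ_normZ a s : germ_bounded s -> germ_norm (a *: s) = snorm a * germ_norm s.
Proof.
move=> fs; apply/eqP; rewrite eq_le germ_normZ_le//=.
have [->|a0] := eqVneq a 0; first by rewrite snorm0 mul0r germ_norm_ge0.
have sa : 0 < snorm a.
  by rewrite lt_neqAle snorm_ge0 andbT eq_sym; apply: contra_neq a0; exact: snorm0_eq0.
rewrite -{1}[s]scale1r -(mulVf a0) -scalerA.
apply: le_trans (ler_wpM2l (ltW sa) (germ_normZ_le _ (germ_boundedZ a fs))) _.
by rewrite snormV mulrA divff ?mul1r// gt_eqF.
Qed.

(** The bounded elements whose germ is a limit of germs from the span of [S].
    Choosing [S] countable makes the fibre separable. *)
Definition germ_dom : {pred Gam} := fun s => `[< germ_bounded s /\ forall e, 0 < e ->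
  exists v, [/\ lin S v, germ_bounded v & germ_norm (s - v) < e] >].

Lemma germ_domP s : reflect (germ_bounded s /\ forall e, 0 < e ->
  exists v, [/\ lin S v, germ_bounded v & germ_norm (s - v) < e]) (s \in germ_dom).
Proof. exact: asboolP. Qed.

Lemma germ_dom_bounded s : s \in germ_dom -> germ_bounded s. Proof. by
    case/germ_domP. Qed.

Lemma germ_dom_closed : submod_closed germ_dom.
Proof.
split.
  apply/germ_domP; split; first exact: germ_bounded0.
  move=> e e0; exists 0; split; [exact: lin0|exact: germ_bounded0|].
  by rewrite subrr; apply: le_lt_trans e0; exact: germ_norm_le germ_ub0.
move=> a s t /germ_domP[fs cs] /germ_domP[ft ct]; apply/germ_domP; split.
  by apply: germ_boundedD => //; exact: germ_boundedZ.
move=> e e0; have e20 : 0 < e / 2 by rewrite divr_gt0.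
have a1 : 0 < snorm a + 1 by rewrite ltr_wpDl// snorm_ge0.
have e1 : 0 < e / 2 / (snorm a + 1) by rewrite divr_gt0.
have [u [Su fu su]] := cs _ e1; have [v [Sv fv tv]] := ct _ e20.
exists (a *: u + v); split; [exact: lin_linear|by apply: germ_boundedD => //; exact:
    germ_boundedZ|].
have -> : a *: s + t - (a *: u + v) = a *: (s - u) + (t - v).
  by rewrite scalerBr opprD addrACA.
have fsu : germ_bounded (s - u) by exact: germ_boundedB.
apply: le_lt_trans (germ_normD (germ_boundedZ a fsu) (germ_boundedB ft fv)) _.
rewrite germ_normZ// (splitr e); apply: ler_ltD => //.
apply: le_trans (_ : (snorm a + 1) * (e / 2 / (snorm a + 1)) <= _).
  by apply: ler_pM; rewrite ?snorm_ge0 ?germ_norm_ge0// ?lerDl// ltW.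
by rewrite mulrC divfK// gt_eqF.
Qed.

Let germ_normD_dom : {in germ_dom &, forall u v, germ_norm (u + v) <= germ_norm u +
    germ_norm v}.
Proof. by move=> u v /germ_dom_bounded fu /germ_dom_bounded fv; exact: germ_normD. Qed.

Let germ_normZ_dom a : {in germ_dom, forall v, germ_norm (a *: v) = snorm a *
    germ_norm v}.
Proof. by move=> u /germ_dom_bounded fu; exact: germ_normZ. Qed.

(** Each increment is multiplied by the indicator of a member of the filter on
    which it is bounded by [r n] and which has finite measure. The germs of
    the increments do not change, and the new increments are summable in the
    norm of the module, so that their sum exists there. *)
Let germ_norm_complete (v : nat -> Gam) : (forall n, v n \in germ_dom) ->
    (forall n, germ_norm (v n.+1 - v n) <= 2 ^- n) ->
    exists2 w, w \in germ_dom & forall e, 0 < e ->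
      exists N, forall n, (N <= n)%N -> germ_norm (w - v n) < e.
Proof.
move=> vd vv; have fv n := germ_dom_bounded (vd n).
(* The factor 2 makes r n strictly larger than the n-th increment, hence a
   bound on a member of the filter. *)
pose r n : R := 2 * 2 ^- n.
have p0 n : 0 < 2 ^- n :> R by rewrite invr_gt0 exprn_gt0.
have r0 n : 0 < r n by rewrite mulr_gt0.
have rS n : r n = r n.+1 + r n.+1 by rewrite /r exprS; field.
pose A n := [set y | pnorm (v n.+1 - v n) y <= r n].
have xA n : df x (A n).
  suff [] : germ_ub (v n.+1 - v n) (r n) by [].
  apply: germ_norm_lt; first exact: germ_boundedB.
  by apply: le_lt_trans (vv n) _; rewrite /r mulr2n mulrDl mul1r ltrDl.
have [B xB Boo] := df_finite df x.
have mB : measurable B by exact: df_measurable xB.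
pose G n := A n `&` B.
have xG n : df x (G n) by exact: df_I.
have mG n : measurable (G n) by exact: df_measurable (xG n).
pose de n := mod_act (@Linfty_indic R k d T mu (G n)) (v n.+1 - v n).
have de_le n : \forall y \ae mu, pnorm (de n) y <= r n * \1_B y.
  apply: filterS2 (pnorm_act (@Linfty_indic R k d T mu (G n)) (v n.+1 - v n))
      (@Linfty_indicE R k d T mu _ (mG n)) => y -> ->.
  rewrite snorm_rtos ger0_norm ?indic_ge0// !indicE.
  have [/set_mem[Ay By]|] := boolP (y \in G n).
    by rewrite (mem_set By) mul1r mulr1.
  by rewrite mul0r mulr_ge0// ltW.
have IB : Int (\1_B : T -> R).
  apply/integrableP; split; first exact/measurable_EFinP/measurable_indicR.
  under eq_integral do rewrite /= ger0_norm ?indic_ge0//.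
  by rewrite integral_indic// setIT.
pose m : R := \int[mu]_x \1_B x.
have m0 : 0 <= m by apply: Rintegral_ge0 => y _; exact: indic_ge0.
have nde n : rnorm (de n) <= r n * m.
  rewrite -rint_pnorm /m -RintegralZl//; apply: rint_ae_le => //; first exact: pnorm_Int.
  exact: IntZ.
pose W n := \sum_(i < n) de i.
have WS n : W n.+1 = W n + de n by rewrite /W big_ord_recr.
have Wn q j : rnorm (W (q + j)%N - W q) <= (2 * r q - 2 * r (q + j)%N) * m.
  elim: j => [|j IH]; first by rewrite addn0 !subrr rnorm0 mul0r.
  rewrite addnS WS addrAC; apply: le_trans (rnormD _ _) _.
  apply: le_trans (lerD IH (nde _)) _; rewrite -mulrDl ler_wpM2r//.
  by rewrite (rS (q + j)%N); lra.
have Wd q j : \forall y \ae mu, pnorm (W (q + j)%N - W q) y <= 2 * r q - 2 * r (q + j)%N.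
  elim: j => [|j IH].
    by rewrite addn0 subrr; apply: filterS (pnorm0 Gam) => y ->; rewrite subrr.
  rewrite addnS WS addrAC.
  apply: filterS3 IH (de_le (q + j)%N) (pnormD (W (q + j)%N - W q) (de (q + j)%N)).
  move=> y H1 H2 /le_trans; apply.
  have H3 : r (q + j)%N * \1_B y <= r (q + j)%N.
    by rewrite ler_piMr ?indic_le1// ltW.
  have := rS (q + j)%N; lra.
have [w0 Ww] : exists w0 : Gam, W @ \oo --> w0.
  apply: rcauchy_cvg => e e0; have e20 : 0 < e / 2 by rewrite divr_gt0.
  have [N NP] := @pow2_small _ (4 * m) (e / 2) (mulr_ge0 (ler0n _ 4) m0) e20.
  have H n : (N <= n)%N -> rnorm (W n - W N) < e / 2.
    move=> Nn; apply: le_lt_trans (NP N (leqnn N)).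
    have := Wn N (n - N)%N; rewrite subnKC// => /le_trans; apply.
    rewrite [leRHS]mulrAC ler_wpM2r//; have := r0 n; rewrite /r; lra.
  exists N => n p Nn Np; apply: le_lt_trans (rdist_tri (W N) _ _) _.
  by rewrite (splitr e); apply: ltrD; [exact: H|rewrite rdistC; exact: H].
have w0d n : \forall y \ae mu, pnorm (w0 - W n) y - 2 * r n <= 0.
  apply: ae_le0_of_small.
    by apply: measurable_funB => //; exact: pnorm_measurable.
  move=> e e0; move/cvg_rnormP/cvgrPdist_lt: Ww => /(_ e e0)[N _ NP].
  pose j := (N + n)%N; exists (pnorm (w0 - W (n + j)%N)); split.
  - exact: pnorm_Int.
  - have := NP (n + j)%N; rewrite /= sub0r normrN ger0_norm ?rnorm_ge0// => H.
    rewrite rint_pnorm rdistC ltW//; apply: H.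
    by rewrite /j addnCA leq_addr.
  - by apply: aeW => y; exact: pnorm_ge0.
  - apply: filterS2 (Wd n j) (pnormD (w0 - W (n + j)%N) (W (n + j)%N - W n)) => y.
    by rewrite subrKA => H1 H2; have := r0 (n + j)%N; lra.
pose w := v 0%N + w0.
have ubw n : germ_ub (w - v n) (2 * r n).
  have -> : w - v n = (w0 - W n) + (v 0%N + W n - v n).
    rewrite addrA; congr (_ - _).
    by rewrite [v 0%N + W n]addrC addrA subrK addrC.
  rewrite -[2 * r n]addr0; apply: germ_ubD.
    apply: (germ_ubI df_setT); first by rewrite mulr_ge0// ltW.
    by apply: filterS (w0d n) => y; rewrite subr_le0.
  elim: n => [|n IH]; first by rewrite /W big_ord0 addr0 subrr; exact: germ_ub0.
  have -> : v 0%N + W n.+1 - v n.+1 =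
      (v 0%N + W n - v n) + (de n - 1 *: (v n.+1 - v n)).
    by rewrite scale1r WS opprB [de n + _]addrCA [in RHS](addrA _ (v n)) subrK !addrA.
  rewrite -[0]addr0; apply: germ_ubD => //.
  apply: (germ_ubI (xG n)) => //.
  apply: filterS2 (pnorm_act_sub (@Linfty_indic R k d T mu (G n)) 1 (v n.+1 - v n))
      (@Linfty_indicE R k d T mu _ (mG n)).
  by move=> y -> -> Gy; rewrite indicE mem_set// rtos1 subrr snorm0 mul0r.
have fw : germ_bounded w.
  by rewrite -[w](subrK (v 0%N)); apply: germ_boundedD => //; exists (2 * r 0%N);
      exact: ubw.
have pw e : 0 < e -> exists N, forall n, (N <= n)%N -> germ_norm (w - v n) < e.
  move=> e0; have [N NP] := @pow2_small _ 4 e (ler0n _ 4) e0.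
  exists N => n /NP; apply: le_lt_trans; apply: le_trans (germ_norm_le (ubw n)) _.
  by rewrite /r mulrA -natrM.
exists w => //; apply/germ_domP; split => // e e0.
have e20 : 0 < e / 2 by rewrite divr_gt0.
have [N NP] := pw _ e20; have /germ_domP[_ /(_ _ e20)[u [Su fu vu]]] := vd N.
exists u; split => //; rewrite -(subrKA (v N)).
apply: le_lt_trans (germ_normD (germ_boundedB fw (fv N)) (germ_boundedB (fv N) fu)) _.
by rewrite (splitr e); apply: ltrD => //; exact: NP.
Qed.

Definition point_seminorm : banach_seminorm Gam :=
  BanachSeminorm germ_dom_closed germ_norm_ge0 germ_normD_dom germ_normZ_dom
      germ_norm_complete.

End PointSeminorm.

(** * Rational scalars, and a positive integrable weight *)

Section RationalScalars.
Context {R : realType} {k : scalar_kind}.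
Local Notation K := (scalar R k).

(** Indexes a countable dense set of scalars, in the real and the complex case
    alike. *)
Definition qscalar (q : rat * rat) : K := mk_scalar (ratr q.1) (ratr q.2).

Lemma qscalar_dense (z : K) (e : R) : 0 < e -> exists q, snorm (z - qscalar q) < e.
Proof.
move=> e0; have e20 : 0 < e / 2 by rewrite divr_gt0.
have H (a : R) : exists q : rat, `|a - ratr q| < e / 2.
  have [|q] := @rat_in_itvoo _ (a - e / 2) (a + e / 2); first by lra.
  rewrite in_itv /= => /andP[q1 q2]; exists q.
  by rewrite ltr_norml; apply/andP; split; lra.
have [p Hp] := H (sre z); have [q Hq] := H (sim z); exists (p, q).
apply: le_lt_trans (snorm_le_sum _) _; rewrite (splitr e).
rewrite /qscalar; move: z Hp Hq; case: k => [z|[a b]] /= Hp Hq; last by apply: ltrD.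
by rewrite normr0; apply: ltrD => //.
Qed.

End RationalScalars.

(** The sum of suitable multiples of the indicators of a countable cover by
    sets of finite measure. *)
Lemma sigma_finite_weight {R : realType} {d : measure_display} {T : measurableType d}
    (mu : {measure set T -> \bar R}) : sigma_finite setT mu ->
  exists2 w : T -> R, mu.-integrable setT (EFin \o w) & forall x, 0 < w x.
Proof.
move=> [F TF /all_and2[mF Foo]].
(* The n-th term of the sum has integral at most 2 ^- n.+1 and values at most
   2 ^- n.+1. *)
pose c n : R := (2 ^+ n.+1 * (1 + fine (mu (F n))))^-1.
have c0 n : 0 < c n.
  by rewrite invr_gt0 mulr_gt0 ?exprn_gt0// ltr_pwDl// fine_ge0.
pose g n x : \bar R := (c n * \1_(F n) x)%:E.
have g0 n x : (0 <= g n x)%E by rewrite lee_fin mulr_ge0 ?indic_ge0// ltW.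
have mg n : measurable_fun setT (g n).
  by apply/measurable_EFinP; apply: measurable_funM => //; exact: measurable_indicR.
pose W x := (\sum_(n <oo) g n x)%E.
have W0 x : (0 <= W x)%E by apply: nneseries_ge0.
have mW : measurable_fun setT W by apply: ge0_emeasurable_sum.
have p2 : (\sum_(n <oo) (0 + (1 / (2 ^ n.+1)%:R)%:E) <= 1%:E :> \bar R)%E.
  have := @epsilon_trick R (fun=> 0%E) 1 xpredT (fun=> lexx _) ler01.
  by rewrite [X in (_ <= X + _)%E]eseries0// add0e.
have gle n x : (g n x <= 0 + (1 / (2 ^ n.+1)%:R)%:E)%E.
  rewrite add0e lee_fin div1r natrX; apply: le_trans (_ : c n <= _).
    by rewrite ler_piMr ?indic_le1// ltW.
  rewrite lef_pV2 ?posrE ?exprn_gt0 ?mulr_gt0 ?exprn_gt0 ?ltr_pwDl ?fine_ge0//.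
  by rewrite ler_pMr ?exprn_gt0// lerDl fine_ge0.
have Wle x : (W x <= 1%:E)%E.
  by apply: le_trans p2; apply: lee_nneseries.
have Wfin x : W x \is a fin_num.
  by rewrite fin_numElt (lt_le_trans (ltNyr 0) (W0 x)) (le_lt_trans (Wle x) (ltry 1)).
exists (fun x => fine (W x)); last first.
  move=> x; have : setT x by []; rewrite TF => -[n _ Fnx].
  rewrite fine_gt0// ltey_eq Wfin andbT.
  apply: lt_le_trans (_ : (g n x <= W x)%E).
    by rewrite lte_fin mulr_gt0// indicE mem_set.
  by rewrite /W (@nneseriesD1 _ _ n xpredT)// leeDl// nneseries_ge0.
apply/integrableP; split.
  by apply/measurable_EFinP; exact: measurableT_comp.
rewrite (eq_integral W); last by move=> x _; rewrite /= ger0_norm ?fineK// fine_ge0.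
rewrite integral_nneseries//; apply: le_lt_trans (ltry 1).
apply: le_trans p2; apply: lee_nneseries => [n _ _|n _]; first exact: integral_ge0.
rewrite /g; under eq_integral do rewrite EFinM.
have mI : measurable_fun setT (fun x => (\1_(F n) x)%:E : \bar R).
  by apply/measurable_EFinP; exact: measurable_indicR.
have -> : (\int[mu]_x ((c n)%:E * (\1_(F n) x)%:E) = (c n)%:E * \int[mu]_x (\1_(F n)
    x)%:E)%E.
  apply: ge0_integralZl => //; last by rewrite lee_fin ltW.
rewrite integral_indic// setIT add0e -(@fineK _ (mu (F n))); last by rewrite ge0_fin_numE.
rewrite -EFinM lee_fin div1r natrX /c invfM -mulrA ler_piMr ?invr_ge0 ?exprn_ge0//.
by rewrite mulrC ler_pdivrMr ?ltr_pwDl ?fine_ge0// mul1r lerDr.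
Qed.

(** * Elements of the module as sections of germs *)

Section Bundle.
Context {R : realType} {k : scalar_kind} {d : measure_display}
  {T : measurableType d} (mu : {measure set T -> \bar R}).
Local Notation K := (scalar R k).
Local Notation Int f := (mu.-integrable setT (EFin \o f)).
Local Notation Li := (Linfty k mu).
Hypothesis cmu : measure_is_complete mu.
Variables (Gam : L1_normed_module k mu) (df : density_field mu) (S : set Gam).
Hypothesis dS : forall s (e : R), 0 < e -> exists2 u, S u & rnorm (s - u) < e.
Implicit Types (s t u v : Gam) (F G : Li).

Local Notation ps := (point_seminorm df S).

Definition fibre (x : T) : completeNormedModType K := bs_space (ps x).

(** The transform of an element into a section, whose value at each point is
    the germ there. *)
Definition hat s : section fibre := fun x => bs_class (ps x) s : fibre x.

Local Notation "'dom' x" := (bs_dom (ps x)) (at level 10, x at level 9).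

(** For almost every [x], membership of the level sets of |s| at all rational
    levels is decided by the value |s|(x). *)
Lemma germ_norm_ae s : \forall x \ae mu, germ_bounded df x s /\ germ_norm df x s =
    pnorm s x.
Proof.
have H : \forall x \ae mu, forall q : rat,
    df x [set y | pnorm s y <= ratr q] <-> pnorm s x <= ratr q.
  by apply: ae_forall_count => q; apply: df_ae; exact: measurable_pnorm_le.
apply: filterS H => x xq.
have ub_gt r : pnorm s x < r -> germ_ub df x s r.
  move=> sr; have [q] := @rat_in_itvoo _ _ _ sr; rewrite in_itv /= => /andP[sq qr].
  have : germ_ub df x s (ratr q).
    by split; [exact: le_trans (pnorm_ge0 s x) (ltW sq)|apply/xq; exact: ltW].
  by move/germ_ubW; apply; exact: ltW.
have fs : germ_bounded df x s by exists (pnorm s x + 1); apply: ub_gt; rewrite ltrDl.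
split => //; apply/eqP; rewrite eq_le; apply/andP; split.
  by apply/ler_addgt0Pr => e e0; apply: germ_norm_le; apply: ub_gt; rewrite ltrDl.
apply: lb_le_inf; first exact: fs.
move=> r [r0 xr]; rewrite leNgt; apply/negP => /(@rat_in_itvoo _ _ _)[q].
rewrite in_itv /= => /andP[rq qs].
have /xq : df x [set y | pnorm s y <= ratr q].
  apply: (df_sub xr); first exact: measurable_pnorm_le.
  by apply: aeW => y /= /le_trans; apply; exact: ltW.
by rewrite leNgt qs.
Qed.

(** Elements of [S] converging to [s] in norm have pointwise distances to [s]
    with infimum 0 almost everywhere. *)
Lemma dom_ae s : \forall x \ae mu, s \in dom x.
Proof.
have /choice[u uP] : forall n : nat, exists u, S u /\ rnorm (s - u) < n.+1%:R^-1.
  move=> n; have n0 : 0 < n.+1%:R^-1 :> R by rewrite invr_gt0.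
  by have [u Su su] := dS s n0; exists u.
have small : \forall x \ae mu, forall j : nat, exists n, pnorm (s - u n) x < j.+1%:R^-1.
  apply: ae_foralln => j.
  pose N := \bigcap_n [set x | j.+1%:R^-1 <= pnorm (s - u n) x].
  have mN : measurable N.
    apply: bigcapT_measurable => n; rewrite -[X in measurable X]setTI.
    by apply: measurable_fun_ler => //; exact: pnorm_measurable.
  have j0 : 0 < j.+1%:R^-1 :> R by rewrite invr_gt0.
  have : \forall x \ae mu, j.+1%:R^-1 * \1_N x <= 0 :> R.
    apply: ae_le0_of_small.
      by apply: measurable_funM => //; exact: measurable_indicR.
    move=> e e0; have [n ne] : exists n : nat, n.+1%:R^-1 < e.
      exact: natSinv_small.
    exists (pnorm (s - u n)); split.
    - exact: pnorm_Int.
    - by rewrite rint_pnorm; apply: ltW; apply: lt_trans ne; case: (uP n).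
    - by apply: aeW => x; exact: pnorm_ge0.
    - apply: aeW => x; rewrite indicE; have [/set_mem xN|_] := boolP (x \in N).
        by rewrite mulr1; exact: xN.
      by rewrite mulr0 pnorm_ge0.
  apply: filterS => x xN; apply: contrapT => H; move: xN; rewrite indicE mem_set.
    by rewrite mulr1 leNgt j0.
  by move=> n _ /=; rewrite leNgt; apply/negP => H1; apply: H; exists n.
have H1 := ae_foralln (fun n => germ_norm_ae (u n)).
have H2 := ae_foralln (fun n => germ_norm_ae (s - u n)).
apply: filterS2 (filterI H1 H2) (filterI small (germ_norm_ae s)) => x [x1 x2] [x3 [fs _]].
apply/germ_domP; split => // e e0.
have [j je] : exists n : nat, n.+1%:R^-1 < e.
  exact: natSinv_small.
have [n nj] := x3 j; exists (u n); split.
- by apply: lin_mem; case: (uP n).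
- by case: (x1 n).
- by rewrite (x2 n).2; exact: lt_trans nj je.
Qed.

Lemma hat_norm s : \forall x \ae mu, rnorm (hat s x) = pnorm s x.
Proof.
apply: filterS2 (dom_ae s) (germ_norm_ae s) => x sx [_ <-].
exact: rnorm_bs_class.
Qed.

Lemma hatD s t : \forall x \ae mu, hat (s + t) x = hat s x + hat t x.
Proof. by apply: filterS2 (dom_ae s) (dom_ae t) => x sx tx; exact: bs_classD. Qed.

Lemma hatZ a s : \forall x \ae mu, hat (a *: s) x = a *: hat s x.
Proof. by apply: filterS (dom_ae s) => x sx; exact: bs_classZ. Qed.

Lemma hatB s t : \forall x \ae mu, hat (s - t) x = hat s x - hat t x.
Proof.
apply: filterS2 (hatD s (- t)) (hatZ (-1) t) => x ->.
by rewrite !scaleN1r => ->.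
Qed.

Lemma hat_dist s t : \forall x \ae mu, rnorm (hat s x - hat t x) = pnorm (s - t) x.
Proof. by apply: filterS2 (hat_norm (s - t)) (hatB s t) => x <- ->. Qed.

(** Near [x], along the filter, F is close to the scalar F(x): the filter
    contains the level sets around rational scalars that contain [x]. As |s|
    is bounded along the filter, the germ of F s - F(x) s has seminorm 0. *)
Lemma hat_act F s : \forall x \ae mu, hat (mod_act F s) x = repr F x *: hat s x.
Proof.
pose A (qr : rat * rat * rat) := [set y | snorm (repr F y - qscalar qr.1) <= ratr
    qr.2 :> R].
have mF : scalar_measurable (repr F) by case: (repr_Linf_function F).
have mA qr : measurable (A qr).
  rewrite -[A qr]setTI; apply: measurable_fun_ler => //.
  have [mf _] : Linf_function mu (fun y => repr F y - qscalar qr.1).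
    exact: (Linf_functionB (repr_Linf_function F) (Linf_function_cst mu (qscalar qr.1))).
  exact: measurable_snorm.
have HA : \forall x \ae mu, forall qr, df x (A qr) <-> A qr x.
  by apply: ae_forall_count => qr; exact: df_ae.
apply: filterS3 (filterI HA (germ_norm_ae s)) (dom_ae s) (dom_ae (mod_act F s)).
move=> x [xA [fs _]] sx Fsx; set c := repr F x.
apply/eqP; rewrite -subr_eq0; apply/eqP/rnorm0_eq0.
have dc : c *: s \in dom x by rewrite rpredZ.
have dB : mod_act F s - c *: s \in dom x by rewrite rpredB.
have -> : hat (mod_act F s) x - c *: hat s x = bs_class (ps x) (mod_act F s - c *: s).
  by rewrite bs_classB// bs_classZ.
rewrite rnorm_bs_class//; apply/eqP; rewrite eq_le germ_norm_ge0 andbT.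
apply/ler_addgt0Pr => e e0; rewrite add0r.
have [M [M0 xM]] := fs.
have e1 : 0 < e / 2 / (M + 1) by rewrite divr_gt0 ?divr_gt0// ltr_wpDl.
have [r] := @rat_in_itvoo _ _ _ e1; rewrite in_itv /= => /andP[r0 re].
have [q qc] := qscalar_dense c r0.
have xAq : df x (A (q, r)) by apply/xA => /=; exact: ltW.
apply: le_trans (_ : 2 * ratr r * M <= _); last first.
  move: re; rewrite ltr_pdivlMr ?ltr_wpDl// => re.
  by have : 0 <= ratr r * 1 :> R; [rewrite mulr1 ltW|lra].
apply: germ_norm_le; apply: (germ_ubI (df_I xAq xM)).
  by rewrite mulr_ge0// mulr_ge0// ltW.
apply: filterS (pnorm_act_sub F c s) => y -> [/= Ay My].
apply: ler_pM => //; [exact: snorm_ge0|exact: pnorm_ge0|].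
have -> : repr F y - c = (repr F y - qscalar q) - (c - qscalar q).
  by rewrite opprB addrA subrK.
apply: le_trans (snormD _ _) _; rewrite mulr2n mulrDl mul1r; apply: lerD => //.
by rewrite /snorm normrN; exact: ltW.
Qed.

Lemma hat_eq0 s : (\forall x \ae mu, hat s x = 0) -> s = 0.
Proof.
move=> s0; apply: pnorm_eq0; apply: filterS2 s0 (hat_norm s) => x -> <-.
by rewrite rnorm0.
Qed.

Lemma hat_inj s t : (\forall x \ae mu, hat s x = hat t x) -> s = t.
Proof.
move=> st; apply/eqP; rewrite -subr_eq0; apply/eqP; apply: hat_eq0.
by apply: filterS2 st (hatB s t) => x -> ->; rewrite subrr.
Qed.

(** The distance is a limit of pointwise norms of elements of the module;
    completeness of the measure lets the limit hold almost everywhere only. *)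
Lemma measurable_dist_lim (eta : nat -> Gam) (t : section fibre) s :
  (\forall x \ae mu, (fun n => hat (eta n) x) @ \oo --> t x) ->
  measurable_fun setT (fun x => rnorm (hat s x - t x)).
Proof.
move=> et; apply: (@measurable_ae_cvg _ _ _ mu cmu (fun n => pnorm (s - eta n))).
  by move=> n; exact: pnorm_measurable.
apply: filterS2 et (ae_foralln (fun n => hat_dist s (eta n))) => x /cvg_rnormP et xd.
apply/cvgrPdist_lt => e e0; move/cvgrPdist_lt: et => /(_ e e0).
apply: filterS => n; rewrite sub0r normrN ger0_norm ?rnorm_ge0// -xd.
apply: le_lt_trans; apply: le_trans (rdist_norm _ _) _.
by rewrite opprB addrC subrKA.
Qed.

(** Dominated convergence makes the sequence Cauchy in the module, and the
    section of germs of its limit is the pointwise limit. *)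
Lemma hat_limit (eta : nat -> Gam) (t : section fibre) (b : T -> R) : Int b ->
  (forall n, \forall x \ae mu, pnorm (eta n) x <= b x) ->
  (\forall x \ae mu, (fun n => hat (eta n) x) @ \oo --> t x) ->
  exists s, \forall x \ae mu, hat s x = t x.
Proof.
move=> Ib /ae_foralln eb et.
pose g n x := rnorm (hat (eta n) x - t x).
have mg n : measurable_fun setT (g n) by exact: measurable_dist_lim et.
have g0 : \forall x \ae mu, (fun n => g n x) @ \oo --> (0 : R).
  by apply: filterS et => x /cvg_rnormP.
have gb : \forall x \ae mu, forall n, 0 <= g n x <= 2 * b x.
  apply: filterS3 g0 eb (ae_foralln (fun n => hat_norm (eta n))) => x gx bx nx.
  have tb : rnorm (t x) <= b x.
    apply/ler_addgt0Pr => e e0; move/cvgrPdist_lt: gx => /(_ e e0)[N _ /(_ N (leqnn N))].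
    rewrite /= sub0r normrN ger0_norm ?rnorm_ge0// /g => ge.
    have := rdist_norm (hat (eta N) x) (t x); rewrite distrC => /(le_trans (ler_norm _)).
    by have := bx N; rewrite -nx; lra.
  move=> n; rewrite rnorm_ge0 /=; apply: le_trans (rnormD _ _) _.
  by rewrite rnormN; have := bx n; rewrite -nx; lra.
have I2b : Int (fun x => 2 * b x) by exact: IntZ.
have Ig n : Int (g n).
  apply: (Int_le (mg n) I2b); apply: filterS gb => x /(_ n)/andP[g1 g2].
  by rewrite ger0_norm.
have small := dominated_small mg I2b gb g0.
have dist n m : \forall x \ae mu, pnorm (eta n - eta m) x <= g n x + g m x.
  apply: filterS (hat_dist (eta n) (eta m)) => x <-.
  by rewrite /g [X in _ <= _ + X]rdistC; exact: rdist_tri.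
have [s es] : exists s : Gam, eta @ \oo --> s.
  apply: rcauchy_cvg => e e0; have e20 : 0 < e / 2 by rewrite divr_gt0.
  have [N NP] := small _ e20; exists N => n m Nn Nm.
  rewrite -rint_pnorm (splitr e); apply: le_lt_trans (ltrD (NP n Nn) (NP m Nm)).
  rewrite -RintegralD//; apply: rint_ae_le => //; first exact: pnorm_Int.
  exact: IntD.
exists s.
have : \forall x \ae mu, rnorm (hat s x - t x) <= 0.
  apply: ae_le0_of_small; first exact: measurable_dist_lim et.
  move=> e e0; have e20 : 0 < e / 2 by rewrite divr_gt0.
  have [N NP] := small _ e20.
  move/cvg_rnormP/cvgrPdist_lt: es => /(_ _ e20)[M _ MP].
  pose n := maxn N M; exists (fun x => pnorm (s - eta n) x + g n x); split.
  - by apply: IntD => //; exact: pnorm_Int.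
  - rewrite RintegralD//; last exact: pnorm_Int.
    rewrite rint_pnorm (splitr e); apply: lerD; last by apply: ltW; apply: NP; exact:
        leq_maxl.
    have := MP n (leq_maxr N M); rewrite /= sub0r normrN ger0_norm ?rnorm_ge0//.
    by rewrite rdistC => /ltW.
  - apply: filterS gb => x /(_ n)/andP[gx _].
    by rewrite addr_ge0// pnorm_ge0.
  - by apply: filterS (hat_dist s (eta n)) => x <-; exact: rdist_tri.
apply: filterS => x H; apply/eqP; rewrite -subr_eq0; apply/eqP/rnorm0_eq0.
by apply/eqP; rewrite eq_le H rnorm_ge0.
Qed.

(** Truncate the factor [a] at level n, so that it acts on the module, and
    apply [hat_limit]. *)
Lemma hat_surj (a : T -> K) s : scalar_measurable a ->
  Int (fun x => snorm (a x) * pnorm s x) ->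
  exists t, \forall x \ae mu, hat t x = a x *: hat s x.
Proof.
move=> ma Ia; pose A n := [set x | snorm (a x) <= n%:R].
have mA n : measurable (A n).
  by rewrite -[A n]setTI; apply: measurable_fun_ler => //; exact: measurable_snorm.
pose f n x : K := rtos (\1_(A n) x) * a x.
have bf n : Linf_function mu (f n).
  split.
    by apply: scalar_measurableM => //; apply: scalar_measurable_rtos; exact:
        measurable_indicR.
  exists n%:R; apply: aeW => x; rewrite snormM snorm_rtos ger0_norm ?indic_ge0// indicE.
  by have [/set_mem|] := boolP (x \in A n); rewrite ?mul1r// mul0r.
have Ff n := to_LinftyE (bf n).
apply: (@hat_limit (fun n => mod_act (to_Linfty mu (f n)) s) (section_mul a (hat s))
    _ Ia).
  move=> n; apply: filterS2 (pnorm_act (to_Linfty mu (f n)) s) (Ff n) => x -> ->.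
  rewrite ler_wpM2r ?pnorm_ge0// /f snormM snorm_rtos ger0_norm ?indic_ge0//.
  by rewrite ler_piMl ?snorm_ge0 ?indic_le1.
apply: filterS2 (ae_foralln Ff) (ae_foralln (fun n => hat_act (to_Linfty mu (f n)) s)).
move=> x fx hx; apply/cvg_rnormP/cvgrPdist_lt => e e0.
have [N aN] : exists N : nat, snorm (a x) <= N%:R.
  exists (Num.truncn (snorm (a x))).+1; apply: ltW; exact: truncnS_gt.
exists N => // n /= Nn; rewrite sub0r normrN hx fx /f indicE mem_set ?rtos1 ?mul1r.
  by rewrite /section_mul subrr rnorm0 normr0.
by rewrite /A /=; apply: le_trans aN _; rewrite ler_nat.
Qed.

End Bundle.

(** * The bundle of germs *)

Section BundleOf.
Context {R : realType} {k : scalar_kind} {d : measure_display}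
  {T : measurableType d} (mu : {measure set T -> \bar R}).
Local Notation K := (scalar R k).
Local Notation Int f := (mu.-integrable setT (EFin \o f)).
Hypothesis cmu : measure_is_complete mu.
Variables (w : T -> R) (Iw : Int w) (w0 : forall x, 0 < w x).
Variables (Gam : L1_normed_module k mu) (df : density_field mu) (S : set Gam).
Hypothesis dS : forall s (e : R), 0 < e -> exists2 u, S u & rnorm (s - u) < e.
Implicit Types (u v : Gam).

Local Notation fb := (fibre df S).
Local Notation ht := (hat df S).

Implicit Types (s t : section fb).

(** One scalar function and one element are enough: sums and limits of such
    sections become sections of germs after multiplication by a suitable
    positive function. *)
Definition hat_section (s : section fb) : Prop := exists (a : T -> K) (u : Gam),
  scalar_measurable a /\ \forall x \ae mu, s x = a x *: ht u x.

Let sec0 : hat_section 0.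
Proof.
exists (cst 0), 0; split; first exact: scalar_measurable_cst.
by apply: aeW => x; rewrite scale0r.
Qed.

Let secM (f : T -> K) s : scalar_measurable f -> hat_section s ->
  hat_section (section_mul f s).
Proof.
move=> mf [a [u [ma su]]]; exists (fun x => f x * a x), u; split.
  exact: scalar_measurableM.
by apply: filterS su => x; rewrite /section_mul => ->; rewrite scalerA.
Qed.

Let secZ (a : K) s : hat_section s -> hat_section (a *: s).
Proof. by move=> /(secM (scalar_measurable_cst a)). Qed.

Let bounded_rtos (f : T -> R) (g : T -> K) : measurable_fun setT f ->
    scalar_measurable g ->
  (forall x, `|f x| * snorm (g x) <= 1) -> Linf_function mu (fun x => rtos (f x) * g x).
Proof.
move=> mf mg H; split; first by apply: scalar_measurableM => //; exact:
    scalar_measurable_rtos.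
by exists 1; apply: aeW => x; rewrite snormM snorm_rtos.
Qed.

(** Dividing by [n] makes both coefficients bounded, so that they act on the
    module. *)
Let secD s t : hat_section s -> hat_section t -> hat_section (s + t).
Proof.
move=> [a [u [ma su]]] [b [v [mb tv]]].
pose n x := 1 + snorm (a x) + snorm (b x).
have n0 x : 0 < n x by rewrite /n ltr_wpDr ?snorm_ge0// ltr_wpDr ?snorm_ge0.
have mn : measurable_fun setT n.
  by apply: measurable_funD; [apply: measurable_funD => //|]; exact: measurable_snorm.
have mV := measurable_inv_pos mn n0.
have bnd (g : T -> K) : scalar_measurable g -> (forall x, snorm (g x) <= n x) ->
    Linf_function mu (fun x => rtos ((n x)^-1) * g x).
  move=> mg gn; apply: bounded_rtos => // x.
  by rewrite ger0_norm ?invr_ge0 ?(ltW (n0 x))// mulrC ler_pdivrMr ?mul1r.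
have ba : Linf_function mu (fun x => rtos ((n x)^-1) * a x).
  by apply: bnd => // x; rewrite /n addrAC ler_wpDl// addr_ge0 ?snorm_ge0.
have bb : Linf_function mu (fun x => rtos ((n x)^-1) * b x).
  by apply: bnd => // x; rewrite /n ler_wpDl// addr_ge0 ?snorm_ge0.
pose A := to_Linfty mu (fun x => rtos ((n x)^-1) * a x).
pose B := to_Linfty mu (fun x => rtos ((n x)^-1) * b x).
exists (fun x => rtos (n x)), (mod_act A u + mod_act B v); split.
  exact: scalar_measurable_rtos.
apply: filterS3 (filterI su tv) (hatD df dS (mod_act A u) (mod_act B v))
  (filterI (filterI (hat_act df dS A u) (hat_act df dS B v))
           (filterI (to_LinftyE ba) (to_LinftyE bb))) => x.
move=> [sx tx] -> [[-> ->] [-> ->]].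
have nn : rtos (n x) * rtos (n x)^-1 = 1 :> K by rewrite -rtosM divff ?rtos1// gt_eqF.
rewrite scalerDr !scalerA !mulrA nn !mul1r -sx -tx //.
Qed.

Let rnorm_sec s a u : (\forall x \ae mu, s x = a x *: ht u x) ->
  \forall x \ae mu, snorm (a x) * pnorm u x = section_norm s x.
Proof.
move=> su; apply: filterS2 su (hat_norm df dS u) => x sx ux.
by rewrite /section_norm sx rnormZ ux.
Qed.

Let sec_norm s : hat_section s -> measurable_fun setT (section_norm s).
Proof.
move=> [a [u [ma su]]].
apply: (measurable_ae_eq cmu _ (rnorm_sec su)).
by apply: measurable_funM; [exact: measurable_snorm|exact: pnorm_measurable].
Qed.

(** With r the norm of the limit, multiply by w / (1 + r) and cut off where a
    section of the sequence exceeds 1 + r in norm. The results are dominated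
    by the weight w, and at almost every point the cut-off disappears
    eventually. *)
Let sec_lim (s_ : nat -> section fb) (s : section fb) :
  (forall n, hat_section (s_ n)) ->
  (\forall x \ae mu, (fun n => s_ n x) @ \oo --> s x) -> hat_section s.
Proof.
move=> ss sl.
have mr : measurable_fun setT (section_norm s).
  apply: (measurable_ae_cvg cmu (fun n => sec_norm (ss n))).
  apply: filterS sl => x /cvg_rnormP/cvgrPdist_lt H; apply/cvgrPdist_lt => e /H.
  apply: filterS => n; rewrite sub0r normrN ger0_norm ?rnorm_ge0// distrC.
  by apply: le_lt_trans; exact: rdist_norm.
pose n x := 1 + section_norm s x.
have n0 x : 0 < n x by rewrite ltr_pwDl// rnorm_ge0.
have mn : measurable_fun setT n by exact: measurable_funD.
have mV := measurable_inv_pos mn n0.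
have mw := Int_measurable Iw.
pose c x := w x * (n x)^-1.
have c0 x : 0 < c x by rewrite mulr_gt0 ?invr_gt0.
have mc : measurable_fun setT c by exact: measurable_funM.
have /choice[a /choice[u au]] := ss.
pose A j := [set x | snorm (a j x) * pnorm (u j) x <= n x].
have man j : measurable_fun setT (fun x => snorm (a j x) * pnorm (u j) x).
  by apply: measurable_funM; [apply: measurable_snorm; case: (au j)|exact:
      pnorm_measurable].
have mA j : measurable (A j).
  by rewrite -[A j]setTI; exact: measurable_fun_ler.
pose b j x : K := rtos (c x * \1_(A j) x) * a j x.
have mb j : scalar_measurable (b j).
  apply: scalar_measurableM; last by case: (au j).
  apply: scalar_measurable_rtos; apply: measurable_funM => //; exact: measurable_indicR.
have ble j x : snorm (b j x) * pnorm (u j) x <= w x.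
  rewrite /b snormM snorm_rtos ger0_norm; last first.
    by apply: mulr_ge0; [exact: ltW|exact: indic_ge0].
  rewrite indicE; have [/set_mem|_] := boolP (x \in A j); last first.
    by rewrite mulr0 !mul0r ltW.
  rewrite /A /= mulr1 -mulrA => H; apply: le_trans (ler_wpM2l (ltW (c0 x)) H) _.
  by rewrite /c divfK// gt_eqF.
have Ib j : Int (fun x => snorm (b j x) * pnorm (u j) x).
  apply: (Int_le _ Iw).
    by apply: measurable_funM; [exact: measurable_snorm|exact: pnorm_measurable].
  by apply: aeW => x; rewrite ger0_norm// mulr_ge0 ?snorm_ge0 ?pnorm_ge0.
have /choice[eta etaP] : forall j, exists v, \forall x \ae mu, ht v x = b j x *: ht
    (u j) x.
  by move=> j; exact: (hat_surj cmu df dS (mb j) (Ib j)).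
have [v vP] : exists v : Gam, \forall x \ae mu, ht v x = rtos (c x) *: s x.
  pose cs : section fb := section_mul (fun x => rtos (c x)) s.
  apply: (hat_limit (df := df) cmu dS (eta := eta) (t := cs) Iw).
    move=> j; apply: filterS3 (etaP j) (hat_norm df dS (eta j)) (hat_norm df dS (u j)).
    by move=> x ex <- ux; rewrite ex rnormZ ux.
  have etaE := ae_foralln etaP.
  have sE := ae_foralln (fun j => (au j).2).
  have nE := ae_foralln (fun j => rnorm_sec (au j).2).
  apply: filterS2 (filterI etaE sE) (filterI nE sl) => x [ex sx] [nx /cvg_rnormP slx].
  apply/cvg_rnormP/cvgrPdist_lt => e e0.
  have e1 : 0 < e / c x by rewrite divr_gt0.
  move/cvgrPdist_lt: slx => H; have [N1 _ P1] := H _ e1; have [N2 _ P2] := H _ ltr01.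
  exists (maxn N1 N2) => // j /=; rewrite geq_max => /andP[/P1 j1 /P2 j2].
  move: j1 j2; rewrite !sub0r !normrN /= !ger0_norm ?rnorm_ge0// => j1 j2.
  have Ajx : A j x.
    rewrite /A /= nx /n /section_norm.
    have := rdist_norm (s_ j x) (s x) => /(le_trans (ler_norm _)); lra.
  rewrite ex /b indicE mem_set// mulr1 -scalerA -sx /section_mul -scalerBr rnormZ.
  rewrite snorm_rtos ger0_norm ?(ltW (c0 x))// mulrC -ltr_pdivlMr//.
exists (fun x => rtos (c x)^-1), v; split.
  by apply: scalar_measurable_rtos; exact: measurable_inv_pos.
apply: filterS vP => x ->; rewrite scalerA -rtosM mulVf ?rtos1 ?scale1r//.
by rewrite gt_eqF.
Qed.

Definition bundle_of : measurable_banach_bundle k mu :=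
  MeasurableBanachBundle sec0 secD secZ secM sec_norm sec_lim.

Local Notation E := bundle_of.

Lemma hat_msec u : msec (m := E) (ht u).
Proof.
exists (cst 1), u; split; first exact: scalar_measurable_cst.
by apply: aeW => x; rewrite scale1r.
Qed.

Lemma hat_integrable u : section_integrable (ht u : section (fiber E)).
Proof.
apply: (Int_le (sec_norm (hat_msec u)) (pnorm_Int u)).
apply: filterS (hat_norm df dS u) => x; rewrite /section_norm => ->.
by rewrite ger0_norm ?pnorm_ge0.
Qed.

Lemma integrable_section_hat (s : section (fiber E)) : msec (m := E) s ->
  section_integrable s -> exists u, \forall x \ae mu, ht u x = s x.
Proof.
move=> [a [u [ma su]]] Is.
have Ia : Int (fun x => snorm (a x) * pnorm u x).
  apply: (Int_le _ Is).
    by apply: measurable_funM; [exact: measurable_snorm|exact: pnorm_measurable].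
  apply: filterS (rnorm_sec su) => x ->.
  by rewrite ger0_norm ?rnorm_ge0.
have [v vP] := hat_surj cmu df dS ma Ia; exists v.
by apply: filterS2 vP su => x -> ->.
Qed.

Definition hat_G1 u : G1_section E.
Proof.
exists (ht u); apply/asboolP; split; [exact: hat_msec|exact: hat_integrable].
Defined.

Lemma bundle_of_isometric : Gamma1_isometric_to E Gam.
Proof.
have /choice[U UP] : forall s : Gamma1 E, exists u : Gam,
    \forall x \ae mu, ht u x = G1_val (repr s) x.
  move=> s; have /asboolP[ms Is] := G1_valP (repr s).
  exact: integrable_section_hat.
have Upi (s : G1_section E) : \forall x \ae mu, ht (U (\pi_(Gamma1 E) s)) x = G1_val s x.
  by apply: filterS2 (UP (\pi_(Gamma1 E) s)) (Gamma1_repr s) => x ->.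
have Uhat u : U (\pi_(Gamma1 E) (hat_G1 u)) = u by apply: (hat_inj dS); exact: Upi.
have Ulin : linear U.
  move=> a s t; apply: (hat_inj dS).
  have H : \forall x \ae mu, ht (U (a *: s + t)) x = G1_val (a *: repr s + repr t) x.
    have -> : a *: s + t = \pi_(Gamma1 E) (a *: repr s + repr t); last exact: Upi.
    rewrite -{1}[t]reprK; apply/esym.
    exact: (@pi_addr _ _ _ _ _ (Quotient.quot (@G1_null _ _ _ _ _ E))).
  apply: filterS3 H (hatD df dS (a *: U s) (U t))
    (filterI (hatZ df dS a (U s)) (filterI (UP s) (UP t))) => x Hx Dx [Zx [sx tx]].
  apply: (etrans Hx); apply: (etrans _ (esym Dx)); rewrite Zx sx tx //.
pose Ul : {linear Gamma1 E -> Gam} := HB.pack U (GRing.isLinear.Build _ _ _ _ U Ulin).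
exists Ul; split.
- exists (fun u => \pi_(Gamma1 E) (hat_G1 u)) => [s|u]; last exact: Uhat.
  rewrite -[RHS]reprK; apply/Gamma1_piP; exact: UP.
- move=> F s; apply: (hat_inj dS).
  apply: filterS3 (Upi (G1_mul (repr F) (repr s))) (hat_act df dS F (U s)) (UP s).
  by move=> x Hx Ax sx; apply: (etrans Hx); apply: (etrans _ (esym Ax)); rewrite sx.
- move=> s; rewrite -rint_pnorm /Gamma1_norm /=; apply: rint_ae_eq; first exact:
    pnorm_Int.
    by apply: sec_norm; case/asboolP: (G1_valP (repr s)).
  by apply: filterS2 (UP s) (hat_norm df dS (U s)) => x ux <-; rewrite ux.
Qed.

Lemma bundle_of_separable : (exists g : nat -> Gam, S = range g) -> separable_bundle E.
Proof.
move=> [g Sg]; exists (fun n => ht (g n)); first by move=> n; exact: hat_msec.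
apply: filterS (ae_foralln (fun n => dom_ae df dS (g n))) => x gx.
apply/seteqP; split => // v _; apply/closure_rnormP => e e0.
have [s sd ->] := bs_classP v; have /germ_domP[_ /(_ _ e0)[u [Su fu su]]] := sd.
have H : u \in bs_dom (point_seminorm df S x) /\
    lin (range (fun n => ht (g n) x)) (bs_class (point_seminorm df S x) u).
  have [n [c [y [Sy ->]]]] := Su.
  elim/big_rec: _ => [|i b _ [bd bl]].
    split; first exact: rpred0.
    have -> : bs_class (point_seminorm df S x) 0 = 0.
      by rewrite -(scale0r (0 : Gam)) bs_classZ ?rpred0// scale0r.
    exact: lin0.
  have yd : y i \in bs_dom (point_seminorm df S x).
    by move: (Sy i); rewrite {1}Sg => -[m _ <-]; exact: gx.
  split; first by rewrite rpredD// rpredZ.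
  rewrite bs_classD ?rpredZ// bs_classZ//; apply: lin_linear => //; apply: lin_mem.
  by move: (Sy i); rewrite {1}Sg => -[m _ <-]; exists m.
exists (bs_class (point_seminorm df S x) u); first by case: H.
rewrite -bs_classB//; last by case: H.
by rewrite rnorm_bs_class ?rpredB//; case: H.
Qed.

End BundleOf.

(** * The closure of a linear correspondence *)

Section Combinations.
Context {R : realType} {k : scalar_kind}.
Local Notation K := (scalar R k).

(** Formal combinations are lists of coefficients and indices, so that the
    same list can be evaluated at two sequences in different spaces. *)
Definition lincomb {V : lmodType K} (L : seq (K * nat)) (v : nat -> V) : V :=
  \sum_(p <- L) p.1 *: v p.2.

Definition rational_terms (L : seq (rat * rat * nat)) : seq (K * nat) :=
  [seq (qscalar p.1, p.2) | p <- L].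

Lemma lincomb_cat (V : lmodType K) L L' (v : nat -> V) :
  lincomb (L ++ L') v = lincomb L v + lincomb L' v.
Proof. exact: big_cat. Qed.

Lemma lincomb_scale (V : lmodType K) a L (v : nat -> V) :
  lincomb [seq (a * p.1, p.2) | p <- L] v = a *: lincomb L v.
Proof. by rewrite /lincomb big_map scaler_sumr; apply: eq_bigr => p _; rewrite
    scalerA. Qed.

Lemma lincomb_cons (V : lmodType K) p L (v : nat -> V) :
  lincomb (p :: L) v = p.1 *: v p.2 + lincomb L v.
Proof. exact: big_cons. Qed.

Lemma lincomb_nil (V : lmodType K) (v : nat -> V) : lincomb [::] v = 0.
Proof. exact: big_nil. Qed.

Lemma lin_lincomb (V : lmodType K) (v : nat -> V) u : lin (range v) u ->
  exists L, u = lincomb L v.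
Proof.
move=> [n [c [y [yv ->]]]].
have /choice[m mE] : forall i, exists j, v j = y i by move=> i; case: (yv i) => j _
    <-; exists j.
exists [seq (c i, m i) | i <- enum 'I_n]; rewrite /lincomb big_map big_enum /=.
by apply: eq_bigr => i _; rewrite mE.
Qed.

(** The approximation is simultaneous in two spaces, which transfers
    statements about rational combinations to all combinations of both
    sequences. *)
Lemma rational_lincomb (V W : normedModType K) (v : nat -> V) (w : nat -> W) L (e : R) :
  0 < e -> exists q, rnorm (lincomb L v - lincomb (rational_terms q) v) < e /\
                     rnorm (lincomb L w - lincomb (rational_terms q) w) < e.
Proof.
elim: L e => [|[c n] L IH] e e0.
  by exists [::]; rewrite /rational_terms /= !lincomb_nil !subrr !rnorm0.
have e20 : 0 < e / 2 by rewrite divr_gt0.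
have [q [qv qw]] := IH _ e20.
pose M := 1 + rnorm (v n) + rnorm (w n).
have M0 : 0 < M by rewrite /M ltr_wpDr ?rnorm_ge0// ltr_pwDl ?rnorm_ge0.
have [p pc] := @qscalar_dense R k c (e / 2 / M) (divr_gt0 e20 M0).
have pM : snorm (c - qscalar p) * M < e / 2 by rewrite -ltr_pdivlMr.
have sp := snorm_ge0 (c - qscalar p).
exists ((p, n) :: q); split; rewrite /rational_terms /= !lincomb_cons /= opprD
    addrACA -scalerBl (splitr e);
  apply: le_lt_trans (rnormD _ _) (ltrD _ _) => //; rewrite rnormZ; apply: le_lt_trans pM;
  apply: ler_wpM2l => //; rewrite /M.
  by have := rnorm_ge0 (w n); lra.
by have := rnorm_ge0 (v n); lra.
Qed.

Lemma rational_lincomb_dense (V : normedModType K) (v : nat -> V) (u : V) (e : R) :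
  closure (lin (range v)) = setT -> 0 < e ->
  exists q, rnorm (u - lincomb (rational_terms q) v) < e.
Proof.
move=> cv e0; have e20 : 0 < e / 2 by rewrite divr_gt0.
have : closure (lin (range v)) u by rewrite cv.
move=> /closure_rnormP/(_ _ e20)[_ /lin_lincomb[L ->] uL].
have [q [Lq _]] := rational_lincomb v v L e20; exists q.
by apply: le_lt_trans (rdist_tri (lincomb L v) _ _) _; rewrite (splitr e); exact: ltrD.
Qed.

End Combinations.

Section Extension.
Context {R : realType} {k : scalar_kind}.
Local Notation K := (scalar R k).
Variables (V W : completeNormedModType K) (v : nat -> V) (w : nat -> W).

(** The closure of the linear correspondence that sends each [v n] to [w n]. *)
Definition corr (a : V) (b : W) : Prop := forall e : R, 0 < e ->
  exists L, rnorm (a - lincomb L v) < e /\ rnorm (b - lincomb L w) < e.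

(** Only rational combinations occur, so that this can be established at
    almost every point of a measure space. *)
Definition matched : Prop := forall q, rnorm (lincomb (rational_terms q) v) = rnorm
    (lincomb (rational_terms q) w).

Hypothesis vw : matched.

Lemma matched_lincomb L : rnorm (lincomb L v) = rnorm (lincomb L w).
Proof.
apply/eqP; rewrite -subr_eq0 -normr_le0; apply/ler_addgt0Pr => e e0; rewrite add0r.
have e20 : 0 < e / 2 by rewrite divr_gt0.
have [q [qv qw]] := rational_lincomb v w L e20.
have H1 := le_lt_trans (rdist_norm (lincomb L v) (lincomb (rational_terms q) v)) qv.
have H2 := le_lt_trans (rdist_norm (lincomb L w) (lincomb (rational_terms q) w)) qw.
move: H1 H2; rewrite vw !ltr_norml => /andP[? ?] /andP[? ?].
by rewrite ler_norml; apply/andP; split; lra.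
Qed.

Lemma corr_norm a b : corr a b -> rnorm a = rnorm b.
Proof.
move=> ab; apply/eqP; rewrite -subr_eq0 -normr_le0; apply/ler_addgt0Pr => e e0;
    rewrite add0r.
have e20 : 0 < e / 2 by rewrite divr_gt0.
have [L [La Lb]] := ab _ e20.
have H1 := le_lt_trans (rdist_norm a (lincomb L v)) La.
have H2 := le_lt_trans (rdist_norm b (lincomb L w)) Lb.
move: H1 H2; rewrite matched_lincomb !ltr_norml => /andP[? ?] /andP[? ?].
by rewrite ler_norml; apply/andP; split; lra.
Qed.

Lemma corr_lin c a b a' b' : corr a b -> corr a' b' -> corr (c *: a + a') (c *: b + b').
Proof.
move=> ab ab' e e0; have e20 : 0 < e / 2 by rewrite divr_gt0.
have c1 : 0 < snorm c + 1 by rewrite ltr_wpDl// snorm_ge0.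
have [L [La Lb]] := ab _ (divr_gt0 e20 c1); have [L' [La' Lb']] := ab' _ e20.
exists ([seq (c * p.1, p.2) | p <- L] ++ L').
have H (U : normedModType K) (x y x' y' : U) : rnorm (x - y) < e / 2 / (snorm c + 1) ->
    rnorm (x' - y') < e / 2 -> rnorm (c *: x + x' - (c *: y + y')) < e.
  move=> xy xy'; rewrite opprD addrACA -scalerBr (splitr e).
  apply: le_lt_trans (rnormD _ _) (ler_ltD _ xy'); rewrite rnormZ.
  move: xy; rewrite ltr_pdivlMr// mulrC => xy; apply: le_trans (ltW xy).
  by rewrite ler_wpM2r ?rnorm_ge0// lerDl.
by rewrite !lincomb_cat !lincomb_scale; split; exact: H.
Qed.

Lemma corr0 : corr 0 0.
Proof. by move=> e e0; exists [::]; rewrite !lincomb_nil !subrr !rnorm0. Qed.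

Lemma corr_inj a b b' : corr a b -> corr a b' -> b = b'.
Proof.
move=> ab ab'; have := corr_lin (-1) ab' ab.
rewrite !scaleN1r addNr => /corr_norm; rewrite rnorm0 => /esym/rnorm0_eq0/eqP.
by rewrite addrC subr_eq0 => /eqP.
Qed.

(** Rational combinations that converge to [a] are sent to a Cauchy sequence,
    by [matched_lincomb]. *)
Lemma corr_total a : closure (lin (range v)) = setT -> exists b, corr a b.
Proof.
move=> dv.
have /choice[q qP] : forall n : nat, exists q, rnorm (a - lincomb (rational_terms q)
    v) < n.+1%:R^-1.
  by move=> n; apply: rational_lincomb_dense => //; rewrite invr_gt0.
have combB (U : lmodType K) L L' (u : nat -> U) :
    lincomb (L ++ [seq (-1 * p.1, p.2) | p <- L']) u = lincomb L u - lincomb L' u.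
  by rewrite lincomb_cat lincomb_scale scaleN1r.
have inv_small (e : R) : 0 < e -> exists N, forall n, (N <= n)%N -> n.+1%:R^-1 < e.
  by move=> e0; have [N _ NP] := near_infty_natSinv_lt (PosNum e0); exists N.
have [b bP] : exists b : W, (fun n => lincomb (rational_terms (q n)) w) @ \oo --> b.
  apply: rcauchy_cvg => e e0; have e20 : 0 < e / 2 by rewrite divr_gt0.
  have [N NP] := inv_small _ e20.
  exists N => n m Nn Nm; rewrite -combB -matched_lincomb combB.
  apply: le_lt_trans (rdist_tri a _ _) _; rewrite (splitr e).
  apply: ltrD; last exact: lt_trans (qP m) (NP _ Nm).
  by rewrite rdistC; exact: lt_trans (qP n) (NP _ Nn).
exists b => e e0; have [N NP] := inv_small _ e0.
move/cvg_rnormP/cvgrPdist_lt: bP => /(_ _ e0)[M _ MP].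
exists (rational_terms (q (maxn N M))); split.
  by apply: lt_trans (qP _) (NP _ _); exact: leq_maxl.
have := MP (maxn N M) (leq_maxr N M).
by rewrite /= sub0r normrN ger0_norm ?rnorm_ge0// rdistC.
Qed.

End Extension.

Lemma corr_sym (R : realType) (k : scalar_kind) (V W : completeNormedModType (scalar R k))
  (v : nat -> V) (w : nat -> W) a b : corr v w a b -> corr w v b a.
Proof. by move=> ab e /ab[L [La Lb]]; exists L. Qed.

(** * Uniqueness of the separable bundle *)

Section Uniqueness.
Context {R : realType} {k : scalar_kind} {d : measure_display}
  {T : measurableType d} (mu : {measure set T -> \bar R}).
Local Notation K := (scalar R k).
Local Notation Int f := (mu.-integrable setT (EFin \o f)).
Local Notation bundle := (measurable_banach_bundle k mu).

Section Morphism.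
Variables (E F : bundle) (sE : nat -> section (fiber E)) (sF : nat -> section (fiber F)).

(** The junk value is 0, taken at the exceptional points. *)
Definition corr_map (x : T) (a : fiber E x) : fiber F x :=
  xget 0 [set b | corr (fun n => sE n x) (fun n => sF n x) a b].

Definition corr_morphism (e : total E) : total F :=
  existT _ (projT1 e) (corr_map (projT2 e)).

Definition matched_at (x : T) : Prop :=
  matched (fun n => sE n x) (fun n => sF n x) /\
  closure (lin (range (fun n => sE n x))) = setT.

Lemma corr_mapP x a : matched_at x ->
  corr (fun n => sE n x) (fun n => sF n x) a (corr_map (x := x) a).
Proof.
move=> [mx cx]; have [b ab] := corr_total mx a cx.
by rewrite /corr_map; case: xgetP => [_ ->|/(_ b)].
Qed.

Lemma corr_map_eq x a b : matched_at x ->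
  corr (fun n => sE n x) (fun n => sF n x) a b -> corr_map (x := x) a = b.
Proof. by move=> gx; apply: corr_inj (corr_mapP _ gx); case: gx. Qed.

Lemma corr_morphism_isometric : (\forall x \ae mu, matched_at x) ->
  (forall s, msec (m := E) s -> exists2 t, msec (m := F) t &
    \forall x \ae mu, corr (fun n => sE n x) (fun n => sF n x) (s x) (t x)) ->
  bundle_morphism corr_morphism /\ morphism_isometric corr_morphism.
Proof.
move=> good sec.
have norm x (a : fiber E x) : matched_at x -> rnorm (corr_map a) = rnorm a.
  by move=> gx; apply/esym; apply: (corr_norm _ (corr_mapP a gx)); case: gx.
have le1 x : matched_at x -> (fiber_norm corr_morphism x <= 1%:E)%E.
  move=> gx; apply: ge_ereal_sup => _ [v /= v1 <-].
  by rewrite lee_fin /total_norm /= norm.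
split; last by apply: filterS good => x gx v; rewrite /total_norm /= norm.
split.
- move=> s /sec[t mt st]; exists t => //; apply: filterS2 good st => x gx sx.
  by rewrite /corr_morphism /= (corr_map_eq gx sx).
- exact: aeW.
- apply: filterS good => x gx; split; last exact: le_lt_trans (le1 x gx) (ltry 1).
  have lin_map : linear (@corr_map x).
    move=> a u v; apply: corr_map_eq => //.
    by apply: corr_lin; exact: corr_mapP.
  pose phi : {linear fiber E x -> fiber F x} :=
    HB.pack (@corr_map x) (GRing.isLinear.Build _ _ _ _ (@corr_map x) lin_map).
  by exists phi.
- apply: le_lt_trans (ltry 1); apply/ess_supP.
  exact: filterS good.
Qed.

End Morphism.

(** Both maps are graphs of the same correspondence, read in opposite
    directions. *)
Lemma corr_morphismK (E F : bundle) (sE : nat -> section (fiber E))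
    (sF : nat -> section (fiber F)) :
  (\forall x \ae mu, matched_at sE sF x) -> (\forall x \ae mu, matched_at sF sE x) ->
  morphism_eq (corr_morphism sF sE \o corr_morphism sE sF) id.
Proof.
move=> EF FE; apply: filterS2 EF FE => x gEF gFE v.
rewrite /corr_morphism /=; congr (existT _ _ _).
by apply: corr_map_eq => //; apply: corr_sym; exact: corr_mapP.
Qed.

Variables (w : T -> R) (Iw : Int w) (w0 : forall x, 0 < w x).
Variable Gam : L1_normed_module k mu.
Implicit Types u v : Gam.

(** A bundle whose module of integrable sections is [Gam], described by the
    sections that represent the elements of [Gam]. *)
Definition represents (E : bundle) (sec : Gam -> section (fiber E)) : Prop :=
  [/\ forall u, msec (m := E) (sec u),
      forall u, \forall x \ae mu, rnorm (sec u x) = pnorm u x,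
      forall a u v, \forall x \ae mu, sec (a *: u + v) x = a *: sec u x + sec v x &
      forall s, msec (m := E) s -> section_integrable s ->
        exists u, \forall x \ae mu, sec u x = s x].

(** Pointwise norms agree because their integrals over every measurable set A
    agree: both are the norm of the product of the element by the indicator of
    A. *)
Lemma isometric_represents (E : bundle) : Gamma1_isometric_to E Gam ->
  exists sec, represents (E := E) sec.
Proof.
move=> [U [[V UK VK] UA UN]].
pose sec u : section (fiber E) := G1_val (repr (V u)).
have secP u : msec (m := E) (sec u) /\ section_integrable (sec u).
  exact/asboolP/(G1_valP (repr (V u))).
have Vpi u (s : G1_section E) : V u = \pi_(Gamma1 E) s ->
    \forall x \ae mu, sec u x = G1_val s x.
  by move=> us; rewrite /sec us; exact: Gamma1_repr.
exists sec; split.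
- by move=> u; case: (secP u).
- move=> u; apply: ae_eq_of_set_integrals.
  + by case: (secP u).
  + exact: pnorm_Int.
  + move=> A mA; pose F := @Linfty_indic R k d T mu A.
    have VF : V (mod_act F u) = Gamma1_act F (V u).
      by apply: (can_inj UK); rewrite VK UA VK.
    have H1 : \int[mu]_x (\1_A x * pnorm u x) = rnorm (mod_act F u).
      rewrite -rint_pnorm; apply: rint_ae_eq.
      * exact/Int_indic/pnorm_Int.
      * exact: pnorm_measurable.
      * apply: filterS2 (pnorm_act F u) (@Linfty_indicE R k d T mu _ mA) => x -> ->.
        by rewrite snorm_rtos ger0_norm ?indic_ge0.
    have H2 : \int[mu]_x (\1_A x * rnorm (sec u x)) = rnorm (mod_act F u).
      rewrite -[mod_act F u]VK UN VF /Gamma1_norm; apply: rint_ae_eq.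
      * by apply: Int_indic => //; case: (secP u).
      * by apply: msec_norm; case/asboolP: (G1_valP (repr (Gamma1_act F (V u)))).
      * apply: filterS2 (Gamma1_repr (G1_mul (repr F) (repr (V u)))) (@Linfty_indicE
          R k d T mu _ mA).
        move=> x; rewrite /section_norm /Gamma1_act => -> /=.
        by rewrite /section_mul => ->; rewrite rnormZ snorm_rtos ger0_norm ?indic_ge0.
    by rewrite H1 H2.
- move=> a u v.
  have : V (a *: u + v) = \pi_(Gamma1 E) (a *: repr (V u) + repr (V v)).
    apply: (can_inj UK); rewrite VK.
    have -> : \pi_(Gamma1 E) (a *: repr (V u) + repr (V v)) = a *: V u + V v.
      rewrite -{2}[V v]reprK.
      exact: (@pi_addr _ _ _ _ _ (Quotient.quot (@G1_null _ _ _ _ _ E))).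
    by rewrite linearP !VK.
  exact: Vpi.
- move=> s ms Is; have sP : s \in @G1_pred _ _ _ _ _ E by exact/asboolP.
  exists (U (\pi_(Gamma1 E) (G1Section sP))).
  exact: (Vpi _ (G1Section sP) (UK _)).
Qed.

Lemma represents_comb (E : bundle) sec : represents (E := E) sec ->
  forall u (g : nat -> Gam) L, \forall x \ae mu,
    sec (u - lincomb L g) x = sec u x - lincomb L (fun n => sec (g n) x).
Proof.
move=> [_ _ lin_sec _] u g; elim=> [|p L IH].
  rewrite lincomb_nil subr0; apply: aeW => x.
  by rewrite lincomb_nil subr0.
rewrite lincomb_cons opprD addrCA -scaleNr.
apply: filterS2 IH (lin_sec (- p.1) (g p.2) (u - lincomb L g)) => x IHx ->.
by rewrite IHx lincomb_cons opprD addrCA scaleNr.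
Qed.

(** If n is the pointwise norm of the section, the factor w / (1 + n) bounds
    the norm by the integrable weight [w]. *)
Lemma msec_weight (E : bundle) (s : section (fiber E)) : msec (m := E) s ->
  exists c : T -> R, [/\ measurable_fun setT c, (forall x, 0 < c x) &
    section_integrable (section_mul (fun x => rtos (c x) : K) s)].
Proof.
move=> ms; have mn := msec_norm ms.
pose n x := 1 + section_norm s x.
have n0 x : 0 < n x by rewrite ltr_pwDl// rnorm_ge0.
have mV : measurable_fun setT (fun x => (n x)^-1).
  by apply: measurable_inv_pos => //; exact: measurable_funD.
have c0 x : 0 < w x * (n x)^-1 by rewrite mulr_gt0 ?invr_gt0.
have mc : measurable_fun setT (fun x => w x * (n x)^-1).
  by apply: measurable_funM => //; exact: Int_measurable Iw.
exists (fun x => w x * (n x)^-1); split => //.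
apply: (Int_le _ Iw).
  by apply: msec_norm; apply: msecM => //; exact: scalar_measurable_rtos.
apply: aeW => x; rewrite ger0_norm ?rnorm_ge0// /section_norm /section_mul rnormZ.
rewrite snorm_rtos ger0_norm ?(ltW (c0 x))// -mulrA ler_piMr ?(ltW (w0 x))//.
by rewrite mulrC ler_pdivrMr// mul1r /n lerDr.
Qed.

Lemma represents_dense (E : bundle) sec : represents (E := E) sec ->
  separable_bundle E -> exists g : nat -> Gam,
    \forall x \ae mu, closure (lin (range (fun n => sec (g n) x))) = setT.
Proof.
move=> [_ _ _ surj] [s ms sd].
have /choice[c cP] := fun n => msec_weight (ms n).
have /choice[g gP] : forall n, exists u, \forall x \ae mu,
    sec u x = rtos (c n x) *: s n x.
  move=> n; have [mc _ Ic] := cP n; apply: surj Ic.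
  by apply: msecM (ms n); exact: scalar_measurable_rtos.
exists g; apply: filterS2 sd (ae_foralln gP) => x sx gx.
rewrite -subTset -sx; apply: closure_subset => _ [n [a [y [sy ->]]]].
apply: (big_ind (lin (range (fun n => sec (g n) x)))).
- exact: lin0.
- by move=> y1 y2 H1 H2; rewrite -[y1]scale1r; exact: lin_linear.
- move=> i _; rewrite -[_ *: _]addr0; apply: lin_linear; last exact: lin0.
  have [j _ <-] := sy i; have [_ cj _] := cP j.
  have -> : s j x = rtos (c j x)^-1 *: sec (g j) x + 0.
    by rewrite gx scalerA -rtosM mulVf ?rtos1 ?scale1r ?addr0// gt_eqF.
  by apply: lin_linear; [apply: lin_mem; exists j|exact: lin0].
Qed.

(** Both norms are the pointwise norm of u minus a combination, an element of
    the module, and there are countably many combinations. *)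
Lemma represents_matched (E F : bundle) secE secF (g : nat -> Gam) u :
  represents (E := E) secE -> represents (E := F) secF ->
  \forall x \ae mu, forall q,
    rnorm (secE u x - lincomb (rational_terms q) (fun n => secE (g n) x)) =
    rnorm (secF u x - lincomb (rational_terms q) (fun n => secF (g n) x)).
Proof.
move=> rE rF; have [_ nE _ _] := rE; have [_ nF _ _] := rF.
apply: ae_forall_count => q.
apply: filterS2 (filterI (represents_comb rE u g (rational_terms q)) (nE (u - lincomb
    (rational_terms q) g)))
  (filterI (represents_comb rF u g (rational_terms q)) (nF (u - lincomb
      (rational_terms q) g))).
by move=> x [<- ->] [<- ->].
Qed.

(** The sections of an element u correspond, since the same rational
    combinations approximate both. A general measurable section is reduced to
    this case by a positive factor. *)
Lemma represents_corr (E F : bundle) secE secF (g : nat -> Gam) :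
  represents (E := E) secE -> represents (E := F) secF ->
  (\forall x \ae mu, closure (lin (range (fun n => secE (g n) x))) = setT) ->
  (\forall x \ae mu, matched_at (fun n => secE (g n)) (fun n => secF (g n)) x) /\
  (forall s, msec (m := E) s -> exists2 t, msec (m := F) t &
    \forall x \ae mu, corr (fun n => secE (g n) x) (fun n => secF (g n) x) (s x) (t x)).
Proof.
move=> rE rF dE; have [_ _ lE surjE] := rE; have [mF _ lF _] := rF.
have sec0 (G : bundle) secG : represents (E := G) secG -> \forall x \ae mu, secG 0 x = 0.
  move=> [_ nG _ _]; apply: filterS2 (nG 0) (pnorm0 Gam) => x nx zx.
  by apply: rnorm0_eq0; rewrite nx.
split.
  apply: filterS3 dE (represents_matched g 0 rE rF) (filterI (sec0 _ _ rE) (sec0 _ _ rF)).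
  move=> x dx mx [e0 f0]; split => // q.
  by have := mx q; rewrite e0 f0 !sub0r !rnormN.
move=> s ms; have [c [mc c0 Ic]] := msec_weight ms.
have [u uP] := surjE _ (msecM (scalar_measurable_rtos mc) ms) Ic.
have mV := measurable_inv_pos mc c0.
exists (section_mul (fun x => rtos (c x)^-1) (secF u)).
  by apply: msecM (mF u); exact: scalar_measurable_rtos.
apply: filterS3 uP dE (represents_matched g u rE rF) => x ux dx mx.
have H : corr (fun n => secE (g n) x) (fun n => secF (g n) x) (secE u x) (secF u x).
  by move=> e e0; have [q qe] := rational_lincomb_dense (secE u x) dx e0; exists
      (rational_terms q); rewrite -mx.
have := corr_lin (rtos (c x)^-1) H (@corr0 _ _ _ _ _ _); rewrite !addr0.
by rewrite {1}ux /section_mul scalerA -rtosM mulVf ?rtos1 ?scale1r// gt_eqF.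
Qed.

(** The generating sequences of the two bundles are interleaved into one
    sequence in the module. *)
Lemma represented_isomorphic (E F : bundle) :
  separable_bundle E -> Gamma1_isometric_to E Gam ->
  separable_bundle F -> Gamma1_isometric_to F Gam ->
  isometrically_isomorphic E F.
Proof.
move=> sepE /isometric_represents[secE rE] sepF /isometric_represents[secF rF].
have [gE dE] := represents_dense rE sepE; have [gF dF] := represents_dense rF sepF.
(* Adding vectors to a generating sequence keeps it generating. *)
pose g n := if odd n then gE n./2 else gF n./2.
have denser (G : bundle) secG h : represents (E := G) secG -> (forall n, exists m, g
    m = h n) ->
    (\forall x \ae mu, closure (lin (range (fun n => secG (h n) x))) = setT) ->
    \forall x \ae mu, closure (lin (range (fun n => secG (g n) x))) = setT.
  move=> rG hg; apply: filterS => x dx; rewrite -subTset -dx; apply: closure_subset.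
  move=> _ [n [a [y [yh ->]]]]; exists n, a, y; split => // i.
  by have [j _ <-] := yh i; have [m <-] := hg j; exists m.
have {}dE : \forall x \ae mu, closure (lin (range (fun n => secE (g n) x))) = setT.
  apply: denser dE => // n; exists n.*2.+1.
  by rewrite /g /= odd_double /= uphalf_double.
have {}dF : \forall x \ae mu, closure (lin (range (fun n => secF (g n) x))) = setT.
  by apply: denser dF => // n; exists n.*2; rewrite /g odd_double doubleK.
have [mEF cEF] := represents_corr rE rF dE; have [mFE cFE] := represents_corr rF rE dF.
have [mPhi iPhi] := corr_morphism_isometric mEF cEF.
have [mPsi _] := corr_morphism_isometric mFE cFE.
exists (corr_morphism (fun n => secE (g n)) (fun n => secF (g n))).
exists (corr_morphism (fun n => secF (g n)) (fun n => secE (g n))).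
by split => //; exact: corr_morphismK.
Qed.

End Uniqueness.

Theorem proposition5p18 (R : realType) (k : scalar_kind) (d : measure_display)
    (X : measurableType d) (mu : {measure set X -> \bar R})
    (mu_sigma_finite : sigma_finite [set: X] mu)
    (mu_complete : measure_is_complete mu)
    (Gam : L1_normed_module k mu) :
  (exists E : measurable_banach_bundle k mu, Gamma1_isometric_to E Gam) /\
  (separable_space Gam ->
     (exists2 E : measurable_banach_bundle k mu,
        separable_bundle E & Gamma1_isometric_to E Gam) /\
     (forall E F : measurable_banach_bundle k mu,
        separable_bundle E -> Gamma1_isometric_to E Gam ->
        separable_bundle F -> Gamma1_isometric_to F Gam ->
        isometrically_isomorphic E F)).
Proof.
have [df] := density_field_exists mu_sigma_finite.
have [w Iw w0] := sigma_finite_weight mu_sigma_finite.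
split.
  have dT (s : Gam) (e : R) : 0 < e -> exists2 u, setT u & rnorm (s - u) < e.
    by move=> e0; exists s => //; rewrite subrr rnorm0.
  exists (bundle_of mu_complete Iw w0 df dT); exact: bundle_of_isometric.
move=> [D cD dD]; split; last exact: (represented_isomorphic Iw w0).
(* The range of g may exceed D, which keeps it dense. *)
have [g] : $| {surj [set: nat] >-> D} |.
  by apply/pcard_geP.
have dg (s : Gam) (e : R) : 0 < e -> exists2 u, range g u & rnorm (s - u) < e.
  move=> e0; have : nbhs s [set u | rnorm (s - u) < e] by apply/nbhs_rnormP; exists e.
  rewrite nbhsE => -[V [oV Vs] Ve].
  have [u [Vu Du]] := dD V (ex_intro _ s Vs) oV.
  have [n _ gn] := @surj _ _ _ _ g u Du.
  by exists u; [exists n|exact: Ve].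
exists (bundle_of mu_complete Iw w0 df dg); last exact: bundle_of_isometric.
by apply: bundle_of_separable; exists g.
Qed.
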